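(* Let $Y=\{Y(t),\ t\in\mathbb{R}\}$ be a supOU process with characteristic quadruple $(a,b,\mu,\pi)$ and let $X(t)=\int_0^tY(s)\,ds$, $t\ge0$. Assume: (1) $P(Y(1)>x)\sim p_0\,k(x)x^{-\gamma}$ and $P(Y(1)\le-x)\sim q_0\,k(x)x^{-\gamma}$ as $x\to\infty$, for some $p_0,q_0\ge0$ with $p_0+q_0>0$, some $0<\gamma<2$ and some slowly varying function $k$; if $\gamma=1$ then $p_0=q_0$; (2) $\mathbb{E}Y(1)=0$ if the mean is finite; (3) $\pi$ has a density $p$ with $p(x)\sim\alpha\,\ell(x^{-1})x^{\alpha-1}$ as $x\to0$, for some $\alpha>0$ and some slowly varying function $\ell$; (4) $\mu([x,\infty))\sim c^+x^{-\beta}$ and $\mu((-\infty,-x])\sim c^-x^{-\beta}$ as $x\to0$, for some $c^+,c^-\ge0$ with $c^++c^->0$ and some $0\le\beta<2$; (5) the scaling function $\tau(q)=\lim_{t\to\infty}\frac{\log\mathbb{E}|X(t)|^q}{\log t}$ exists in the extended reals for every $q\in\mathbb{R}$, and $0\in\operatorname{Int}(\mathcal{D}_\tau)$, where $\mathcal{D}_\tau=\{q:\tau(q)<\infty\}$. Then: (i) If $b=0$ and $\beta<1+\alpha<\gamma$, then for every $\varepsilon$ with $0<\varepsilon<1-1/(1+\alpha)$, $$-\alpha\le\liminf_{t\to\infty}\frac{1}{\log t}\log P\left(t^{1-\varepsilon}<|X(t)|<t^{1+\varepsilon}\right)\le\limsup_{t\to\infty}\frac{1}{\log t}\log P\left(t^{1-\varepsilon}<|X(t)|<t^{1+\varepsilon}\right)\le-(\alpha-(1+\alpha)\varepsilon).$$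 (ii) If $b=0$ and $1+\alpha<\beta\le\gamma$, then for every $\varepsilon$ with $0<\varepsilon<\alpha/\beta$, $$-\alpha\le\liminf_{t\to\infty}\frac{1}{\log t}\log P\left(t^{1-\varepsilon}<|X(t)|<t^{1+\varepsilon}\right)\le\limsup_{t\to\infty}\frac{1}{\log t}\log P\left(t^{1-\varepsilon}<|X(t)|<t^{1+\varepsilon}\right)\le-(\alpha-\beta\varepsilon).$$
   Context: A supOU process is $Y(t)=\int_{\mathbb{R}_+}\int_{\mathbb{R}}e^{-\xi t+s}\mathbf{1}_{[0,\infty)}(\xi t-s)\,\Lambda(d\xi,ds)$, where $\Lambda$ is a homogeneous infinitely divisible random measure (Lévy basis) on $\mathbb{R}_+\times\mathbb{R}$ with $\log\mathbb{E}e^{i\zeta\Lambda(A)}=(\pi\times\mathrm{Leb})(A)\,\kappa_L(\zeta)$ for Borel $A$, $\pi$ a probability measure on $\mathbb{R}_+$, and $\kappa_L(\zeta)=i\zeta a-\frac{\zeta^2}{2}b+\int_{\mathbb{R}}(e^{i\zeta x}-1-i\zeta x\mathbf{1}_{[-1,1]}(x))\mu(dx)$ the cumulant function of an infinitely divisible law with Lévy–Khintchine triplet $(a,b,\mu)$; $(a,b,\mu,\pi)$ is the characteristic quadruple. *)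

(* Defs.v *)
From HB Require Import structures.
From mathcomp Require Import all_boot all_order all_algebra.
From mathcomp Require Import all_classical all_reals all_analysis.
Set Implicit Arguments. Unset Strict Implicit. Unset Printing Implicit Defensive.
Import Order.TTheory GRing.Theory Num.Theory.
Import numFieldNormedType.Exports.
Local Open Scope classical_set_scope.
Local Open Scope ring_scope.

Section defs.
Variable R : realType.

Definition slowly_varying (k : R -> R) : Prop :=
  measurable_fun setT k /\
  (\forall x \near +oo, 0 < k x) /\
  (forall lam : R, 0 < lam -> (k (lam * x) / k x) @[x --> +oo] --> (1 : R)).

Definition levy_measure (mu : {measure set R -> \bar R}) : Prop :=
  mu [set 0] = 0%E /\
  (\int[mu]_x (Num.min 1 (x ^+ 2))%:E < +oo)%E.

Definition supou_kernel (t : R) (z : R * R) : R :=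
  if z.2 <= z.1 * t then expR (z.2 - z.1 * t) else 0.

(** Real and imaginary parts of the cumulant function kappa_L of the
    infinitely divisible law with Levy-Khintchine triplet (a,b,mu). *)
Definition kappa_re (b : R) (mu : {measure set R -> \bar R}) (z : R) : R :=
  - (z ^+ 2 * b / 2) + Rintegral mu setT (fun x => cos (z * x) - 1).

Definition kappa_im (a : R) (mu : {measure set R -> \bar R}) (z : R) : R :=
  z * a + Rintegral mu setT
     (fun x => sin (z * x) - z * x * (\1_(`[-1, 1]%classic) x)).

(** Y is a supOU process with characteristic quadruple (a,b,mu,pi):
    its finite-dimensional distributions are those of
    Y(t) = \int\int f_t(xi,s) Lambda(dxi,ds), i.e. for all t_1..t_n, zeta_1..zeta_n,
    E exp(i sum zeta_j Y(t_j)) = exp( \int\int kappa_L(sum zeta_j f_{t_j}) d(pi x Leb) ),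
    written through real and imaginary parts. *)
Definition supOU {d} {T : measurableType d} (P : probability T R)
  (Y : R -> T -> R) (a b : R) (mu : {measure set R -> \bar R})
  (pi : probability R R) : Prop :=
  0 <= b /\ levy_measure mu /\ pi `]-oo, 0[%classic = 0%E /\
  (forall t, measurable_fun setT (Y t)) /\
  forall (n : nat) (ts zs : 'I_n -> R),
    let g := fun z : R * R => \sum_(j < n) zs j * supou_kernel (ts j) z in
    let Z := fun w : T => \sum_(j < n) zs j * Y (ts j) w in
    let KR := Rintegral (pi \x lebesgue_measure)%E setT (kappa_re b mu \o g) in
    let KI := Rintegral (pi \x lebesgue_measure)%E setT (kappa_im a mu \o g) in
    (pi \x lebesgue_measure)%E.-integrable setT (EFin \o (kappa_re b mu \o g)) /\
    (pi \x lebesgue_measure)%E.-integrable setT (EFin \o (kappa_im a mu \o g)) /\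
    ('E_P[cos \o Z] = (expR KR * cos KI)%:E)%E /\
    ('E_P[sin \o Z] = (expR KR * sin KI)%:E)%E.

Definition eabspow (x q : R) : \bar R :=
  if x == 0 then (if q < 0 then +oo%E else if q == 0 then 1%E else 0%E)
  else (`|x| `^ q)%:E.

Definition eln (x : \bar R) : \bar R :=
  match x with
  | r%:E => if 0 < r then (ln r)%:E else -oo%E
  | +oo%E => +oo%E
  | -oo%E => -oo%E
  end.

Definition liminf_pinfty (f : R -> \bar R) : \bar R :=
  ereal_sup [set ereal_inf (f @` `[M, +oo[%classic) | M in [set: R]].
Definition limsup_pinfty (f : R -> \bar R) : \bar R :=
  ereal_inf [set ereal_sup (f @` `[M, +oo[%classic) | M in [set: R]].

End defs.

Definition integrated {R : realType} {T : Type} (Y : R -> T -> R) (t : R) (w : T) : R :=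
  Rintegral lebesgue_measure `[0, t]%classic (fun s => Y s w).

(** the scaling function tau(q) = lim_{t->oo} log E|X(t)|^q / log t
    (lim in the extended reals; the existence is assumed separately) *)
Definition moment {R : realType} {d} {T : measurableType d} (P : probability T R)
  (X : R -> T -> R) (q t : R) : \bar R :=
  (\int[P]_w eabspow (X t w) q)%E.

Definition log_ratio {R : realType} {d} {T : measurableType d} (P : probability T R)
  (X : R -> T -> R) (q t : R) : \bar R :=
  (eln (moment P X q t) * ((ln t)^-1)%:E)%E.

Definition tau {R : realType} {d} {T : measurableType d} (P : probability T R)
  (X : R -> T -> R) (q : R) : \bar R :=
  lim (log_ratio P X q t @[t --> +oo]).

Definition log_prob_ratio {R : realType} {d} {T : measurableType d} (P : probability T R)
  (X : R -> T -> R) (eps t : R) : \bar R :=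
  (eln (P [set w | (t `^ (1 - eps) < `|X t w| < t `^ (1 + eps))%R]) * ((ln t)^-1)%:E)%E.

(* Main.v *)
Require Import Defs.
From HB Require Import structures.
From mathcomp Require Import all_boot all_order all_algebra.
From mathcomp Require Import all_classical all_reals all_analysis.
From mathcomp Require Import measurable_realfun ring lra.
Set Implicit Arguments. Unset Strict Implicit. Unset Printing Implicit Defensive.
Import Order.TTheory GRing.Theory Num.Theory.
Import numFieldNormedType.Exports.
Local Open Scope classical_set_scope.
Local Open Scope ring_scope.

(** Both cases are instances of one estimate, with an exponent [q0] equal to
    [1 + alpha] in (i) and to [beta] in (ii): the rate lies between [- alpha] and
    [- (alpha - q0 * eps)].

    The modulus of the characteristic function of [X t] is [exp (- I)], where [I] is
    the integral of the real exponent [psi mu] of the Levy measure along the kernel of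
    [X t]; it is obtained as an L1 limit of Riemann sums of [Y].  The tails of [mu] near
    [0] and the moments of [Y 1] give [psi mu z <= K (|z|^r1 + |z|^r2)] for
    [r2 < q0 < r1].  The kernel is at most [min t (1 + 1/xi)], so its r-th moment is
    [O (t^(r - a))] for every [a < alpha].  Integrating [1 - cos] dyadically turns this
    into [E |X t|^q = O (t^(q0 - alpha + delta))] for [q] close to [q0].

    Upper bound: Markov's inequality for [|X t| >= t^(1 - eps)].  Lower bound: jumps
    with [xi <= 1/t] have pi-mass about [t^(- alpha)] and contribute a kernel of size
    [t], whence [1 - Re E exp (i zeta X t / t) >= c t^(- alpha - delta)]; the
    contribution of [|X t| <= t^(1 - eps)] to the left-hand side and the probability of
    [|X t| >= t^(1 + eps)] are of smaller order by the moment bound. *)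

(** * Elementary inequalities *)

(** [supOU] prescribes only finite-dimensional characteristic functions, so [X t] is out of reach
    without Riemann sums. The passage to the limit is made in L1, which requires centred [Y t] with
    moments above order 1; these exist because [q0 >= 1 + alpha > 1]. The imaginary exponent,
    carrying drift and compensator, is never estimated: an independent copy turns the characteristic
    function into its squared modulus, and Jensen's inequality with the zero mean removes the copy
    again. Exponents never exceed 2, the range where [1 - cos x <= 2 |x|^r]. Slow variation enters
    only through limiting ratios at a factor 2; iterating such a ratio costs an arbitrarily small
    power, which the logarithmic scale absorbs. The value of [q0] is the larger of two thresholds:
    [1 + alpha], from the condition [1 + a <= r] under which the kernel moment is [O(t^(r - a))],
    and [beta], from integrability of the small jumps. The condition [q0 <= gamma] provides the
    moments of [Y 1] below order [q0]. *)

Section real_functions.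
Context {R : realType}.
Implicit Types x y z u : R.

Lemma cos_lipschitz x y : `|cos x - cos y| <= `|x - y|.
Proof.
wlog xy : x y / x < y.
  move=> H; have [/H//|yx|->] := ltgtP x y; last by rewrite !subrr.
  by rewrite distrC [leRHS]distrC; exact: H.
have [c _ e] : exists2 c, c \in `]x, y[%R & cos y - cos x = - sin c * (y - x).
  apply: MVT => //; last exact/continuous_subspaceT/continuous_cos.
rewrite distrC e normrM [leRHS]distrC ler_piMl// normrN; exact: sin_max.
Qed.

Lemma sin_lipschitz x y : `|sin x - sin y| <= `|x - y|.
Proof.
wlog xy : x y / x < y.
  move=> H; have [/H//|yx|->] := ltgtP x y; last by rewrite !subrr.
  by rewrite distrC [leRHS]distrC; exact: H.
have [c _ e] : exists2 c, c \in `]x, y[%R & sin y - sin x = cos c * (y - x).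
  apply: MVT => //; last exact/continuous_subspaceT/continuous_sin.
rewrite distrC e normrM [leRHS]distrC ler_piMl//; exact: cos_max.
Qed.

(** Interpolation between the bound 2, enough for [|x| >= 1], and the half-angle bound by [x^2],
    where [|x|^2 <= |x|^r] for [|x| < 1] because [r <= 2]. *)
Lemma onem_cos_le x r : 0 <= r <= 2 -> 1 - cos x <= 2 * `|x| `^ r.
Proof.
move=> /andP[r0 r2]; have [x1|x1] := leP 1 `|x|.
  have : 1 <= `|x| `^ r by rewrite -(powRr0 `|x|) ler_powR.
  have := cos_geN1 x; lra.
have [->|x0] := eqVneq x 0.
  by rewrite cos0 subrr mulr_ge0// powR_ge0.
have x2 : `|x| ^+ 2 <= `|x| `^ r.
  by rewrite -powR_mulrn// ger_powR// ltW ?normr_gt0 ?x0.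
have e : 1 - cos x = 2 * sin (x / 2) ^+ 2.
  have := cos_mulr2n (x / 2); rewrite -[x / 2 *+ 2]mulr_natr divfK// => ->.
  by rewrite cos2sin2; ring.
have : sin (x / 2) ^+ 2 <= `|x / 2| ^+ 2.
  rewrite -[leLHS]real_normK ?num_real// lerXn2r ?nnegrE//.
  by have := sin_lipschitz (x / 2) 0; rewrite sin0 !subr0.
rewrite normrM [ `|2^-1| ]gtr0_norm ?invr_gt0// e; have := sqr_ge0 `|x|; lra.
Qed.

Lemma cos_ltr1 x : 0 < x <= 1 -> 0 < 1 - cos x.
Proof.
move=> /andP[x0 x1]; rewrite subr_gt0 -[ltRHS]cos0 ltr_cos//.
  by rewrite in_itv/= lexx pi_ge0.
by have := @pi_ge2 R; rewrite in_itv/= (ltW x0)/= => ?; lra.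
Qed.

(** [1 - cos] increases on [[0, pi]], and the cap 2 keeps both points there since [pi >= 2]. *)
Lemma le_onem_cos x y : 0 <= x -> x <= `|y| <= 2 -> 1 - cos x <= 1 - cos y.
Proof.
have pi2 := @pi_ge2 R.
move=> x0 /andP[xy y2]; rewrite -(cos_norm y) lerB// leNgt ltr_cos ?in_itv/=.
- by rewrite -leNgt.
- by rewrite normr_ge0/=; lra.
- by rewrite x0/=; lra.
Qed.

Lemma dyadic_bracket x : 1 <= x -> exists k : nat, 2 ^+ k <= x < 2 ^+ k.+1.
Proof.
(* The exponent is the binary logarithm of the integer part [n]: between integers, [n < 2^(k+1)]
   means [n + 1 <= 2^(k+1)], hence [x < 2^(k+1)]. *)
move=> x1; pose n := Num.truncn x.
have /andP[nx xn] : n%:R <= x < n.+1%:R by rewrite truncn_itv// (le_trans ler01).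
have n0 : (0 < n)%N by rewrite truncn_gt0.
exists (trunc_log 2 n); rewrite -!natrX; apply/andP; split.
  by rewrite (le_trans _ nx)// ler_nat trunc_logP.
by rewrite (lt_le_trans xn)// ler_nat trunc_log_ltn.
Qed.

End real_functions.

Section series_domination.
Local Open Scope ereal_scope.

(** Stands in for a partition into dyadic shells: since every point is dominated by some [phi k],
    [g] is below the whole series, and the shells may overlap. All dyadic estimates of the
    development go through it. *)
Lemma integral_le_geometric d (T : measurableType d) (R : realType)
    (mu : {measure set T -> \bar R}) (D : set T) (g : T -> \bar R)
    (phi : (T -> \bar R)^nat) (C th : R) :
  measurable D -> measurable_fun D g -> (forall x, D x -> 0 <= g x) ->
  (forall k, measurable_fun D (phi k)) ->
  (forall k x, D x -> 0 <= phi k x) ->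
  (forall x, D x -> exists k, g x <= phi k x) ->
  (0 < th < 1)%R -> (0 <= C)%R ->
  (forall k, \int[mu]_(x in D) phi k x <= (C * th ^+ k)%:E) ->
  \int[mu]_(x in D) g x <= (C / (1 - th))%:E.
Proof.
move=> mD mg g0 mphi phi0 gphi /andP[th0 th1] C0 iphi.
have := @integral_nneseries _ _ _ mu _ mD _ mphi phi0 => e.
apply: (@le_trans _ _ (\int[mu]_(x in D) \sum_(n <oo) phi n x)).
  apply: ge0_le_integral => //.
  - by apply: ge0_emeasurable_sum => // k x Dx _; exact: phi0.
  move=> x Dx; have [k /le_trans] := gphi x Dx; apply.
  apply: (@le_trans _ _ (\sum_(0 <= i < k.+1) phi i x)).
    by rewrite big_nat_recr//= leeDr// sume_ge0// => i _; exact: phi0.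
  by apply: nneseries_lim_ge => i _ _; exact: phi0.
rewrite e; apply: lime_le.
  by apply: is_cvg_nneseries => n _ _; apply: integral_ge0 => x /phi0.
near=> n; apply: (@le_trans _ _ (\sum_(0 <= i < n) (C * th ^+ i)%:E)).
  by apply: lee_sum => i _.
rewrite sumEFin lee_fin.
have -> : (\sum_(0 <= i < n) C * th ^+ i = series (geometric C th) n)%R by [].
by rewrite geometric_le_lim// gtr0_norm.
Unshelve. all: by end_near. Qed.

End series_domination.

(** * Moments from characteristic functions *)

Lemma expr_powR (R : realType) (x r : R) n : 0 <= x -> (x ^+ n) `^ r = (x `^ r) ^+ n.
Proof. by move=> x0; rewrite -(powR_mulrn _ x0) -(powR_mulrn _ (powR_ge0 x r)) powRAC. Qed.

Lemma gt0_powRD (R : realType) (x r s : R) : 0 < x ->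
  x `^ (r + s) = x `^ r * x `^ s.
Proof. by move=> x0; rewrite powRD// implybE (gt_eqF x0) orbT. Qed.

(* Sums the dyadic bounds [1 - cos (z x) >= 1 - cos (1/2)], valid for [1/2 <= |z x| <= 1]. *)
Definition cosK {R : realType} (q r : R) : R :=
  ((1 - cos (1 / 2)) * (1 - 2 `^ (q - r)))^-1.

Lemma powR2_lt1 (R : realType) (q r : R) : q < r -> 0 < (2 : R) `^ (q - r) < 1.
Proof.
move=> qr; rewrite powR_gt0//= /powR pnatr_eq0/= expR_lt1.
by rewrite pmulr_llt0 ?subr_lt0// ln_gt0// ltr1n.
Qed.

(** Where [z0 |X| < 1] the integrand is at most [z0^(-q)]. On the shell [2^k <= z0 |X| < 2^(k+1)]
    the frequency [z0 / 2^(k+1)] makes [1 - cos] at least a constant, and the shell costs a multiple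
    of [2^((k+1)(q-r))], summable since [q < r]. *)
Lemma moment_le_onem_cos d (T : measurableType d) (R : realType)
    (nu : {measure set T -> \bar R}) (X : T -> R) (A z0 q r : R) :
  measurable_fun setT X -> (nu setT <= 1)%E -> 0 < q < r -> 0 < z0 -> 0 <= A ->
  (forall z, 0 < z <= z0 ->
    (\int[nu]_x (1 - cos (z * X x))%:E <= (A * z `^ r)%:E)%E) ->
  (\int[nu]_x (`|X x| `^ q)%:E <=
    (z0 `^ (- q) + cosK q r * A * z0 `^ (r - q))%:E)%E.
Proof.
move=> mX nu1 /andP[q0 qr] z00 A0 hX.
have mXq : measurable_fun setT (fun x => (`|X x| `^ q)%:E).
  apply/measurable_EFinP; apply: (measurableT_comp (measurable_powR q)).
  exact: measurableT_comp.
have mXD : measurable_fun setT (fun x => z0 * `|X x|).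
  by apply: measurable_funM => //; exact: measurableT_comp.
pose D := [set x | 1 <= z0 * `|X x|].
have mD : measurable D.
  rewrite (_ : D = setT `&` (fun x => z0 * `|X x|) @^-1` `[1, +oo[%classic).
    exact: mXD.
  by rewrite setTI; apply/seteqP; split => x; rewrite /D/= in_itv/= andbT.
pose c : R := 1 - cos (1 / 2).
have c0 : 0 < c by apply: cos_ltr1; lra.
have /andP[t0 t1] := powR2_lt1 qr.
set th := (2 : R) `^ (q - r) in t0 t1.
have HD : (\int[nu]_(x in D) (`|X x| `^ q)%:E <=
    ((c^-1 * A * z0 `^ (r - q)) / (1 - th))%:E)%E.
  pose z k := z0 / 2 ^+ k.+1.
  pose phi k x := (z0 `^ (- q) * (2 ^+ k.+1) `^ q / c * (1 - cos (z k * X x)))%:E.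
  have mphi k : measurable_fun setT (fun x => (1 - cos (z k * X x))%:E).
    apply/measurable_EFinP; apply: measurable_funB => //.
    apply: measurableT_comp => //; first exact: continuous_measurable_fun (@continuous_cos R).
    exact: measurable_funM.
  have phiE k : phi k = (fun x => (z0 `^ (- q) * (2 ^+ k.+1) `^ q / c)%:E *
      (1 - cos (z k * X x))%:E)%E by [].
  have C0 k : 0 <= z0 `^ (- q) * (2 ^+ k.+1) `^ q / c.
    by rewrite divr_ge0 ?mulr_ge0 ?powR_ge0// ltW.
  have phi0 k x : (0 <= phi k x)%E.
    by rewrite lee_fin mulr_ge0// subr_ge0 cos_le1.
  apply: (@integral_le_geometric _ _ _ _ _ _ phi) => //.
  - exact: measurable_funTS.
  - move=> k; rewrite phiE; apply: measurable_funeM.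
    exact: measurable_funTS.
  - move=> x Dx; have [k /andP[k1 k2]] := dyadic_bracket Dx.
    exists k; rewrite lee_fin.
    have k0 : 0 < 2 ^+ k.+1 :> R by rewrite exprn_gt0.
    have : c <= 1 - cos (z k * X x).
      apply: le_onem_cos => //.
      rewrite normrM [ `|z k| ]gtr0_norm ?divr_gt0// /z mulrAC.
      rewrite ler_pdivlMr// exprS mulrA mulfVK// mul1r k1/=.
      rewrite ler_pdivrMr// -exprS (le_trans (ltW k2))//.
      by lra.
    move=> cc; apply: (@le_trans _ _ (z0 `^ (- q) * (2 ^+ k.+1) `^ q)).
      rewrite -(mulKf (lt0r_neq0 z00) `|X x|) mulrC powRM ?invr_ge0//; last 2 first.
      - by rewrite mulr_ge0// ltW.
      - exact: ltW.
      rewrite mulrC -(powR_inv1 (ltW z00)) -powRrM mulN1r.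
      rewrite ler_wpM2l ?powR_ge0// ge0_ler_powR// ?nnegrE//; first exact: ltW.
        by rewrite mulr_ge0// ltW.
      exact: ltW.
    rewrite -mulrA ler_peMr ?mulr_ge0 ?powR_ge0//.
    by rewrite mulrC ler_pdivlMr// mul1r.
  - by rewrite t0.
  - by rewrite !mulr_ge0 ?powR_ge0 ?invr_ge0// ltW.
  - move=> k; apply: (@le_trans _ _ (\int[nu]_x phi k x)%E).
      apply: ge0_subset_integral => //.
      by rewrite phiE; exact: measurable_funeM.
    rewrite phiE ge0_integralZl_EFin//.
    apply: (@le_trans _ _ ((z0 `^ (- q) * (2 ^+ k.+1) `^ q / c)%:E * (A * (z k) `^ r)%:E)%E).
      apply: lee_wpmul2l; first by rewrite lee_fin.
      apply: hX; rewrite divr_gt0//= ler_piMr ?(ltW z00)// invf_le1//.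
      by rewrite exprn_ege1// ler1n.
    rewrite -EFinM lee_fin.
    (* Powers of [z0] collect to [z0^(r-q)] and powers of [2^(k+1)] to [th^(k+1)]; the surplus
       factor [th <= 1] is then dropped. *)
    rewrite [leLHS](_ : _ = c^-1 * A * (z0 `^ (- q) * z0 `^ r) * ((2 ^+ k.+1) `^ q * (2 ^+ k.+1) `^ (- r))).
      have k0 : 0 < 2 ^+ k.+1 :> R by rewrite exprn_gt0.
      rewrite -(gt0_powRD _ _ k0) -(gt0_powRD _ _ z00).
      rewrite expr_powR// exprS (addrC _ r) -/th mulrA.
      apply: ler_wpM2r; first by rewrite exprn_ge0// ltW.
      rewrite ler_piMr//; last exact: ltW.
      by rewrite !mulr_ge0 ?powR_ge0 ?invr_ge0// ltW.
    rewrite /z (powRM _ (ltW z00)) ?invr_ge0 ?exprn_ge0//.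
    rewrite -[((2 ^+ k.+1)^-1)]powR_inv1 ?exprn_ge0// -powRrM mulN1r.
    by ring.
have mR : measurable_fun setT ((fun x => (`|X x| `^ q)%:E) \_ D).
  by apply/(measurable_restrictT _ mD); exact: measurable_funTS.
have R0 x : (0 <= ((fun x => (`|X x| `^ q)%:E) \_ D) x)%E by exact: erestrict_ge0.
apply: (@le_trans _ _ (\int[nu]_x ((z0 `^ (- q))%:E +
    ((fun x => (`|X x| `^ q)%:E) \_ D) x))%E).
  apply: ge0_le_integral => //.
  - exact: emeasurable_funD.
  move=> x _; rewrite patchE; case: ifPn => [_|xD].
    by apply: leeDr; rewrite lee_fin powR_ge0.
  (* Outside [D] the restriction takes the default [point], which is 0 in the extended reals. *)
  rewrite (_ : point = 0%E)// adde0 lee_fin powRN -[leRHS]powR_inv1 ?powR_ge0// -powRrM mulrN1 -mulN1r powRrM (powR_inv1 (ltW z00)).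
  apply: ge0_ler_powR; rewrite ?nnegrE//; first exact: ltW.
    by rewrite invr_ge0 ltW.
  move: xD; rewrite notin_setE /D/= => /negP; rewrite -ltNge.
  by rewrite -ltr_pdivlMl// mulr1 => /ltW.
rewrite ge0_integralD//; last by move=> x _; rewrite lee_fin powR_ge0.
rewrite EFinD -integral_mkcond; apply: leeD.
  rewrite (integral_cst nu measurableT (z0 `^ (- q))%:E) -[leRHS]mule1.
  by apply: lee_wpmul2l => //; rewrite lee_fin powR_ge0.
apply: le_trans HD _; rewrite lee_fin /cosK invfM -/th -/c.
by rewrite le_eqVlt; apply/orP; left; apply/eqP; ring.
Qed.

Lemma measurable_cosM d (T : measurableType d) (R : realType) (X : T -> R) (z : R) : measurable_fun setT X ->
  measurable_fun setT (fun w => cos (z * X w)).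
Proof.
move=> mX; apply: measurableT_comp; last exact: measurable_funM.
exact: continuous_measurable_fun (@continuous_cos R).
Qed.

Lemma measurable_sinM d (T : measurableType d) (R : realType) (X : T -> R) (z : R) : measurable_fun setT X ->
  measurable_fun setT (fun w => sin (z * X w)).
Proof.
move=> mX; apply: measurableT_comp; last exact: measurable_funM.
exact: continuous_measurable_fun (@continuous_sin R).
Qed.

Section probability_integrals.
Context d (T : measurableType d) (R : realType) (P : probability T R).
Implicit Types X : T -> R.

Lemma bounded_integrable (f : T -> R) (M : R) :
  measurable_fun setT f -> (forall x, `|f x| <= M) ->
  P.-integrable setT (EFin \o f).
Proof.
move=> mf fM; apply: measurable_bounded_integrable => //.
  by rewrite (le_lt_trans (probability_le1 P measurableT))// ltry.
by exists M; split; [exact: num_real|move=> y My x _ /=; rewrite (le_trans (fM x))// ltW].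
Qed.

Lemma integrable_cosM X (z : R) : measurable_fun setT X ->
  P.-integrable setT (EFin \o (fun w => cos (z * X w))).
Proof.
move=> mX; apply: (@bounded_integrable _ 1) => [|x]; first exact: measurable_cosM.
exact: cos_max.
Qed.

Lemma integrable_sinM X (z : R) : measurable_fun setT X ->
  P.-integrable setT (EFin \o (fun w => sin (z * X w))).
Proof.
move=> mX; apply: (@bounded_integrable _ 1) => [|x]; first exact: measurable_sinM.
exact: sin_max.
Qed.

Lemma integrable_EFinM (a : R) (f : T -> R) : P.-integrable setT (EFin \o f) ->
  P.-integrable setT (EFin \o (fun w => a * f w)).
Proof. by move=> /(integrableZl measurableT a). Qed.

Lemma integrable_EFinD (f g : T -> R) : P.-integrable setT (EFin \o f) ->
  P.-integrable setT (EFin \o g) -> P.-integrable setT (EFin \o (fun w => f w + g w)).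
Proof. by move=> fi gi; have := integrableD measurableT fi gi. Qed.

Lemma integrable_EFinB (f g : T -> R) : P.-integrable setT (EFin \o f) ->
  P.-integrable setT (EFin \o g) -> P.-integrable setT (EFin \o (fun w => f w - g w)).
Proof. by move=> fi gi; have := integrableB measurableT fi gi. Qed.

Lemma EFin_Rintegral (f : T -> R) : P.-integrable setT (EFin \o f) ->
  ((\int[P]_x f x)%:E = \int[P]_x (f x)%:E)%E.
Proof. by move=> fi; rewrite /Rintegral fineK// integrable_fin_num. Qed.

Lemma Rintegral_cst_probability (a : R) : \int[P]_x a = a.
Proof.
rewrite /Rintegral.
rewrite (integral_cst P measurableT a%:E).
have -> : (P : {measure set T -> \bar R}) setT = 1%E by exact: probability_setT.
by rewrite mule1.
Qed.

(** Young's inequality for the product of [y] and 1, with conjugate exponents [q] and [q / (q - 1)],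
    multiplied by [q]. The second exponent degenerates at [q = 1], treated apart. *)
Lemma bernoulli_powR (y q : R) : 0 <= y -> 1 <= q -> 1 + q * (y - 1) <= y `^ q.
Proof.
move=> y0; rewrite le_eqVlt => /predU1P[<-|q1].
  by rewrite powRr1// mul1r subrKC.
have q0 : 0 < q by rewrite (lt_trans _ q1).
have := @conjugate_powR R y 1 q (q / (q - 1)) y0 ler01 q0.
rewrite divr_gt0 ?subr_gt0// => /(_ isT).
rewrite powR1 mulr1.
have qn : q != 0 by rewrite gt_eqF.
have qn1 : q - 1 != 0 by rewrite gt_eqF// subr_gt0.
have -> : q^-1 + (q / (q - 1))^-1 = 1 by field; rewrite qn ?qn1.
move=> /(_ erefl) h; have {h} : q * y <= q * (y `^ q / q + 1 / (q / (q - 1))).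
  by rewrite ler_pM2l.
have -> : q * (y `^ q / q + 1 / (q / (q - 1))) = y `^ q + (q - 1).
  by field; rewrite qn ?qn1.
by lra.
Qed.

(** With [m = |E X|], Bernoulli's inequality at [|X| / m] bounds [|X|^q] below by the tangent line
    at [m]; integrating it and using [E |X| >= m] gives the claim. The cases [m = 0] and infinite
    moment are separated because the tangent argument needs a positive [m] and an integrable
    power. *)
Lemma jensen_powR X (q : R) : 1 <= q -> P.-integrable setT (EFin \o X) ->
  ((`|\int[P]_x X x| `^ q)%:E <= \int[P]_x (`|X x| `^ q)%:E)%E.
Proof.
move=> q1 iX; have mX : measurable_fun setT X.
  by apply/measurable_EFinP; case/integrableP : iX.
have mXq : measurable_fun setT (fun x => `|X x| `^ q).
  apply: (measurableT_comp (measurable_powR q)); exact: measurableT_comp.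
have [Xoo|] := eqVneq (\int[P]_x (`|X x| `^ q)%:E)%E +oo%E.
  by rewrite Xoo leey.
rewrite -ltey => Xoo.
have iXq : P.-integrable setT (EFin \o (fun x => `|X x| `^ q)).
  apply/integrableP; split; first exact/measurable_EFinP.
  rewrite (le_lt_trans _ Xoo)//; apply: ge0_le_integral => //=.
  - by apply/measurable_EFinP; exact: measurableT_comp.
  - exact/measurable_EFinP.
  - by move=> x _; rewrite lee_fin ger0_norm ?powR_ge0.
set m := `|\int[P]_x X x|; have := normr_ge0 (\int[P]_x X x); rewrite -/m.
rewrite le_eqVlt => /predU1P[<-|m0].
  rewrite powR0 ?gt_eqF ?(lt_le_trans _ q1)//.
  by apply: integral_ge0 => x _; rewrite lee_fin powR_ge0.
rewrite -EFin_Rintegral// lee_fin.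
have iaX : P.-integrable setT (EFin \o (fun x => `|X x|)) by exact: integrable_norm.
have mE : m <= \int[P]_x `|X x| by exact: le_normr_Rintegral.
have i1 : P.-integrable setT (EFin \o (fun x => m `^ q * (q / m) * `|X x|)).
  exact: integrable_EFinM.
have i2 : P.-integrable setT (EFin \o (fun=> m `^ q * (1 - q))).
  apply: (@bounded_integrable _ `|m `^ q * (1 - q)|) => //.
apply: (@le_trans _ _ (\int[P]_x (m `^ q * (q / m) * `|X x| + m `^ q * (1 - q)))).
  rewrite RintegralD// RintegralZl// Rintegral_cst_probability.
  rewrite -!mulrA -mulrDr -[leLHS]mulr1 ler_wpM2l ?powR_ge0//.
  have : q * 1 <= q * (m^-1 * \int[P]_x `|X x|).
    by rewrite ler_pM2l ?(lt_le_trans _ q1)// mulrC ler_pdivlMr// mul1r.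
  by lra.
apply: le_Rintegral => //.
  exact: integrable_EFinD.
move=> x _; have -> : `|X x| `^ q = m `^ q * (`|X x| / m) `^ q.
  rewrite -(powRM _ (ltW m0)); last by rewrite divr_ge0// ltW.
  congr (_ `^ _).
  by rewrite mulrC divfK// gt_eqF.
rewrite -mulrA -mulrDr ler_wpM2l ?powR_ge0//.
apply: le_trans (bernoulli_powR _ q1); last by rewrite divr_ge0// ltW.
by rewrite le_eqVlt; apply/orP; left; apply/eqP; ring.
Qed.

Lemma integral_cosB X (z : R) : measurable_fun setT X ->
  (\int[P \x P]_w (1 - cos (z * (X w.1 - X w.2)))%:E =
  (1 - (\int[P]_w cos (z * X w)) ^+ 2 - (\int[P]_w sin (z * X w)) ^+ 2)%:E)%E.
Proof.
move=> mX; set c := (\int[P]_w cos _)%R; set s := (\int[P]_w sin _)%R.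
have ic := integrable_cosM z mX; have iS := integrable_sinM z mX.
have i1 : P.-integrable setT (EFin \o cst (1 : R)).
  by apply: (@bounded_integrable _ 1) => // x; rewrite normr1.
(* Used twice: for the inner integral, with [a] and [b] the cosine and sine at a fixed first
   variable, and for the outer one, with [a = c] and [b = s]. *)
have L (a b : R) : (\int[P]_w (1 - (a * cos (z * X w) + b * sin (z * X w))) = 1 - (a * c + b * s))%R.
  have ia : P.-integrable setT (EFin \o (fun w => a * cos (z * X w))) by exact: integrable_EFinM.
  have ib : P.-integrable setT (EFin \o (fun w => b * sin (z * X w))) by exact: integrable_EFinM.
  rewrite RintegralB//=; last exact: integrable_EFinD.
  by rewrite RintegralD// !RintegralZl// Rintegral_cst_probability.
have iL (a b : R) : P.-integrable setT (EFin \o (fun w => 1 - (a * cos (z * X w) + b * sin (z * X w)))).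
  apply: (@bounded_integrable _ (1 + (`|a| + `|b|))) => [|x].
    apply: measurable_funB => //; apply: measurable_funD; apply: measurable_funM => //.
      exact: measurable_cosM.
    exact: measurable_sinM.
  rewrite (le_trans (ler_normB _ _))// normr1 lerD2l (le_trans (ler_normD _ _))//.
  rewrite lerD// normrM ler_piMr ?cos_max//; exact: sin_max.
have mD : measurable_fun setT (fun w : T * T => X w.1 - X w.2).
  by apply: measurable_funB; exact: measurableT_comp.
rewrite fubini_tonelli1//=; last first.
  by apply/measurable_EFinP; apply: measurable_funB => //; exact: measurable_cosM.
rewrite /fubini_F/=.
transitivity (\int[P]_x (1 - (c * cos (z * X x) + s * sin (z * X x)))%:E)%E.
  apply: eq_integral => x _; rewrite (mulrC c) (mulrC s) -[in RHS]L.
  rewrite EFin_Rintegral//; apply: eq_integral => y _.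
  by rewrite mulrBr cosB.
rewrite -EFin_Rintegral// L; congr (_%:E); ring.
Qed.

(* [1 - c^2 - s^2] is [E (1 - cos (z (X - X')))] for an independent copy [X'] of [X],
   and [E |X|^q <= E |X - X'|^q] by Jensen's inequality since [X'] is centred. *)
Lemma moment_le_char X (A z0 q r : R) :
  P.-integrable setT (EFin \o X) -> \int[P]_w X w = 0 ->
  1 <= q < r -> 0 < z0 -> 0 <= A ->
  (forall z, 0 < z <= z0 ->
    1 - (\int[P]_w cos (z * X w)) ^+ 2 - (\int[P]_w sin (z * X w)) ^+ 2 <=
    A * z `^ r) ->
  (\int[P]_x (`|X x| `^ q)%:E <=
    (z0 `^ (- q) + cosK q r * A * z0 `^ (r - q))%:E)%E.
Proof.
move=> iX X0 /andP[q1 qr] z00 A0 hX.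
have mX : measurable_fun setT X by apply/measurable_EFinP; case/integrableP : iX.
have mD : measurable_fun setT (fun w : T * T => X w.1 - X w.2).
  by apply: measurable_funB; exact: measurableT_comp.
have mpq d' (T' : measurableType d') (f : T' -> R) : measurable_fun setT f ->
    measurable_fun setT (fun x => (`|f x| `^ q)%:E).
  move=> mf; apply/measurable_EFinP; apply: (measurableT_comp (measurable_powR q)).
  exact: measurableT_comp.
apply: (@le_trans _ _ (\int[P \x P]_w (`|X w.1 - X w.2| `^ q)%:E)%E).
  rewrite fubini_tonelli1//=; last first.
    exact: (mpq _ _ (fun w : T * T => X w.1 - X w.2)).
  rewrite /fubini_F; apply: ge0_le_integral => //.
  - exact: mpq.
  - apply: (@measurable_fun_fubini_tonelli_F _ _ _ _ _ _ (fun w : T * T => (`|X w.1 - X w.2| `^ q)%:E)).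
      exact: (mpq _ _ (fun w : T * T => X w.1 - X w.2)).
    by move=> w; rewrite lee_fin powR_ge0.
  move=> x _ /=.
  have iC : P.-integrable setT (EFin \o (fun=> X x)).
    by apply: (@bounded_integrable _ `|X x|).
  have iB : P.-integrable setT (EFin \o (fun w => X x - X w)).
    exact: integrable_EFinB.
  apply: le_trans (jensen_powR q1 iB); rewrite lee_fin.
  by rewrite RintegralB// X0 Rintegral_cst_probability subr0.
apply: moment_le_onem_cos => //.
- by have /= -> := probability_setT (P \x P)%E.
- by rewrite (lt_le_trans ltr01).
- by move=> z /hX; rewrite integral_cosB.
Qed.

End probability_integrals.

(** * Regular variation *)

Section affine_change_of_variables.
Context {R : realType}.
Local Notation leb := (@lebesgue_measure R).
Local Open Scope ereal_scope.

Lemma measurable_affine (c e : R) : measurable_fun setT (fun v : R => c * v + e)%R.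
Proof. by apply: measurable_funD => //; exact: measurable_funM. Qed.

(** [c] times the image of Lebesgue measure under [v -> c v + e] agrees with Lebesgue measure on
    half-open intervals, hence everywhere by uniqueness. *)
Lemma ge0_integral_affine (c e : R) (f : R -> \bar R) : (0 < c)%R ->
  measurable_fun setT f -> (forall x, 0 <= f x) ->
  \int[leb]_x f x = c%:E * \int[leb]_v f (c * v + e)%R.
Proof.
move=> c0 mf f0.
pose mu : {measure set (measurableTypeR R) -> \bar R} :=
  @measure_function_pushforward__canonical__measure_function_Measure _ _
    (measurableTypeR R) (measurableTypeR R) R leb _ (measurable_affine c e).
pose m : {measure set (measurableTypeR R) -> \bar R} := mscale (NngNum (ltW c0)) mu.
have mE (A : set R) : measurable A -> leb A = m A.
  move=> mA; suff H X : ocitv X -> lebesgue_measure X = m X.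
    exact: (@lebesgue_measure_unique R m H A mA).
  move=> [[a b] _ <-].
  transitivity (c%:E * leb ((fun v : R => c * v + e)%R @^-1` `]a, b]%classic)) => //.
  have -> : (fun v : R => c * v + e)%R @^-1` `]a, b]%classic =
      `]((a - e) / c)%R, ((b - e) / c)%R]%classic.
    apply/seteqP; split => v /=; rewrite !in_itv/= => /andP[av vb].
      by rewrite ltr_pdivrMr// ler_pdivlMr// mulrC ltrBlDr lerBrDr av vb.
    move: av vb; rewrite ltr_pdivrMr// ler_pdivlMr// mulrC ltrBlDr lerBrDr => -> ->//.
  rewrite !lebesgue_measure_itv/= !lte_fin ltr_pM2r ?invr_gt0// ltrD2r.
  case: ifPn => _; last by rewrite mule0.
  rewrite -!EFinB -EFinM; congr (_%:E); field.
  by rewrite gt_eqF.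
rewrite (eq_measure_integral m) => [|A mA _]; last exact: mE.
rewrite /m ge0_integral_mscale//.
by congr (_ * _); rewrite ge0_integral_pushforward// ?preimage_setT//; exact: measurable_affine.
Qed.

End affine_change_of_variables.

Section limits_at_zero_and_infinity.
Context {R : realType}.
Implicit Type P : R -> Prop.

Lemma near0rP P : (\forall x \near 0^'+, P x) <->
  exists2 e : R, 0 < e & forall x, 0 < x < e -> P x.
Proof.
split.
  rewrite near_withinE => /nbhs_ballP[e /= e0 h]; exists e => // x /andP[x0 xe].
  by apply: h => //=; rewrite /ball/= sub0r normrN gtr0_norm.
move=> [e e0 h]; rewrite near_withinE; apply/nbhs_ballP; exists e => //= x.
rewrite /ball/= sub0r normrN => xe x0.
by apply: h; rewrite x0/= (le_lt_trans (ler_norm _)).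
Qed.

Lemma near_pinftyP P : (\forall x \near +oo, P x) <->
  exists M : R, forall x, M < x -> P x.
Proof.
split => [[M [_ h]]|[M h]]; first by exists M.
by exists M; split => //; exact: num_real.
Qed.

Lemma invr_cvg0ry : (x : R)^-1 @[x --> 0^'+] --> +oo.
Proof.
apply/cvgryPge => M; apply/near0rP; exists (`|M| + 1)^-1.
  by rewrite invr_gt0 ltr_wpDl.
move=> x /andP[x0 xM]; rewrite (le_trans (ler_norm _))//.
rewrite -[leRHS](_ : (`|M| + 1) + (x^-1 - (`|M| + 1)) = _); last by ring.
rewrite -addrA lerDl addr_ge0// subr_ge0.
by rewrite -[leLHS]invrK lef_pV2 ?posrE ?invr_gt0 ?ltW ?ltr_wpDl.
Qed.

Lemma half_cvg0r : (x / 2 : R) @[x --> 0^'+] --> 0^'+.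
Proof.
move=> A /near0rP[e e0 h]; apply/near0rP; exists e => // x /andP[x0 xe].
by apply: h; rewrite divr_gt0//= ltr_pdivrMr//; lra.
Qed.

Lemma double_cvgry : (2 * x : R) @[x --> +oo] --> +oo.
Proof.
move=> A /near_pinftyP[M h]; apply/near_pinftyP; exists (`|M|) => x xM.
by apply: h; have := ler_norm M; have := normr_ge0 M; lra.
Qed.

(** Moves a limiting ratio from model functions [g], [g'] to [f], [f'] asymptotic to [s] times them;
    below, the primed functions are the same ones at a rescaled argument. Since [s != 0], no
    denominator vanishes eventually. *)
Lemma ratio_cvg (T : Type) (F : set_system T) {FF : Filter F} (f g f' g' : T -> R) (s rho : R) :
  s != 0 -> (f x / g x) @[x --> F] --> s -> (f' x / g' x) @[x --> F] --> s ->
  (g' x / g x) @[x --> F] --> rho -> (f' x / f x) @[x --> F] --> rho.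
Proof.
move=> s0 fg fg' gg.
have h : ((f' x / g' x) * (g' x / g x)) * (f x / g x)^-1 @[x --> F] --> rho.
  rewrite -[rho](_ : s * rho * s^-1 = _); last by field.
  by apply: cvgM; [exact: cvgM|exact: cvgV].
apply: cvg_trans h; apply: near_eq_cvg.
have n1 : \forall x \near F, f x / g x != 0.
  exact: (fg _ (open_nbhs_nbhs (conj (@open_neq _ 0) s0))).
have n2 : \forall x \near F, f' x / g' x != 0.
  exact: (fg' _ (open_nbhs_nbhs (conj (@open_neq _ 0) s0))).
near=> x.
have : f x / g x != 0 by near: x.
have : f' x / g' x != 0 by near: x.
rewrite !mulf_eq0 !invr_eq0 !negb_or => /andP[a1 a2] /andP[a3 a4].
by field; rewrite a2 a3 a4.
Unshelve. all: by end_near. Qed.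

End limits_at_zero_and_infinity.

(** Extracts from regular variation what is used of it: the ratio at scale 1/2. As
    [(x/2)^-1 = 2 x^-1], slow variation of [ell] is applied with factor 2. *)
Lemma density_halving_cvg (R : realType) (p ell : R -> R) (alpha : R) :
  0 < alpha -> slowly_varying ell ->
  (p x / (alpha * ell (x^-1) * x `^ (alpha - 1))) @[x --> 0^'+] --> (1 : R) ->
  (p (x / 2) / p x) @[x --> 0^'+] --> (2 : R) `^ (1 - alpha).
Proof.
move=> a0 [_ [_ sv]] h.
apply: (ratio_cvg (oner_neq0 R) h).
  exact: (cvg_comp _ _ half_cvg0r h).
have two0 : (0 : R) < 2 by [].
have e2 := sv _ two0.
have {}e2 := cvg_comp _ _ invr_cvg0ry e2.
rewrite -[_ `^ _]mul1r.
have : (ell (2 * x^-1) / ell x^-1) * (2 : R) `^ (1 - alpha) @[x --> 0^'+] -->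
    1 * (2 : R) `^ (1 - alpha).
  by apply: cvgM e2 _; exact: cvg_cst.
apply: cvg_trans; apply: near_eq_cvg; apply/near0rP; exists 1 => // x /andP[x0 _].
rewrite powRM ?(ltW x0)// invfM invrK (mulrC x^-1).
have -> : (2^-1 : R) `^ (alpha - 1) = 2 `^ (1 - alpha).
  by rewrite -[2^-1]powR_inv1// -powRrM mulN1r opprB.
have : x `^ (alpha - 1) != 0 by rewrite gt_eqF// powR_gt0.
(* In this case both sides are 0, by the convention [0^-1 = 0]. *)
have [->|e0] := eqVneq (ell x^-1) 0; first by rewrite !(mulr0, mul0r, invr0).
by move=> px; field; rewrite e0 px gt_eqF.
Qed.

Lemma tail_doubling_cvg (R : realType) (G k : R -> R) (gam s : R) :
  s != 0 -> slowly_varying k ->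
  (G x / (k x * x `^ (- gam))) @[x --> +oo] --> s ->
  (G (2 * x) / G x) @[x --> +oo] --> (2 : R) `^ (- gam).
Proof.
move=> s0 [_ [_ sv]] h.
apply: (ratio_cvg s0 h).
  exact: (cvg_comp _ _ double_cvgry h).
have two0 : (0 : R) < 2 by [].
have e2 := sv _ two0.
rewrite -[_ `^ _]mul1r.
have : (k (2 * x) / k x) * (2 : R) `^ (- gam) @[x --> +oo] -->
    1 * (2 : R) `^ (- gam).
  by apply: cvgM e2 _; exact: cvg_cst.
apply: cvg_trans; apply: near_eq_cvg; apply/near_pinftyP; exists 0 => x x0.
rewrite powRM ?(ltW x0)//.
have : x `^ (- gam) != 0 by rewrite gt_eqF// powR_gt0.
have [->|e0] := eqVneq (k x) 0; first by rewrite !(mulr0, mul0r, invr0).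
by move=> px; field; rewrite e0 px.
Qed.

Lemma measurable_inv (R : realType) : measurable_fun setT (fun x : R => x^-1).
Proof.
rewrite (_ : (fun x : R => x^-1) = (fun x => x `^ (-1) * \1_(`]0, +oo[%classic) x -
    (- x) `^ (-1) * \1_(`]-oo, 0[%classic) x)); last first.
  apply/funext => x; rewrite !indicE.
  have -> : (x \in `]0, +oo[%classic) = (0 < x).
    by apply/idP/idP; rewrite inE/= in_itv/= andbT.
  have -> : (x \in `]-oo, 0[%classic) = (x < 0).
    by apply/idP/idP; rewrite inE/= in_itv/=.
  have [x0|x0|->] := ltgtP x 0; rewrite ?mulr0 ?mulr1 ?subr0 ?invr0// ?sub0r.
  - by rewrite powR_inv1 ?oppr_ge0 ?(ltW x0)// invrN opprK.
  - by rewrite powR_inv1 ?(ltW x0).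
apply: measurable_funB; apply: measurable_funM; do ? exact: measurable_indic.
  exact: measurable_powR.
by apply: (measurableT_comp (measurable_powR _)).
Qed.

Lemma lt_powR2 (R : realType) (a b : R) : a < b -> (2 : R) `^ a < 2 `^ b.
Proof.
move=> ab; rewrite /powR pnatr_eq0/= ltr_expR ltr_pM2r//.
by rewrite ln_gt0// ltr1n.
Qed.

(** On the level [x0 2^k <= f < x0 2^(k+1)] the integrand is at most [(x0 2^(k+1))^s] and the mass
    at most [C th^k], so the levels are summed by a geometric series of ratio [th 2^s]. *)
Lemma integral_powR_tail_lty d (T : measurableType d) (R : realType)
    (nu : {measure set T -> \bar R}) (f : T -> R) (s C th x0 : R) :
  measurable_fun setT f -> 0 < x0 -> 0 <= s -> 0 <= C -> 0 < th ->
  th * 2 `^ s < 1 ->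
  (forall k, (nu [set x | (x0 * 2 ^+ k <= f x)%R] <= (C * th ^+ k)%:E)%E) ->
  (\int[nu]_(x in [set x | (x0 <= f x)%R]) (f x `^ s)%:E < +oo)%E.
Proof.
move=> mf x00 s0 C0 th0 th1 h.
have mS (y : R) : measurable [set x | y <= f x].
  rewrite (_ : [set x | y <= f x] = setT `&` f @^-1` `[y, +oo[%classic).
    exact: mf.
  by rewrite setTI; apply/seteqP; split => x; rewrite /= in_itv/= andbT.
pose phi k x := ((x0 * 2 ^+ k.+1) `^ s * \1_[set x | x0 * 2 ^+ k <= f x] x)%:E.
have mphi k : measurable_fun setT (phi k).
  apply/measurable_EFinP; apply: measurable_funM => //.
have b0 k : 0 <= x0 * 2 ^+ k by rewrite mulr_ge0 ?exprn_ge0 ?(ltW x00).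
apply: (@le_lt_trans _ _ (((x0 * 2) `^ s * C) / (1 - th * 2 `^ s))%:E); last exact: ltry.
apply: (@integral_le_geometric _ _ _ _ _ _ phi) => //.
- apply/measurable_EFinP; apply: measurable_funTS.
  exact: (measurableT_comp (measurable_powR s)).
- by move=> x _; rewrite lee_fin powR_ge0.
- by move=> k; exact: measurable_funTS.
- by move=> k x _; rewrite lee_fin mulr_ge0 ?powR_ge0.
- move=> x /= fx.
  have [k /andP[k1 k2]] : exists k, 2 ^+ k <= f x / x0 < 2 ^+ k.+1.
    by apply: dyadic_bracket; rewrite ler_pdivlMr// mul1r.
  exists k; rewrite lee_fin indicE mem_set/=; last by rewrite mulrC -ler_pdivlMr.
  rewrite mulr1; apply: ge0_ler_powR => //; rewrite ?nnegrE//.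
    exact: le_trans (ltW x00) fx.
  by move: k2; rewrite ltr_pdivrMr// mulrC => /ltW.
- by rewrite mulr_gt0 ?powR_gt0.
- by rewrite mulr_ge0 ?powR_ge0.
move=> k; apply: (@le_trans _ _ (\int[nu]_x phi k x)%E).
  apply: ge0_subset_integral => // x _.
  by rewrite lee_fin mulr_ge0 ?powR_ge0.
have -> : phi k = (fun x => ((x0 * 2 ^+ k.+1) `^ s)%:E * (\1_[set x | x0 * 2 ^+ k <= f x] x)%:E)%E.
  by apply/funext => x; rewrite -EFinM.
rewrite ge0_integralZl_EFin ?powR_ge0//; last first.
  by apply/measurable_EFinP; apply: measurable_indic; exact: mS.
rewrite integral_indic// setIT.
apply: (@le_trans _ _ (((x0 * 2 ^+ k.+1) `^ s)%:E * (C * th ^+ k)%:E)%E).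
  by apply: lee_wpmul2l => //; rewrite lee_fin powR_ge0.
rewrite -EFinM lee_fin exprMn exprS mulrA powRM ?exprn_ge0 ?mulr_ge0 ?(ltW x00)//.
by rewrite expr_powR// le_eqVlt; apply/orP; left; apply/eqP; ring.
Qed.

(** * Mass of [pi] near zero *)

Section mass_near_zero.
Context {R : realType}.
Local Notation leb := (@lebesgue_measure R).
Variables (pi : probability R R) (p : R -> R) (alpha : R).
Hypothesis alpha_ge0 : 0 <= alpha.
Hypothesis mp : measurable_fun setT p.
Hypothesis p_ge0 : forall x, 0 <= x -> 0 <= p x.
Hypothesis piE : forall A, measurable A ->
  pi A = (\int[leb]_(x in A `&` `[0%R, +oo[%classic) (p x)%:E)%E.
Hypothesis p_halving : (p (x / 2) / p x) @[x --> 0^'+] --> (2 : R) `^ (1 - alpha).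

Let mass (x : R) := fine (pi `]0, x]%classic).

Lemma mass_EFin x : (mass x)%:E = pi `]0, x]%classic.
Proof. by rewrite fineK// fin_num_measure. Qed.

Lemma massE x : pi `]0, x]%classic = (\int[leb]_(u in `]0%R, x]) (p u)%:E)%E.
Proof.
rewrite piE//; congr (integral _ _ _); apply/seteqP; split => u /=; rewrite !in_itv/=.
  by case.
by move=> /andP[u0 ux]; rewrite u0 ux ltW.
Qed.

Lemma mass_halfE x : pi `]0, x / 2]%classic =
  (2^-1%:E * \int[leb]_(u in `]0%R, x]) (p (u / 2))%:E)%E.
Proof.
have m2 : measurable_fun setT (fun v : R => p (v / 2)).
  by apply: measurableT_comp => //; exact: measurable_funM.
rewrite massE integral_mkcond (@ge0_integral_affine _ (2^-1) 0)//; first last.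
- move=> u; apply: erestrict_ge0 => v; rewrite /= in_itv/= lee_fin => /andP[v0 _].
  by apply: p_ge0; exact: ltW.
- apply/(measurable_restrictT _ (measurable_itv _)); apply/measurable_EFinP.
  exact: measurable_funTS.
rewrite [in RHS]integral_mkcond; congr (_ * _)%E; apply: eq_integral => v _.
rewrite !patchE addr0 mulrC.
suff -> : (v / 2 \in `]0, x / 2]%classic) = (v \in `]0, x]%classic) by [].
apply/idP/idP; rewrite !inE/= !in_itv/= => /andP[].
  by rewrite ler_pM2r// pmulr_lgt0// => -> ->.
by move=> v0 vx; rewrite ler_pM2r// vx divr_gt0.
Qed.

(** The density ratio tends to [2^(1-alpha)], and the substitution [u -> u/2] contributes a factor
    1/2, so masses shrink by about [2^(-alpha)] per halving; any [c1] and [c2] strictly around this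
    value bracket the ratio. *)
Lemma mass_halving (c1 c2 : R) :
  0 < c1 < 2 `^ (- alpha) -> 2 `^ (- alpha) < c2 ->
  exists2 x1 : R, 0 < x1 & 0 < mass x1 /\ forall x, 0 < x <= x1 ->
    c1 * mass x <= mass (x / 2) <= c2 * mass x.
Proof.
move=> /andP[c10 c1a] c2a.
have e2 : (2 : R) `^ (1 - alpha) = 2 * 2 `^ (- alpha).
  by rewrite gt0_powRD// powRr1.
have n1 : \forall x \near 0^'+, 2 * c1 < p (x / 2) / p x.
  by apply: (cvgr_gt _ p_halving); rewrite e2 ltr_pM2l.
have n2 : \forall x \near 0^'+, p (x / 2) / p x < 2 * c2.
  by apply: (cvgr_lt _ p_halving); rewrite e2 ltr_pM2l.
have /near0rP[e e0 h] : \forall x \near 0^'+,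
    2 * c1 < p (x / 2) / p x /\ p (x / 2) / p x < 2 * c2.
  by apply: filterS2 n1 n2.
(* If [p x = 0], the quotient [p (x/2) / p x] would be 0 by convention, but it exceeds
   [2 c1 > 0]. *)
have pgt0 x : 0 < x < e -> 0 < p x.
  move=> /[dup] /andP[x0 xe] /h[h1 _].
  rewrite lt_neqAle p_ge0 ?(ltW x0)// andbT; apply/eqP => px0.
  by move: h1; rewrite -px0 invr0 mulr0 ltNge pmulr_rge0// ltW.
have c20 : 0 < c2 by apply: lt_trans c2a; rewrite powR_gt0.
have m2 : measurable_fun setT (fun v : R => p (v / 2)).
  by apply: measurableT_comp => //; exact: measurable_funM.
have mpi D : measurable D -> measurable_fun D (EFin \o p).
  by move=> mD; apply/measurable_EFinP; exact: measurable_funTS.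
have mpi2 D : measurable D -> measurable_fun D (fun v : R => (p (v / 2))%:E).
  by move=> mD; apply/measurable_EFinP; exact: measurable_funTS.
have itv0 x u : `]0, x]%classic u -> (0 <= (p u)%:E)%E.
  by rewrite /= in_itv/= => /andP[u0 _]; rewrite lee_fin p_ge0// ltW.
have itv02 x u : `]0, x]%classic u -> (0 <= (p (u / 2))%:E)%E.
  by rewrite /= in_itv/= => /andP[u0 _]; rewrite lee_fin p_ge0// ltW// divr_gt0.
have itvM x u (c : R) : 0 < c -> `]0, x]%classic u -> (0 <= c%:E * (p u)%:E)%E.
  by move=> c0 /itv0; apply: mule_ge0; rewrite lee_fin ltW.
have mpM D (c : R) : measurable D -> measurable_fun D (fun u => c%:E * (p u)%:E)%E.
  by move=> mD; apply: measurable_funeM; exact: mpi.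
have e20 : 0 < e / 2 by rewrite divr_gt0.
have e2e : e / 2 < e by rewrite ltr_pdivrMr//; lra.
exists (e / 2) => //; split.
  (* With zero mass [p] would vanish almost everywhere on []0, e/2]], contradicting its positivity
     there. *)
  rewrite lt_neqAle fine_ge0// andbT eq_sym; apply/eqP => m0.
  have : pi `]0, e / 2]%classic = 0%E by rewrite -mass_EFin m0.
  rewrite massE.
  have -> : (\int[leb]_(u in `]0%R, (e / 2)%R]) (p u)%:E)%E =
      (\int[leb]_(u in `]0%R, (e / 2)%R]) `|(EFin \o p) u|)%E.
    apply: eq_integral => u /[!inE] ui; rewrite gee0_abs//.
    exact: itv0 ui.
  move/(ae_eq_integral_abs leb (measurable_itv _) (mpi _ (measurable_itv _))).
  move=> [N [mN N0 sN]].
  have : (leb `]0%R, (e / 2)%R]%classic <= leb N)%E.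
    apply: le_measure; rewrite ?inE//.
    move=> u ui; apply: sN => /= /(_ ui)/= [pu].
    move: ui; rewrite /= in_itv/= => /andP[u0 ue].
    have : 0 < p u by apply: pgt0; rewrite u0 (le_lt_trans ue).
    by rewrite pu ltxx.
  rewrite N0 lebesgue_measure_itv/= lte_fin e20 -EFinB lee_fin subr0.
  by rewrite leNgt e20.
move=> x /andP[x0 xe].
have ux u : `]0, x]%classic u -> 2 * c1 * p u <= p (u / 2) <= 2 * c2 * p u.
  rewrite /= in_itv/= => /andP[u0 ux].
  have ue : 0 < u < e by rewrite u0 (le_lt_trans ux)// (le_lt_trans xe).
  have [h1 h2] := h _ ue; have pu := pgt0 _ ue.
  by rewrite -ler_pdivlMr// (ltW h1)/= -ler_pdivrMr// ltW.
apply/andP; split; rewrite -lee_fin EFinM !mass_EFin mass_halfE massE.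
  rewrite (_ : c1%:E = 2^-1%:E * (2 * c1)%:E)%E; last by rewrite -EFinM mulrA mulVf// mul1r.
  rewrite -muleA; apply: lee_wpmul2l => //.
  rewrite -ge0_integralZl_EFin//; last 3 first.
  - exact: itv0.
  - exact: mpi.
  - by rewrite mulr_ge0// ltW.
  apply: ge0_le_integral => //.
  - by move=> u; apply: itvM; rewrite mulr_gt0.
  - exact: mpM.
  - exact: mpi2.
  - by move=> u /ux /andP[h1 _]; rewrite -EFinM lee_fin.
rewrite (_ : c2%:E = 2^-1%:E * (2 * c2)%:E)%E; last by rewrite -EFinM mulrA mulVf// mul1r.
rewrite -muleA; apply: lee_wpmul2l => //.
rewrite -ge0_integralZl_EFin//; last 3 first.
- exact: itv0.
- exact: mpi.
- by rewrite mulr_ge0// ltW.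
apply: ge0_le_integral => //.
- exact: itv02.
- exact: mpi2.
- exact: mpM.
- by move=> u /ux /andP[_ h2]; rewrite -EFinM lee_fin.
Qed.

(** Iterating the lower halving bound with [c1 = 2^(-a)] gives at least [2^(-a k)] times [mass x1]
    at [x1 / 2^k]. A general [x] is compared with the dyadic point just below it, at most a factor 2
    away, whence the constant [(2 x1)^(-a)]. *)
Lemma mass_lower_bound (a : R) : alpha < a ->
  exists2 x1 : R, 0 < x1 & exists2 c : R, 0 < c &
    forall x, 0 < x <= x1 -> c * x `^ a <= mass x.
Proof.
move=> aa.
pose c1 := (2 : R) `^ (- a).
have c10 : 0 < c1 by rewrite powR_gt0.
have c1a : 0 < c1 < 2 `^ (- alpha).
  by rewrite c10 lt_powR2// ltrN2.
have c2a : (2 : R) `^ (- alpha) < 2 `^ (- alpha) + 1 by rewrite ltrDl.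
have [x1 x10 [m1 h]] := mass_halving c1a c2a.
have hk k : c1 ^+ k * mass x1 <= mass (x1 / 2 ^+ k).
  elim: k => [|k IH]; first by rewrite !expr0 mul1r divr1.
  have x1k : 0 < x1 / 2 ^+ k <= x1.
    by rewrite divr_gt0//= ler_pdivrMr// ler_peMr ?(ltW x10)// exprn_ege1// ler1n.
  have /andP[h1 _] := h _ x1k.
  rewrite exprS -mulrA; apply: (le_trans (ler_wpM2l (ltW c10) IH)).
  by rewrite exprSr invfM mulrA.
exists x1 => //; exists ((2 * x1) `^ (- a) * mass x1).
  by rewrite mulr_gt0// powR_gt0// mulr_gt0.
move=> x /andP[x0 xx1].
have [k /andP[k1 k2]] : exists k, 2 ^+ k <= x1 / x < 2 ^+ k.+1.
  by apply: dyadic_bracket; rewrite ler_pdivlMr// mul1r.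
have k0 : 0 < 2 ^+ k.+1 :> R by rewrite exprn_gt0.
apply: (@le_trans _ _ (mass (x1 / 2 ^+ k.+1))); last first.
  rewrite fine_le ?fin_num_measure//; apply: le_measure; rewrite ?inE//.
  apply: subset_itvl; rewrite bnd_simp ler_pdivrMr//.
  by move: k2; rewrite ltr_pdivrMr// mulrC => /ltW.
apply: le_trans (hk k.+1).
rewrite mulrAC; apply: ler_wpM2r; first exact: ltW.
rewrite /c1 -expr_powR// !powRN mulrC ler_pdivrMr ?powR_gt0//; last first.
  by rewrite mulr_gt0.
rewrite mulrC ler_pdivlMr ?powR_gt0//.
have a_ge0 : 0 <= a by exact: le_trans alpha_ge0 (ltW aa).
rewrite -powRM ?(ltW x0)//.
apply: ge0_ler_powR; rewrite ?nnegrE//; last first.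
  rewrite exprS mulrCA ler_pM2l//.
  by move: k1; rewrite ler_pdivlMr// mulrC.
all: by rewrite mulr_ge0// ltW// mulr_gt0.
Qed.

Lemma inverse_moment_lty (a : R) : 0 < a < alpha ->
  (\int[pi]_(x in [set x | (0 < x)%R]) ((x^-1) `^ a)%:E < +oo)%E.
Proof.
move=> /andP[a0 aa].
(* The exponent is midway between [a] and [alpha]: [c2 > 2^(-alpha)] makes it an upper halving
   constant, while [c2 2^a < 1] makes the series converge. *)
pose c2 : R := 2 `^ (- ((a + alpha) / 2)).
have c20 : 0 < c2 by rewrite powR_gt0.
have c2a : 2 `^ (- alpha) < c2 by apply: lt_powR2; lra.
have c1a : 0 < (2 : R) `^ (- alpha) / 2 < 2 `^ (- alpha).
  have : 0 < (2 : R) `^ (- alpha) by rewrite powR_gt0.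
  by move=> ?; apply/andP; split; lra.
have [x1 x10 [m1 h]] := mass_halving c1a c2a.
have hk k : mass (x1 / 2 ^+ k) <= c2 ^+ k * mass x1.
  elim: k => [|k IH]; first by rewrite !expr0 mul1r divr1.
  have x1k : 0 < x1 / 2 ^+ k <= x1.
    by rewrite divr_gt0//= ler_pdivrMr// ler_peMr ?(ltW x10)// exprn_ege1// ler1n.
  have /andP[_ h1] := h _ x1k.
  rewrite (exprS c2) -mulrA; apply: le_trans (ler_wpM2l (ltW c20) IH).
  by apply: le_trans h1; rewrite exprSr invfM mulrA.
have mi : measurable_fun setT (fun x : R => x^-1) by exact: measurable_inv.
have mpow : measurable_fun setT (fun x : R => ((x^-1) `^ a)%:E).
  by apply/measurable_EFinP; exact: (measurableT_comp (measurable_powR a)).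
have mpos : measurable [set x : R | 0 < x].
  rewrite (_ : [set x | 0 < x] = `]0, +oo[%classic)//.
  by apply/seteqP; split => x; rewrite /= in_itv/= andbT.
have H : (\int[pi]_(x in [set x | (x1^-1 <= x^-1)%R]) ((x^-1) `^ a)%:E < +oo)%E.
  apply: (@integral_powR_tail_lty _ _ _ pi (fun x => x^-1) a (mass x1) c2 x1^-1) => //.
  - by rewrite invr_gt0.
  - exact: ltW.
  - exact: ltW.
  - rewrite /c2 -gt0_powRD// -[ltRHS](powRr0 2); apply: lt_powR2; lra.
  move=> k; apply: (@le_trans _ _ (pi `]0, x1 / 2 ^+ k]%classic)).
    apply: le_measure; rewrite ?inE//.
      rewrite (_ : [set x | _] = setT `&` (fun x => x^-1) @^-1` `[x1^-1 * 2 ^+ k, +oo[%classic); first exact: mi.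
      by rewrite setTI; apply/seteqP; split => x; rewrite /= in_itv/= andbT.
    move=> x /=; rewrite in_itv/= => xk.
    have k0 : 0 < x1^-1 * 2 ^+ k by rewrite mulr_gt0 ?invr_gt0// exprn_gt0.
    have x0 : 0 < x by rewrite -invr_gt0 (lt_le_trans k0).
    rewrite x0/= -[leRHS]invrK invfM invrK -[leLHS]invrK.
    by rewrite lef_pV2 ?posrE ?invr_gt0.
  by have := hk k; rewrite -lee_fin mass_EFin (mulrC _ (mass x1)).
have m1' : measurable [set x : R | x1^-1 <= x^-1].
  rewrite (_ : [set x | _] = setT `&` (fun x => x^-1) @^-1` `[x1^-1, +oo[%classic); first exact: mi.
  by rewrite setTI; apply/seteqP; split => x; rewrite /= in_itv/= andbT.
have m2' : measurable [set x : R | x1 < x].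
  rewrite (_ : [set x | _] = `]x1, +oo[%classic)//.
  by apply/seteqP; split => x; rewrite /= in_itv/= andbT.
rewrite (_ : [set x : R | 0 < x] = [set x | x1^-1 <= x^-1] `|` [set x | x1 < x]); last first.
  apply/seteqP; split => x /=.
    move=> x0; have [?|xx1] := ltP x1 x; [by right|left].
    by rewrite lef_pV2 ?posrE.
  case=> [x1x|/(lt_trans x10)//].
  by rewrite -invr_gt0 (lt_le_trans _ x1x)// invr_gt0.
rewrite ge0_integral_setU//; first last.
- apply/disj_setPS => x [/= x1x xx1].
  have x0 : 0 < x by exact: lt_trans xx1.
  by move: x1x; rewrite lef_pV2 ?posrE// leNgt xx1.
- by move=> x _; rewrite lee_fin powR_ge0.
- by apply: measurable_funTS.
apply: lte_add_pinfty => //.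
apply: (@le_lt_trans _ _ (\int[pi]_(x in [set x | (x1 < x)%R]) ((x1^-1) `^ a)%:E)%E).
  apply: ge0_le_integral => //.
  - by move=> x _; rewrite lee_fin powR_ge0.
  - by apply: measurable_funTS.
  move=> x /= xx1; rewrite lee_fin; apply: ge0_ler_powR; rewrite ?nnegrE; first exact: ltW.
  - by rewrite invr_ge0 ltW// (lt_trans x10).
  - by rewrite invr_ge0 ltW.
  by rewrite lef_pV2 ?posrE// ?(ltW xx1)// (lt_trans x10).
rewrite (integral_cst pi m2' (x1^-1 `^ a)%:E) lte_mul_pinfty//.
  by rewrite lee_fin powR_ge0.
by rewrite (le_lt_trans (probability_le1 pi m2'))// ltry.
Qed.

End mass_near_zero.

Lemma measurable_ler (d : measure_display) (T : measurableType d) (R : realType) (f : T -> R) (y : R) :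
  measurable_fun setT f -> measurable [set x | y <= f x].
Proof.
move=> mf; rewrite (_ : [set x | y <= f x] = setT `&` f @^-1` `[y, +oo[%classic).
  exact: mf.
by rewrite setTI; apply/seteqP; split => x; rewrite /= in_itv/= andbT.
Qed.

Lemma measurable_ltr (d : measure_display) (T : measurableType d) (R : realType) (f : T -> R) (y : R) :
  measurable_fun setT f -> measurable [set x | y < f x].
Proof.
move=> mf; rewrite (_ : [set x | y < f x] = setT `&` f @^-1` `]y, +oo[%classic).
  exact: mf.
by rewrite setTI; apply/seteqP; split => x; rewrite /= in_itv/= andbT.
Qed.

Lemma measurable_ger (d : measure_display) (T : measurableType d) (R : realType) (f : T -> R) (y : R) :
  measurable_fun setT f -> measurable [set x | f x <= y].
Proof.
move=> mf; rewrite (_ : [set x | f x <= y] = setT `&` f @^-1` `]-oo, y]%classic).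
  exact: mf.
by rewrite setTI; apply/seteqP; split => x; rewrite /= in_itv.
Qed.

Lemma measurable_normr_powR (d : measure_display) (T : measurableType d) (R : realType) (f : T -> R) (r : R) :
  measurable_fun setT f -> measurable_fun setT (fun x => (`|f x| `^ r)%:E).
Proof.
move=> mf; apply/measurable_EFinP; apply: (measurableT_comp (measurable_powR r)).
exact: measurableT_comp.
Qed.

Lemma powR_integral_lty (d : measure_display) (T : measurableType d) (R : realType)
    (P : probability T R) (f : T -> R) (s x0 : R) :
  measurable_fun setT f -> (forall x, 0 <= f x) -> 0 <= s ->
  (\int[P]_(x in [set x | (x0 <= f x)%R]) (f x `^ s)%:E < +oo)%E ->
  (\int[P]_x (f x `^ s)%:E < +oo)%E.
Proof.
move=> mf f0 s0 H.
have mA := measurable_ler x0 mf.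
have mB : measurable [set x | f x < x0].
  rewrite (_ : [set x | f x < x0] = ~` [set x | x0 <= f x]); first exact: measurableC.
  by apply/seteqP; split => x /=; rewrite ltNge => /negP.
have mpow : measurable_fun setT (fun x => (f x `^ s)%:E).
  by apply/measurable_EFinP; exact: (measurableT_comp (measurable_powR s)).
have TE : [set: T] = [set x | x0 <= f x] `|` [set x | f x < x0].
  by apply/seteqP; split => x //= _; case: (leP x0 (f x)); [left|right].
rewrite TE ge0_integral_setU//; first last.
- by apply/disj_setPS => x [/= x1x]; rewrite ltNge x1x.
- by move=> x _; rewrite lee_fin powR_ge0.
- by apply: measurable_funTS.
apply: lte_add_pinfty => //.
apply: (@le_lt_trans _ _ (\int[P]_(x in [set x | (f x < x0)%R]) (x0 `^ s)%:E)%E).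
  apply: ge0_le_integral => //.
  - by move=> x _; rewrite lee_fin powR_ge0.
  - by apply: measurable_funTS.
  move=> x /= xx1; rewrite lee_fin; apply: ge0_ler_powR => //; rewrite ?nnegrE//.
  - by rewrite ltW// (le_lt_trans _ xx1).
  - exact: ltW.
rewrite (integral_cst P mB (x0 `^ s)%:E) lte_mul_pinfty//.
  by rewrite lee_fin powR_ge0.
by rewrite (le_lt_trans (probability_le1 P mB))// ltry.
Qed.

(** The two tails are added because one of [p0], [q0] may be 0, and then that tail alone need not
    have a doubling ratio. The sum [G] has one, [2^(-gam)], and [c] sits midway between it and
    [2^(-r)]. *)
Lemma absolute_moment_lty (d : measure_display) (T : measurableType d) (R : realType)
    (P : probability T R) (Y : T -> R) (p0 q0 gam r : R) (k : R -> R) :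
  measurable_fun setT Y -> 0 < p0 + q0 -> 0 < r < gam -> slowly_varying k ->
  (fine (P [set w | x < Y w]) / (k x * x `^ (- gam))) @[x --> +oo] --> p0 ->
  (fine (P [set w | Y w <= - x]) / (k x * x `^ (- gam))) @[x --> +oo] --> q0 ->
  (\int[P]_w (`|Y w| `^ r)%:E < +oo)%E.
Proof.
move=> mY pq0 /andP[r0 rg] sv h1 h2.
pose G x := fine (P [set w | x < Y w]) + fine (P [set w | Y w <= - x]).
have hG : (G x / (k x * x `^ (- gam))) @[x --> +oo] --> (p0 + q0 : R).
  rewrite (_ : (fun x => G x / _) = (fun x => fine (P [set w | x < Y w]) / (k x * x `^ (- gam)) +
    fine (P [set w | Y w <= - x]) / (k x * x `^ (- gam)))); first exact: cvgD.
  by apply/funext => x; rewrite mulrDl.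
have pq : p0 + q0 != 0 by rewrite gt_eqF.
have dG := tail_doubling_cvg pq sv hG.
pose c : R := 2 `^ (- ((r + gam) / 2)).
have c0 : 0 < c by rewrite powR_gt0.
have n1 : \forall x \near +oo, G (2 * x) / G x < c.
  by apply: (cvgr_lt _ dG); apply: lt_powR2; lra.
have n2 : \forall x \near +oo, G x / (k x * x `^ (- gam)) != 0.
  exact: (hG _ (open_nbhs_nbhs (conj (@open_neq _ 0) pq))).
have /near_pinftyP[M hM] : \forall x \near +oo, G (2 * x) <= c * G x.
  apply: filterS2 n1 n2 => x a1 a2.
  have Gx : 0 < G x.
    rewrite lt_neqAle addr_ge0 ?fine_ge0// andbT eq_sym.
    by move: a2; rewrite mulf_eq0 negb_or => /andP[].
  by rewrite -ler_pdivrMr// ltW.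
pose x0 := `|M| + 1.
have x00 : 0 < x0 by rewrite ltr_wpDl.
have x0M : M < x0 by rewrite (le_lt_trans (ler_norm M))// ltrDl.
have hk n : G (x0 * 2 ^+ n) <= c ^+ n * G x0.
  elim: n => [|n IH]; first by rewrite !expr0 mul1r mulr1.
  have : M < x0 * 2 ^+ n.
    by rewrite (lt_le_trans x0M)// ler_peMr ?(ltW x00)// exprn_ege1// ler1n.
  move=> /hM; rewrite mulrCA -exprS => /le_trans; apply.
  by rewrite (exprS c) -mulrA ler_pM2l.
have mabs : measurable_fun setT (fun w => `|Y w|) by exact: measurableT_comp.
have mNY : measurable_fun setT (fun w => - Y w) by exact: measurableT_comp.
(* The threshold is doubled since the right tail is strict: [|Y| >= 2 y] implies [Y > y] or
   [Y <= - y]. *)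
have H : (\int[P]_(w in [set w | (2 * x0 <= `|Y w|)%R]) (`|Y w| `^ r)%:E < +oo)%E.
  apply: (@integral_powR_tail_lty _ _ _ P (fun w => `|Y w|) r (G x0) c (2 * x0)) => //.
  - by rewrite mulr_gt0.
  - exact: ltW.
  - by rewrite addr_ge0 ?fine_ge0.
  - by rewrite -gt0_powRD// -[ltRHS](powRr0 2); apply: lt_powR2; lra.
  move=> n.
  have y0 : 0 < x0 * 2 ^+ n by rewrite mulr_gt0// exprn_gt0.
  have mA := measurable_ltr (x0 * 2 ^+ n) mY.
  have mB := measurable_ger (- (x0 * 2 ^+ n)) mY.
  apply: (@le_trans _ _ (P ([set w | x0 * 2 ^+ n < Y w] `|` [set w | Y w <= - (x0 * 2 ^+ n)]))).
    apply: le_measure; rewrite ?inE//.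
    - exact: measurable_ler.
    - exact: measurableU.
    - move=> w /=; rewrite -mulrA; have [Y0|Y0] := leP 0 (Y w) => h.
        by left; move: h; rewrite ger0_norm// => h; lra.
      by right; move: h; rewrite ltr0_norm// => h; lra.
  apply: (@le_trans _ _ (P [set w | (x0 * 2 ^+ n < Y w)%R] +
      P [set w | (Y w <= - (x0 * 2 ^+ n))%R])%E); first exact: measureU2.
  rewrite -(fineK (fin_num_measure P _ mA)) -(fineK (fin_num_measure P _ mB)) -EFinD lee_fin.
  by have := hk n; rewrite (mulrC _ (G x0)).
by apply: (powR_integral_lty (f := fun w => `|Y w|) _ _ _ H) => //; exact: ltW.
Qed.

(** * The supOU kernel and its Riemann sums *)

Section supou_kernel.
Context {R : realType}.
Local Notation leb := (@lebesgue_measure R).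
Implicit Types (xi s t u v h : R) (n : nat).

Lemma measurable_supou_kernel t : measurable_fun setT (@supou_kernel R t).
Proof.
have m1 : measurable_fun setT (fun z : R * R => z.1 * t).
  by apply: measurable_funM => //; exact: measurable_fst.
have m2 : measurable_fun setT (fun z : R * R => z.2) by exact: measurable_snd.
apply: measurable_fun_ifT => //.
  exact: measurable_fun_ler.
by apply: measurableT_comp => //; exact: measurable_funB.
Qed.

Lemma measurable_supou_kernel_section t xi : measurable_fun setT (fun s => supou_kernel t (xi, s)).
Proof. by apply: (measurableT_comp (measurable_supou_kernel t)); exact: measurable_pair1. Qed.

Lemma supou_kernel_ge0 t z : 0 <= @supou_kernel R t z.
Proof. by rewrite /supou_kernel; case: ifPn => // _; exact: expR_ge0. Qed.

Lemma supou_kernel_le1 t z : @supou_kernel R t z <= 1.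
Proof.
rewrite /supou_kernel; case: ifPn => // h.
by rewrite -expR0 ler_expR subr_le0.
Qed.

(** Shifting [s] by [xi * t] removes both [xi] and [t], which is where stationarity comes from. The
    factor 1 matches the shape of [ge0_integral_affine]. *)
Lemma supou_kernel_shift t xi s :
  supou_kernel t (xi, 1 * s + xi * t) = supou_kernel 0 (0, s).
Proof. by rewrite /supou_kernel/= mul1r gerDr !mulr0 addrK subr0. Qed.

Lemma integral_supou_kernel t xi : (\int[leb]_s (supou_kernel t (xi, s))%:E = 1)%E.
Proof.
rewrite (@ge0_integral_affine _ 1 (xi * t))//; first last.
- by move=> s; rewrite lee_fin supou_kernel_ge0.
- by apply/measurable_EFinP; exact: measurable_supou_kernel_section.
rewrite mul1e; under eq_integral do rewrite supou_kernel_shift.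
have e1 := @integral_exponential_pdf R 1 ltr01.
have m1 : measurable_fun setT (fun x : R => (exponential_pdf 1 x)%:E).
  by apply/measurable_EFinP; exact: measurable_exponential_pdf.
have g1 (x : R) : (0 <= (exponential_pdf 1 x)%:E)%E.
  by rewrite lee_fin exponential_pdf_ge0.
rewrite -e1.
transitivity (\int[leb]_(x in `[0%R, +oo[) (exponential_pdf 1 x)%:E)%E; last first.
  rewrite integral_mkcond; apply: eq_integral => x _; rewrite patchE; case: ifPn => //.
  rewrite notin_setE/= in_itv/= andbT => /negP; rewrite -ltNge => x0.
  by rewrite lt0_exponential_pdf.
rewrite ge0_integration_by_substitution0// [RHS]integral_mkcond.
apply: eq_integral => x _; rewrite /supou_kernel/= mulr0 subr0 patchE.
have -> : (x \in `]-oo, 0%R]%classic) = (x <= 0).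
  by apply/idP/idP; rewrite inE/= in_itv/=.
case: ifPn => // x0; rewrite exponential_pdfE ?oppr_ge0//.
by rewrite mul1r mulN1r opprK.
Qed.

(** For [s <= xi * u] the later kernel is [exp (- xi (v - u))] times the earlier one; for other [s]
    the earlier one vanishes. The additive form lets all terms be integrated as nonnegative
    functions, without subtraction of extended reals. *)
Lemma supou_kernel_distr xi u v s : 0 <= xi -> u <= v ->
  `|supou_kernel u (xi, s) - supou_kernel v (xi, s)| +
    2 * expR (- (xi * (v - u))) * supou_kernel u (xi, s) =
  supou_kernel u (xi, s) + supou_kernel v (xi, s).
Proof.
move=> xi0 uv; have xuv : xi * u <= xi * v by rewrite ler_wpM2l.
set c := expR _.
have c1 : c <= 1 by rewrite -expR0 ler_expR oppr_le0 mulr_ge0// subr_ge0.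
have [su|su] := boolP (s <= xi * u).
  have eu : supou_kernel u (xi, s) = expR (s - xi * u) by rewrite /supou_kernel/= su.
  have ev : supou_kernel v (xi, s) = c * expR (s - xi * u).
    by rewrite /supou_kernel/= (le_trans su xuv) -expRD; congr expR; ring.
  rewrite eu ev ger0_norm; first by ring.
  by rewrite subr_ge0 ler_piMl// expR_ge0.
have eu : supou_kernel u (xi, s) = 0 by rewrite /supou_kernel/= (negbTE su).
by rewrite eu mulr0 addr0 sub0r normrN add0r ger0_norm// supou_kernel_ge0.
Qed.

Lemma integral_supou_kernel_distr xi u v : 0 <= xi ->
  (\int[leb]_s `|supou_kernel u (xi, s) - supou_kernel v (xi, s)|%:E =
    (2 - 2 * expR (- (xi * `|v - u|)))%:E)%E.
Proof.
move=> xi0; wlog uv : u v / u <= v.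
  move=> H; have [uv|/ltW vu] := leP u v; first exact: H.
  rewrite (distrC v) -H//; apply: eq_integral => s _.
  by rewrite distrC.
have mk t := measurable_supou_kernel_section t xi.
have mE t : @measurable_fun _ _ (measurableTypeR R) _ setT (fun s => (supou_kernel t (xi, s))%:E).
  by apply/measurable_EFinP; exact: measurable_supou_kernel_section.
have k0 t s : setT s -> (0 <= (supou_kernel t (xi, s))%:E)%E by rewrite lee_fin supou_kernel_ge0.
have md : measurable_fun setT (fun s => `|supou_kernel u (xi, s) - supou_kernel v (xi, s)|%:E).
  by apply/measurable_EFinP; apply: measurableT_comp => //; exact: measurable_funB.
rewrite [ `|v - u|]ger0_norm ?subr_ge0//.
set c := expR _.
have c0 : 0 <= 2 * c by rewrite mulr_ge0 ?expR_ge0.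
have : (\int[leb]_s (`|supou_kernel u (xi, s) - supou_kernel v (xi, s)|%:E +
    (2 * c)%:E * (supou_kernel u (xi, s))%:E) =
    \int[leb]_s ((supou_kernel u (xi, s))%:E + (supou_kernel v (xi, s))%:E))%E.
  by apply: eq_integral => s _; rewrite -EFinM -!EFinD supou_kernel_distr.
rewrite ge0_integralD//; last 2 first.
- by move=> s _; rewrite mule_ge0// k0.
- exact: (measurable_funeM (2 * c)%:E (mE u)).
have eZ : (\int[leb]_s ((2 * c)%:E * (supou_kernel u (xi, s))%:E) = (2 * c)%:E)%E.
  rewrite -[RHS]mule1 -(integral_supou_kernel u xi).
  exact: (ge0_integralZl_EFin leb measurableT (k0 u) (mE u) c0).
rewrite [X in _ = X -> _](ge0_integralD leb measurableT (k0 u) (mE u) (k0 v) (mE v)).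
rewrite [X in _ = (X + _)%E -> _]integral_supou_kernel [X in _ = (_ + X)%E -> _]integral_supou_kernel.
rewrite [X in (_ + X)%E = _ -> _]eZ => e.
have := e; case: (\int[leb]_s _)%E => //= r [re].
by congr (_%:E); rewrite -[r](addrK (2 * c)) re.
Qed.

(** Kernel of the left-endpoint Riemann sum of [Y] over [[0, n h]]. The bounds below are proved at
    this discrete level, uniformly in the mesh, so the kernel of [X t] itself is never computed. *)
Definition riemann_kernel h n (z : R * R) : R :=
  h * \sum_(j < n) supou_kernel (j%:R * h) z.

Lemma measurable_riemann_kernel h n : measurable_fun setT (riemann_kernel h n).
Proof.
apply: measurable_funM => //; apply: measurable_sum => j.
exact: measurable_supou_kernel.
Qed.

Lemma riemann_kernel_ge0 h n z : 0 <= h -> 0 <= riemann_kernel h n z.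
Proof. by move=> h0; rewrite mulr_ge0// sumr_ge0// => j _; exact: supou_kernel_ge0. Qed.

Lemma riemann_kernel_le h n z : 0 <= h -> riemann_kernel h n z <= n%:R * h.
Proof.
move=> h0; rewrite /riemann_kernel mulrC; apply: ler_wpM2r => //.
apply: (@le_trans _ _ (\sum_(j < n) 1)); last by rewrite sumr_const card_ord.
by apply: ler_sum => j _; exact: supou_kernel_le1.
Qed.

(* The sum telescopes against [(1 + 1/x) (1 - exp (min 0 (s - n x)))] with [x = xi h],
   because [(1 + 1/x) (1 - exp (- x)) >= 1]. *)
Lemma riemann_kernel_le_inv h n xi s : 0 < h -> 0 < xi ->
  riemann_kernel h n (xi, s) <= h + xi^-1.
Proof.
move=> h0 xi0; pose x := xi * h; have x0 : 0 < x by rewrite mulr_gt0.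
have xK : 1 <= (1 + x^-1) * (1 - expR (- x)).
  have : 1 + x <= expR x := expR_ge1Dx x.
  rewrite expRN => ex.
  have e0 : (expR x)^-1 <= (1 + x)^-1 by rewrite lef_pV2 ?posrE ?expR_gt0// addr_gt0.
  rewrite [leLHS](_ : 1 = (1 + x^-1) * (1 - (1 + x)^-1)); last first.
    by field; rewrite (gt_eqF x0)/= gt_eqF// addr_gt0.
  by rewrite ler_pM2l ?addr_gt0 ?invr_gt0// lerB.
have K0 : 0 <= 1 + x^-1 by rewrite addr_ge0// invr_ge0 ltW.
suff H : \sum_(j < n) supou_kernel (j%:R * h) (xi, s) <=
    (1 + x^-1) * (1 - expR (Num.min 0 (s - n%:R * x))).
  have : riemann_kernel h n (xi, s) <= h * (1 + x^-1).
    rewrite ler_pM2l//; apply: (le_trans H).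
    by rewrite ler_piMr// gerBl expR_ge0.
  move/le_trans; apply; rewrite mulrDr mulr1 lerD2l /x invfM mulrCA mulfV ?mulr1//.
  by rewrite gt_eqF.
elim: n => [|n IH].
  rewrite big_ord0 mul0r subr0 mulr_ge0// subr_ge0 -expR0 ler_expR.
  by rewrite ge_min lexx.
rewrite big_ord_recr/=; apply: (le_trans (lerD IH (lexx _))).
rewrite /supou_kernel/= (_ : xi * (n%:R * h) = n%:R * x); last by rewrite /x; ring.
have e : s - n.+1%:R * x = (s - n%:R * x) - x by rewrite -natr1; ring.
case: ifPn => [sn|]; last first.
  rewrite -ltNge => sn; rewrite addr0 ler_wpM2l// lerB// ler_expR.
  have -> : Num.min 0 (s - n%:R * x) = 0 by apply/min_idPl; rewrite subr_ge0 ltW.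
  by rewrite ge_min lexx.
have sn0 : s - n%:R * x <= 0 by rewrite subr_le0.
have sn1 : s - n.+1%:R * x <= 0 by rewrite e subr_le0 (le_trans sn0)// ltW.
rewrite (min_idPr sn0) (min_idPr sn1) e (expRD (s - _)).
set E := expR (s - n%:R * x); have E0 : 0 <= E by exact: expR_ge0.
have -> : (1 + x^-1) * (1 - E * expR (- x)) =
   (1 + x^-1) * (1 - E) + E * ((1 + x^-1) * (1 - expR (- x))) by ring.
by rewrite lerD2l ler_peMr.
Qed.

(** A jump in [[-1, 0]] decaying at rate at most [1 / (n h)] keeps a fixed fraction of its size over
    the whole window: each exponent [s - xi j h] is at least [-1 - 1]. *)
Lemma riemann_kernel_ge h n xi s : 0 <= h -> 0 <= xi -> xi * (n%:R * h) <= 1 ->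
  -1 <= s <= 0 -> n%:R * h * expR (- 2) <= riemann_kernel h n (xi, s).
Proof.
move=> h0 xi0 xin /andP[s1 s0]; rewrite mulrAC mulrC ler_wpM2l//.
apply: (@le_trans _ _ (\sum_(j < n) expR (- 2))).
  by rewrite sumr_const card_ord mulr_natl.
apply: ler_sum => j _; rewrite /supou_kernel/=.
have j0 : 0 <= xi * (j%:R * h) by rewrite !mulr_ge0.
have jn : xi * (j%:R * h) <= xi * (n%:R * h).
  by rewrite ler_wpM2l// ler_wpM2r// ler_nat ltnW.
by rewrite (le_trans s0 j0) ler_expR; lra.
Qed.

Lemma integral_riemann_kernel h n xi : 0 <= h ->
  (\int[leb]_s (riemann_kernel h n (xi, s))%:E = (n%:R * h)%:E)%E.
Proof.
move=> h0.
have mE t : @measurable_fun _ _ (measurableTypeR R) _ setT (fun s => (supou_kernel t (xi, s))%:E).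
  by apply/measurable_EFinP; exact: measurable_supou_kernel_section.
have k0 t s : setT s -> (0 <= (supou_kernel t (xi, s))%:E)%E by rewrite lee_fin supou_kernel_ge0.
transitivity (\int[leb]_s (h%:E * \sum_(j < n) (supou_kernel (j%:R * h) (xi, s))%:E))%E.
  by apply: eq_integral => s _; rewrite /riemann_kernel EFinM sumEFin.
rewrite ge0_integralZl_EFin//; last 2 first.
- by move=> s _; apply: sume_ge0 => j _; exact: k0.
- by apply: emeasurable_sum => j; exact: mE.
rewrite ge0_integral_sum//; last by move=> j s _; exact: k0.
under eq_bigr do rewrite integral_supou_kernel.
by rewrite sumEFin sumr_const card_ord -EFinM mulrC.
Qed.

End supou_kernel.

(** * Integrals of the kernels against [pi] times Lebesgue measure *)

Section kernel_integrals.
Context {R : realType}.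
Local Notation leb := (@lebesgue_measure R).
Variable pi : probability R R.
Hypothesis pi_pos : pi `]-oo, 0]%classic = 0%E.
Local Notation Q := (pi \x leb)%E.

Lemma ge0_integral_positive_half (F : R -> \bar R) : measurable_fun setT F ->
  (forall x, (0 <= F x)%E) ->
  (\int[pi]_x F x = \int[pi]_(x in [set x | (0 < x)%R]) F x)%E.
Proof.
move=> mF F0.
have TE : [set: R] = [set x | 0 < x] `|` `]-oo, 0]%classic.
  by apply/seteqP; split => x //= _; rewrite in_itv/=; case: (ltP 0 x); [left|right].
have mA : measurable [set x : R | 0 < x].
  exact: (@measurable_ltr _ _ _ (fun x : R => x) 0).
rewrite TE ge0_integral_setU//; last 2 first.
- by apply: measurable_funS mF.
- apply/disj_setPS => x [/= x1x]; rewrite in_itv/= leNgt.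
  by rewrite x1x.
by rewrite (null_set_integral (measurable_itv _) _ pi_pos) ?adde0//; apply: measurable_funS mF.
Qed.

Lemma integral_product_kernel (f : R * R -> \bar R) :
  measurable_fun setT f -> (forall z, (0 <= f z)%E) ->
  (\int[Q]_z f z = \int[pi]_(x in [set x | (0 < x)%R]) \int[leb]_s f (x, s))%E.
Proof.
move=> mf f0; rewrite fubini_tonelli1//.
rewrite /fubini_F ge0_integral_positive_half//.
- exact: (@measurable_fun_fubini_tonelli_F _ _ _ _ _ leb f mf f0).
- by move=> x; apply: integral_ge0.
Qed.

(** Write [k^r = k k^(r-1-a) k^a] and [t = n h]. The first factor integrates to [t] in [s]; the
    second is at most [t^(r-1-a)] since [k <= t] and [r >= 1 + a]; the third is at most
    [(1 + 1/xi)^a <= 2^a (1 + xi^(-a))], whose [pi]-integral involves only [J]. *)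
Lemma integral_riemann_kernel_powR (a r J h : R) (n : nat) :
  (\int[pi]_(x in [set x | (0 < x)%R]) (x^-1 `^ a)%:E <= J%:E)%E ->
  0 < a -> 1 + a <= r -> 0 < h <= 1 -> 1 <= n%:R * h ->
  (\int[Q]_z (riemann_kernel h n z `^ r)%:E <=
    ((n%:R * h) `^ (r - a) * (2 `^ a * (1 + J)))%:E)%E.
Proof.
move=> HJ a0 ar /andP[h0 h1] t1.
set t := n%:R * h in t1 *.
have t0 : 0 < t by apply: lt_le_trans t1.
have mr : measurable_fun setT (riemann_kernel h n) by exact: measurable_riemann_kernel.
rewrite integral_product_kernel; first last.
- by move=> z; rewrite lee_fin powR_ge0.
- by apply/measurable_EFinP; exact: (measurableT_comp (measurable_powR r)).
pose B (x : R) := t `^ (r - 1 - a) * (2 `^ a * (1 + x^-1 `^ a)).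
have B0 x : 0 <= B x by rewrite !mulr_ge0 ?powR_ge0// addr_ge0// powR_ge0.
have mpow : measurable_fun setT (fun x : R => (x^-1 `^ a)%:E).
  by apply/measurable_EFinP; exact: (measurableT_comp (measurable_powR a) (@measurable_inv R)).
have mA : measurable [set x : R | 0 < x].
  exact: (@measurable_ltr _ _ _ (fun x : R => x) 0).
have inner x : 0 < x -> (\int[leb]_s (riemann_kernel h n (x, s) `^ r)%:E <= (t * B x)%:E)%E.
  move=> x0.
  have mrs : @measurable_fun _ _ (measurableTypeR R) _ setT (fun s => riemann_kernel h n (x, s)).
    by apply: (measurableT_comp mr); exact: measurable_pair1.
  have mrsE : @measurable_fun _ _ (measurableTypeR R) _ setT (fun s => (riemann_kernel h n (x, s))%:E).
    exact/measurable_EFinP.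
  have r0 s : setT s -> (0 <= (riemann_kernel h n (x, s))%:E)%E.
    by rewrite lee_fin riemann_kernel_ge0// ltW.
  have eI : (\int[leb]_s ((B x)%:E * (riemann_kernel h n (x, s))%:E) = (t * B x)%:E)%E.
    rewrite [LHS](ge0_integralZl_EFin leb measurableT r0 mrsE (B0 x)).
    by rewrite integral_riemann_kernel ?ltW// -EFinM mulrC.
  rewrite -eI; apply: ge0_le_integral => //.
  - by move=> s _; rewrite lee_fin powR_ge0.
  - by apply/measurable_EFinP; exact: (measurableT_comp (measurable_powR r)).
  - exact: measurable_funeM.
  move=> s _; rewrite -EFinM lee_fin.
  set k := riemann_kernel h n (x, s).
  have k0 : 0 <= k by rewrite riemann_kernel_ge0// ltW.
  have kt : k <= t by rewrite riemann_kernel_le// ltW.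
  have kx : k <= 1 + x^-1.
    by rewrite (le_trans (riemann_kernel_le_inv _ _ h0 x0))// lerD2r.
  have x10 : 0 < x^-1 by rewrite invr_gt0.
  rewrite -(mulr_powRB1 k0); last by lra.
  rewrite mulrC; apply: ler_wpM2r => //.
  have -> : r - 1 = (r - 1 - a) + a by ring.
  rewrite powRD; last by rewrite subrK implybE gt_eqF//; lra.
  apply: ler_pM; rewrite ?powR_ge0//.
    by apply: ge0_ler_powR; rewrite ?nnegrE//; [lra|exact: ltW].
  apply: (@le_trans _ _ ((1 + x^-1) `^ a)).
    apply: ge0_ler_powR; rewrite ?nnegrE//; first exact: ltW.
    by rewrite addr_ge0// ltW.
  rewrite mulrDr mulr1; have [x1|x1] := leP x^-1 1.
    apply: (@le_trans _ _ (2 `^ a)); last by rewrite lerDl mulr_ge0 ?powR_ge0.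
    apply: ge0_ler_powR; rewrite ?nnegrE//; first exact: ltW.
      by rewrite addr_ge0// ltW.
    by lra.
  apply: (@le_trans _ _ (2 `^ a * x^-1 `^ a)); last by rewrite lerDr powR_ge0.
  rewrite -powRM//; last exact: ltW.
  apply: ge0_ler_powR; rewrite ?nnegrE//; first exact: ltW.
  - by rewrite addr_ge0// ltW.
  - by rewrite mulr_ge0// ltW.
  by lra.
pose c := t * (t `^ (r - 1 - a) * 2 `^ a).
have c0 : 0 <= c by rewrite !mulr_ge0 ?powR_ge0// ltW.
apply: (@le_trans _ _ (\int[pi]_(x in [set x | (0 < x)%R]) (c%:E * (1 + (x^-1 `^ a)%:E)))%E).
  apply: ge0_le_integral => //.
  - by move=> x _; apply: integral_ge0 => s _; rewrite lee_fin powR_ge0.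
  - apply: measurable_funTS.
    apply: (@measurable_fun_fubini_tonelli_F _ _ _ _ _ leb (fun z => (riemann_kernel h n z `^ r)%:E)).
      by apply/measurable_EFinP; exact: (measurableT_comp (measurable_powR r)).
    by move=> z; rewrite lee_fin powR_ge0.
  - apply: measurable_funeM; apply: emeasurable_funD => //.
    exact: measurable_funTS.
  move=> x x0; rewrite (le_trans (inner _ x0))// -EFinD -EFinM lee_fin /B /c.
  by rewrite le_eqVlt; apply/orP; left; apply/eqP; ring.
rewrite ge0_integralZl_EFin//; first last.
- by apply: emeasurable_funD => //; exact: measurable_funTS.
- by move=> x _; rewrite adde_ge0// lee_fin powR_ge0.
rewrite ge0_integralD//; first last.
- exact: measurable_funTS.
- by move=> x _; rewrite lee_fin powR_ge0.
rewrite [X in (_ * (X + _))%E](integral_cst pi mA 1%E) mul1e.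
apply: (@le_trans _ _ (c%:E * (1 + J%:E))%E).
  apply: lee_wpmul2l => //; apply: leeD => //.
  exact: probability_le1.
rewrite -EFinD -EFinM lee_fin /c.
have -> : t * (t `^ (r - 1 - a) * 2 `^ a) = t `^ (r - a) * 2 `^ a.
  rewrite mulrA -{1}(powRr1 (ltW t0)) -gt0_powRD//.
  by congr (_ `^ _ * _); ring.
by rewrite mulrA.
Qed.

Let W (h : R) := (\int[pi]_(x in [set x | (0 < x)%R]) (2 - 2 * expR (- (x * h)))%:E)%E.

Lemma measurable_mod (h : R) : measurable_fun setT (fun x : R => (2 - 2 * expR (- (x * h)))%:E).
Proof.
apply/measurable_EFinP; apply: measurable_funB => //; apply: measurable_funM => //.
apply: measurableT_comp => //; apply: measurableT_comp => //.
exact: measurable_funM.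
Qed.

Lemma integral_supou_kernel_diff (u v h : R) : `|v - u| <= h ->
  (\int[Q]_z `|supou_kernel u z - supou_kernel v z|%:E <= W h)%E.
Proof.
move=> uvh.
rewrite integral_product_kernel; last 2 first.
- apply/measurable_EFinP; apply: measurableT_comp => //.
  by apply: measurable_funB; exact: measurable_supou_kernel.
- by move=> z; rewrite lee_fin.
have mA : measurable [set x : R | 0 < x].
  exact: (@measurable_ltr _ _ _ (fun x : R => x) 0).
have e : (\int[pi]_(x in [set x | (0 < x)%R])
   \int[leb]_s `|supou_kernel u (x, s) - supou_kernel v (x, s)|%:E =
   \int[pi]_(x in [set x | (0 < x)%R]) (2 - 2 * expR (- (x * `|v - u|)))%:E)%E.
  apply: eq_integral => x; rewrite inE/= => x0.
  by rewrite integral_supou_kernel_distr// ltW.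
rewrite e; apply: ge0_le_integral => //.
- move=> x /= x0; rewrite lee_fin subr_ge0 ler_piMr// -expR0 ler_expR oppr_le0.
  by rewrite mulr_ge0// ltW.
- by apply: measurable_funTS; exact: measurable_mod.
- by apply: measurable_funTS; exact: measurable_mod.
move=> x /= x0; rewrite lee_fin lerB// ler_pM2l// ler_expR lerN2.
by rewrite ler_pM2l.
Qed.

(** For fixed [xi] the L1 distance in [s] depends only on [|v - u|]; its [pi]-integral tends to 0 by
    dominated convergence along [h = 1 / (m + 1)], with the constant 2 as majorant. *)
Lemma supou_kernel_modulus (eta : R) : 0 < eta ->
  exists2 h0 : R, 0 < h0 & forall u v, `|v - u| <= h0 ->
  (\int[Q]_z `|supou_kernel u z - supou_kernel v z|%:E <= eta%:E)%E.
Proof.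
move=> eta0.
have mA : measurable [set x : R | 0 < x].
  exact: (@measurable_ltr _ _ _ (fun x : R => x) 0).
pose f_ (m : nat) (x : R) := (2 - 2 * expR (- (x * m.+1%:R^-1)))%:E.
have b (m : nat) (x : R) : 0 < x -> 0 <= 2 - 2 * expR (- (x * m.+1%:R^-1)) <= 2.
  move=> x0; rewrite subr_ge0 ler_piMr//=; last first.
    by rewrite -expR0 ler_expR oppr_le0 mulr_ge0// ltW.
  by rewrite gerBl mulr_ge0// expR_ge0.
have cv (x : R) : (2 - 2 * expR (- (x * m.+1%:R^-1))) @[m --> \oo] --> (0 : R).
  rewrite -[X in _ --> X](_ : 2 - 2 * expR (- (x * 0)) = 0); last first.
    by rewrite mulr0 oppr0 expR0 mulr1 subrr.
  apply: cvgB; first exact: cvg_cst.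
  apply: cvgM; first exact: cvg_cst.
  apply: continuous_cvg; first exact: continuous_expR.
  apply: cvgN; apply: cvgM; first exact: cvg_cst.
  exact: cvg_harmonic.
have mf m : measurable_fun [set x : R | 0 < x] (f_ m).
  by apply: measurable_funTS; exact: measurable_mod.
have cvE : {ae pi, forall x, [set x : R | 0 < x] x -> f_ ^~ x @ \oo --> (cst 0%E : R -> \bar R) x}.
  apply: aeW => x _; apply/fine_cvgP; split; first exact: nearW.
  exact: cv.
have i2 : pi.-integrable [set x : R | 0 < x] (cst 2%:E).
  apply: (@integrableS _ _ _ pi setT) => //.
  by apply: (@bounded_integrable _ _ _ pi (fun=> 2) `|2|).
have dom : {ae pi, forall x, forall m, [set x : R | 0 < x] x -> (`|f_ m x| <= (cst 2%:E : R -> \bar R) x)%E}.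
  apply: aeW => x m /= x0; have /andP[b1 b2] := b m x x0.
  by rewrite lee_fin ger0_norm.
have [_ _] := dominated_convergence mA mf (measurable_cst _) cvE i2 dom.
rewrite integral0 => /fine_cvgP[fin cvf].
have n1 : \forall m \near \oo, fine (\int[pi]_(x in [set x | (0 < x)%R]) f_ m x)%E < eta.
  exact: (cvgr_lt _ cvf).
near \oo => m.
have fm : (\int[pi]_(x in [set x | (0 < x)%R]) f_ m x)%E \is a fin_num by near: m.
have em : fine (\int[pi]_(x in [set x | (0 < x)%R]) f_ m x)%E < eta by near: m.
exists m.+1%:R^-1; first by rewrite invr_gt0.
move=> u v /integral_supou_kernel_diff/le_trans; apply.
by rewrite /W -(fineK fm) lee_fin ltW.
Unshelve. all: by end_near. Qed.

End kernel_integrals.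

(** * The Levy exponent *)

Section psi.
Context {R : realType}.
Variable mu : {measure set R -> \bar R}.
Hypothesis levy_mu : levy_measure mu.

(* Minus the real part of the cumulant function when [b = 0]. *)
Definition psi (z : R) := (\int[mu]_x (1 - cos (z * x))%:E)%E.

Lemma measurable_onem_cosM (z : R) : measurable_fun setT (fun x : R => (1 - cos (z * x))%:E).
Proof.
apply/measurable_EFinP; apply: measurable_funB => //.
exact: (@measurable_cosM _ _ _ (fun x => x)).
Qed.

Lemma onem_cos_ge0 (x : R) : 0 <= 1 - cos x.
Proof. by rewrite subr_ge0 cos_le1. Qed.

Lemma psi_ge0 z : (0 <= psi z)%E.
Proof. by apply: integral_ge0 => x _; rewrite lee_fin onem_cos_ge0. Qed.

Lemma psi_lty z : (psi z < +oo)%E.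
Proof.
have [_ h] := levy_mu.
pose c := 2 * (1 + z ^+ 2).
have c0 : 0 <= c by rewrite mulr_ge0// addr_ge0// sqr_ge0.
have m1 : measurable_fun setT (fun x : R => (Num.min 1 (x ^+ 2))%:E).
  by apply/measurable_EFinP; apply: measurable_minr => //; exact: measurable_funX.
have h1 x : setT x -> (0 <= (Num.min 1 (x ^+ 2 : R))%:E)%E.
  by rewrite lee_fin le_min ler01 sqr_ge0.
apply: (@le_lt_trans _ _ (\int[mu]_x (c%:E * (Num.min 1 (x ^+ 2))%:E))%E).
  apply: ge0_le_integral => //.
  - exact: measurable_onem_cosM.
  - exact: measurable_funeM.
  move=> x _; rewrite -EFinM lee_fin.
  have z2 := sqr_ge0 z; have x2 := sqr_ge0 x.
  case: (leP 1 (x ^+ 2)) => x1.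
    by have := cos_geN1 (z * x); rewrite /c; lra.
  have := @onem_cos_le R (z * x) 2; rewrite lexx ler0n => /(_ isT).
  rewrite -[2]/(2%:R) powR_mulrn// real_normK ?num_real// exprMn => /le_trans; apply.
  rewrite -subr_ge0 /c (_ : _ - _ = 2 * x ^+ 2); last by ring.
  by rewrite mulr_ge0.
rewrite ge0_integralZl_EFin// lte_mul_pinfty//.
Qed.

(** Finiteness of [psi] matters here: [Rintegral] would silently return 0 on an infinite
    integral. *)
Lemma kappa_re_psi z : (kappa_re 0 mu z)%:E = (- psi z)%E.
Proof.
rewrite /kappa_re mulr0 mul0r oppr0 add0r /Rintegral.
have e : (\int[mu]_x (cos (z * x) - 1)%:E = - psi z)%E.
  rewrite /psi -integral_ge0N//.
  by apply: eq_integral => x _; rewrite -EFinN opprB.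
rewrite e fineK// fin_numN ge0_fin_numE ?psi_ge0//; exact: psi_lty.
Qed.

(** Small and large jumps get different exponents in [onem_cos_le], because near 0 and near infinity
    [mu] has moments of different orders. *)
Lemma psi_le (r1 r2 M1 M2 z : R) : 0 <= r1 <= 2 -> 0 <= r2 <= 2 ->
  (\int[mu]_(x in [set x | (`|x| <= 1)%R]) (`|x| `^ r1)%:E <= M1%:E)%E ->
  (\int[mu]_(x in [set x | (1 < `|x|)%R]) (`|x| `^ r2)%:E <= M2%:E)%E ->
  (psi z <= (2 * M1 * `|z| `^ r1 + 2 * M2 * `|z| `^ r2)%:E)%E.
Proof.
move=> r12 r22 H1 H2.
have mn : measurable_fun setT (fun x : R => `|x|) by apply: measurableT_comp.
have mA := measurable_ger 1 mn; have mB := measurable_ltr 1 mn.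
have mp (r : R) (D : set R) : measurable_fun D (fun x : R => (`|x| `^ r)%:E).
  by apply: measurable_funTS; exact: (@measurable_normr_powR _ _ _ (fun x : R => x)).
have TE : [set: R] = [set x | `|x| <= 1] `|` [set x | 1 < `|x|].
  by apply/seteqP; split => x //= _; case: (ltP 1 `|x|); [right|left].
have part (r M : R) (D : set R) : measurable D -> 0 <= r <= 2 ->
    (\int[mu]_(x in D) (`|x| `^ r)%:E <= M%:E)%E ->
    (\int[mu]_(x in D) (1 - cos (z * x))%:E <= (2 * M * `|z| `^ r)%:E)%E.
  move=> mD hr HM.
  apply: (@le_trans _ _ (\int[mu]_(x in D) ((2 * `|z| `^ r)%:E * (`|x| `^ r)%:E))%E).
    apply: ge0_le_integral => //.
    - by apply: measurable_funTS; exact: measurable_onem_cosM.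
    - exact: measurable_funeM.
    move=> x _; rewrite -EFinM lee_fin (le_trans (onem_cos_le _ hr))//.
    by rewrite normrM powRM// mulrA.
  rewrite ge0_integralZl_EFin ?mulr_ge0 ?powR_ge0//.
  have -> : 2 * M * `|z| `^ r = 2 * `|z| `^ r * M by ring.
  rewrite (EFinM (2 * `|z| `^ r)); exact: lee_wpmul2l.
rewrite /psi TE ge0_integral_setU//; first last.
- by apply/disj_setPS => x [/= x1x]; rewrite ltNge x1x.
- by apply: measurable_funTS; exact: measurable_onem_cosM.
by rewrite EFinD; apply: leeD; exact: part.
Qed.

End psi.

(** * Consequences of the power tails of [mu] at zero *)

Section levy_tails.
Context {R : realType}.
Variable mu : {measure set R -> \bar R}.
Hypothesis levy_mu : levy_measure mu.
Variables (cp cm beta : R).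
Hypothesis cp_ge0 : 0 <= cp.
Hypothesis cm_ge0 : 0 <= cm.
Hypothesis cpm : 0 < cp + cm.
Hypothesis beta_ge0 : 0 <= beta.
Hypothesis hcp : (mu `[x, +oo[%classic * (x `^ beta)%:E)%E @[x --> 0^'+] --> cp%:E.
Hypothesis hcm : (mu `]-oo, (- x)%R]%classic * (x `^ beta)%:E)%E @[x --> 0^'+] --> cm%:E.

Lemma measurable_norm_ge (y : R) : measurable [set x : R | y <= `|x|].
Proof. by apply: (@measurable_ler _ _ _ (fun x : R => `|x|)); exact: measurableT_comp. Qed.

Lemma norm_geE (y : R) : 0 < y -> [set x : R | y <= `|x|] = `[y, +oo[%classic `|` `]-oo, - y]%classic.
Proof.
move=> y0; apply/seteqP; split => x /=; rewrite !in_itv/= ?andbT.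
  by case: (ler0P x) => x0 h; [right; rewrite lerNr|left].
by case=> h; [rewrite (le_trans h)// ler_norm|rewrite -normrN (le_trans _ (ler_norm _))// lerNr].
Qed.

Lemma levy_tail_near0 : exists2 x0 : R, 0 < x0 & exists2 C : R, 0 < C &
  forall u, 0 < u < x0 -> (mu [set x | (u <= `|x|)%R] <= (C * u `^ (- beta))%:E)%E.
Proof.
have [f1 g1] := (fine_cvgP _ _).1 hcp.
have [f2 g2] := (fine_cvgP _ _).1 hcm.
have n1 : \forall x \near 0^'+, fine (mu `[x, +oo[%classic * (x `^ beta)%:E)%E < cp + 1.
  by apply: (cvgr_lt _ g1); rewrite ltrDl.
have n2 : \forall x \near 0^'+, fine (mu `]-oo, (- x)%R]%classic * (x `^ beta)%:E)%E < cm + 1.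
  by apply: (cvgr_lt _ g2); rewrite ltrDl.
have /near0rP[x0 x00 h] : \forall x \near 0^'+,
    ((mu `[x, +oo[%classic * (x `^ beta)%:E)%E \is a fin_num /\
     fine (mu `[x, +oo[%classic * (x `^ beta)%:E)%E < cp + 1) /\
    ((mu `]-oo, (- x)%R]%classic * (x `^ beta)%:E)%E \is a fin_num /\
     fine (mu `]-oo, (- x)%R]%classic * (x `^ beta)%:E)%E < cm + 1).
  by near=> x; split; split; near: x.
exists x0 => //; exists (cp + 1 + (cm + 1)).
  by apply: addr_gt0; rewrite ltr_wpDl.
move=> u /[dup] /andP[u0 _] /h[[a1 a2] [a3 a4]].
have ub : 0 < u `^ beta by rewrite powR_gt0.
have tail (A : set R) (c : R) : (mu A * (u `^ beta)%:E)%E \is a fin_num ->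
    fine (mu A * (u `^ beta)%:E)%E < c -> (mu A <= (c * u `^ (- beta))%:E)%E.
  move=> fA lA; have : (mu A * (u `^ beta)%:E <= c%:E)%E.
    by rewrite -(fineK fA) lee_fin ltW.
  by rewrite -lee_pdivlMr// powRN => h1; exact: h1.
rewrite norm_geE// mulrDl EFinD; apply: le_trans (leeD (tail _ _ a1 a2) (tail _ _ a3 a4)).
by apply: measureU2.
Unshelve. all: by end_near. Qed.

(** The set [|x| >= y0 / 2^(k+1)] has mass [O(2^(k beta))], and [|x|^r1] is at most [(y0 / 2^k)^r1]
    on the k-th shell, so the series has ratio [2^(beta - r1) < 1]. Between [y0] and 1 the integrand
    is at most 1 and the mass is finite. *)
Lemma levy_small_moment (r1 : R) : beta < r1 ->
  (\int[mu]_(x in [set x | (`|x| <= 1)%R]) (`|x| `^ r1)%:E < +oo)%E.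
Proof.
move=> br.
have r10 : 0 < r1 by exact: le_lt_trans br.
have [x0 x00 [C C0 h]] := levy_tail_near0.
pose y0 := Num.min (x0 / 2) 1.
have y00 : 0 < y0 by rewrite lt_min divr_gt0//= ltr01.
have y0x : y0 < x0 by rewrite gt_min ltr_pdivrMr//; apply/orP; left; lra.
have y01 : y0 <= 1 by rewrite ge_min lexx orbT.
pose th : R := 2 `^ (beta - r1).
have /andP[th0 th1] := powR2_lt1 br.
have mn : measurable_fun setT (fun x : R => `|x|) by apply: measurableT_comp.
have mp (r : R) (D : set R) : measurable_fun D (fun x : R => (`|x| `^ r)%:E).
  by apply: measurable_funTS; exact: (@measurable_normr_powR _ _ _ (fun x : R => x)).
have mA := measurable_ger y0 mn; have mB := measurable_ltr y0 mn.
pose y k := y0 / 2 ^+ k.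
have yk0 k : 0 < y k by rewrite divr_gt0// exprn_gt0.
pose phi k x : \bar R := ((y k) `^ r1 * \1_[set x : R | y k.+1 <= `|x|] x)%:E.
have H : (\int[mu]_(x in [set x | (`|x| <= y0)%R]) (`|x| `^ r1)%:E <=
    ((y0 `^ (r1 - beta) * (C * 2 `^ beta)) / (1 - th))%:E)%E.
  apply: (@integral_le_geometric _ _ _ mu _ _ phi) => //.
  - move=> k; apply/measurable_EFinP; apply: measurable_funTS.
    apply: measurable_funM => //; apply: measurable_indic; exact: measurable_norm_ge.
  - by move=> k x _; rewrite lee_fin mulr_ge0// powR_ge0.
  - move=> x /= xy; have [->|xn0] := eqVneq x 0.
      by exists 0%N; rewrite normr0 powR0 ?gt_eqF// lee_fin mulr_ge0// powR_ge0.
    have nx0 : 0 < `|x| by rewrite normr_gt0.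
    have [k /andP[k1 k2]] : exists k, 2 ^+ k <= y0 / `|x| < 2 ^+ k.+1.
      by apply: dyadic_bracket; rewrite ler_pdivlMr// mul1r.
    exists k; rewrite lee_fin indicE mem_set/=; last first.
      rewrite /y ler_pdivrMr ?exprn_gt0// mulrC.
      by move: k2; rewrite ltr_pdivrMr// => /ltW.
    rewrite mulr1; apply: ge0_ler_powR; rewrite ?nnegrE//; first exact: ltW.
      exact: ltW.
    rewrite /y ler_pdivlMr ?exprn_gt0// mulrC.
    by move: k1; rewrite ler_pdivlMr.
  - by rewrite th0.
  - by rewrite !mulr_ge0 ?powR_ge0// ltW.
  move=> k; apply: (@le_trans _ _ (\int[mu]_x phi k x)%E).
    apply: ge0_subset_integral => //.
      apply/measurable_EFinP; apply: measurable_funM => //; apply: measurable_indic.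
      exact: measurable_norm_ge.
    by move=> x _; rewrite lee_fin mulr_ge0// powR_ge0.
  have -> : phi k = (fun x => ((y k) `^ r1)%:E * (\1_[set x : R | y k.+1 <= `|x|] x)%:E)%E.
    by apply/funext => x; rewrite -EFinM.
  rewrite ge0_integralZl_EFin ?powR_ge0//; last first.
    by apply/measurable_EFinP; apply: measurable_indic; exact: measurable_norm_ge.
  rewrite integral_indic//; last exact: measurable_norm_ge.
  rewrite setIT; apply: (@le_trans _ _ (((y k) `^ r1)%:E * (C * (y k.+1) `^ (- beta))%:E)%E).
    apply: lee_wpmul2l; first by rewrite lee_fin powR_ge0.
    apply: h; rewrite yk0/= (le_lt_trans _ y0x)// /y ler_pdivrMr ?exprn_gt0//.
    by rewrite ler_peMr ?(ltW y00)// exprn_ege1// ler1n.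
  rewrite -EFinM lee_fin.
  have -> : (y k.+1) `^ (- beta) = (y k) `^ (- beta) * 2 `^ beta.
    rewrite /y exprSr invfM mulrA powRM ?(ltW (yk0 k))//.
    by congr (_ * _); rewrite -[2^-1]powR_inv1// -powRrM mulN1r opprK.
  have -> : th ^+ k = (2 ^+ k) `^ (beta - r1) by rewrite expr_powR.
  have -> : y k `^ r1 * (C * (y k `^ (- beta) * 2 `^ beta)) =
      (y k `^ r1 * y k `^ (- beta)) * (C * 2 `^ beta) by ring.
  rewrite -(gt0_powRD _ _ (yk0 k)).
  have -> : y k `^ (r1 - beta) = y0 `^ (r1 - beta) * (2 ^+ k) `^ (beta - r1).
    rewrite /y powRM ?(ltW y00) ?invr_ge0 ?exprn_ge0//; congr (_ * _).
    by rewrite -[X in X `^ _]powR_inv1 ?exprn_ge0// -powRrM mulN1r opprB.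
  by rewrite le_eqVlt; apply/orP; left; apply/eqP; ring.
apply: (@le_lt_trans _ _ (\int[mu]_(x in [set x | (`|x| <= y0)%R]) (`|x| `^ r1)%:E +
   \int[mu]_(x in [set x | (y0 <= `|x|)%R]) 1)%E).
  have mI : measurable ([set x : R | `|x| <= y0] `|` [set x : R | y0 < `|x| <= 1]).
    apply: measurableU => //.
    rewrite (_ : [set x : R | y0 < `|x| <= 1] = [set x : R | y0 < `|x|] `&` [set x : R | `|x| <= 1]).
      by apply: measurableI => //; exact: measurable_ger.
    by apply/seteqP; split => x /=; [move=> /andP[]|move=> [-> ->]].
  have mI2 : measurable [set x : R | y0 < `|x| <= 1].
    rewrite (_ : [set x : R | y0 < `|x| <= 1] = [set x : R | y0 < `|x|] `&` [set x : R | `|x| <= 1]).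
      by apply: measurableI => //; exact: measurable_ger.
    by apply/seteqP; split => x /=; [move=> /andP[]|move=> [-> ->]].
  rewrite (_ : [set x : R | `|x| <= 1] = [set x : R | `|x| <= y0] `|` [set x : R | y0 < `|x| <= 1]); last first.
    apply/seteqP; split => x /=.
      by move=> x1; case: (leP `|x| y0); [left|right; rewrite x1].
    by case=> [/le_trans|/andP[]//]; exact.
  rewrite ge0_integral_setU//; first last.
  - by apply/disj_setPS => x [/= x1x]; rewrite ltNge x1x.
  apply: leeD => //.
  apply: (@le_trans _ _ (\int[mu]_(x in [set x | (y0 < `|x| <= 1)%R]) 1)%E).
    apply: ge0_le_integral => //.
    move=> x /= /andP[_ x1]; rewrite lee_fin -(powRr0 `|x|).
    have [->|xn0] := eqVneq x 0; first by rewrite normr0 powR0 ?gt_eqF// powRr0.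
    by apply: ger_powR; [rewrite normr_gt0 xn0|exact: ltW].
  apply: ge0_subset_integral => //; first exact: measurable_norm_ge.
  by move=> x /= /andP[/ltW].
rewrite (integral_cst mu (measurable_norm_ge y0) 1%E) mul1e.
apply: lte_add_pinfty; first by apply: (le_lt_trans H); exact: ltry.
by apply: (@le_lt_trans _ _ (C * y0 `^ (- beta))%:E); [apply: h; rewrite y00|exact: ltry].
Qed.

(** As [cp + cm > 0], some annulus [u <= |x| <= n + 1] is charged by [mu]. With [zeta = 1 / (n + 1)]
    the argument [zeta y x] remains in a compact part of []0, 1]] in absolute value. The range of
    [y] is that of the kernel divided by [t] in [riemann_kernel_ge]. *)
Lemma psi_lower_bound : exists2 zeta : R, 0 < zeta & exists2 c : R, 0 < c &
  forall y, expR (- 2) <= y <= 1 -> (c%:E <= psi mu (zeta * y))%E.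
Proof.
have [x0 x00 [C C0 h]] := levy_tail_near0.
have [f1 g1] := (fine_cvgP _ _).1 hcp.
have [f2 g2] := (fine_cvgP _ _).1 hcm.
have gs : (fine (mu `[x, +oo[%classic * (x `^ beta)%:E)%E +
    fine (mu `]-oo, (- x)%R]%classic * (x `^ beta)%:E)%E) @[x --> 0^'+] --> cp + cm.
  exact: cvgD g1 g2.
have n1 : \forall x \near 0^'+, 0 < fine (mu `[x, +oo[%classic * (x `^ beta)%:E)%E +
    fine (mu `]-oo, (- x)%R]%classic * (x `^ beta)%:E)%E by exact: (cvgr_gt _ gs).
have /near0rP[e e0 he] := n1.
pose u := Num.min (e / 2) (Num.min (x0 / 2) (1 / 2)).
have u0 : 0 < u by rewrite !lt_min !divr_gt0.
have ue : u < e by rewrite gt_min; apply/orP; left; rewrite ltr_pdivrMr//; lra.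
have ux : u < x0 by rewrite !gt_min ltr_pdivrMr//; apply/orP; right; apply/orP; left; lra.
have u1 : u <= 1 by rewrite !ge_min; apply/orP; right; apply/orP; right; lra.
have muu : mu [set x | (u <= `|x|)%R] != 0%E.
  apply/eqP => m0.
  have sub (A : set R) : measurable A -> A `<=` [set x | u <= `|x|] -> mu A = 0%E.
    move=> mA sA; apply/eqP; rewrite eq_le measure_ge0 andbT -m0.
    by apply: le_measure; rewrite ?inE//; exact: measurable_norm_ge.
  have := he u; rewrite u0 ue => /(_ isT).
  have sU := norm_geE u0.
  by rewrite !sub ?mul0e ?addr0 ?ltxx// sU => x; [right|left].
pose A (n : nat) := [set x : R | u <= `|x| <= n.+1%:R].
have mn : measurable_fun setT (fun x : R => `|x|) by apply: measurableT_comp.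
have AE n : A n = [set x : R | u <= `|x|] `&` [set x : R | `|x| <= n.+1%:R].
  by rewrite /A; apply/seteqP; split => x /=; [move=> /andP[]|move=> [-> ->]].
have mA n : measurable (A n).
  rewrite AE; apply: measurableI; [exact: measurable_norm_ge|exact: measurable_ger].
have [n An] : exists n, mu (A n) != 0%E.
  apply/not_existsP => nA; move/eqP: muu; apply.
  have UA : \bigcup_n A n = [set x | u <= `|x|].
    apply/seteqP; split => [x [n _ /= /andP[]//]|x /= xu].
    exists (Num.truncn `|x|) => //; rewrite /A/= xu/= ltW//.
    by have /andP[] := truncn_itv (normr_ge0 x).
  have : (mu \o A) x @[x --> \oo] --> mu (\bigcup_n A n).
    apply: nondecreasing_cvg_mu => //.
      by rewrite UA; exact: measurable_norm_ge.
    move=> k l kl; apply/subsetPset => x; rewrite /A/= => /andP[-> xk]/=.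
    by rewrite (le_trans xk)// ler_nat.
  rewrite UA (_ : mu \o A = cst 0%E); last first.
    by apply/funext => k /=; apply/eqP; move/negP: (nA k); rewrite negbK.
  by move/(cvg_lim (@ereal_hausdorff R)) => <-; rewrite lim_cst//; exact: ereal_hausdorff.
have Afin : mu (A n) \is a fin_num.
  rewrite ge0_fin_numE// (@le_lt_trans _ _ (C * u `^ (- beta))%:E)//; last exact: ltry.
  apply: le_trans (h u _); last by rewrite u0.
  by apply: le_measure; rewrite ?inE//; [exact: measurable_norm_ge|move=> x /= /andP[]].
(* The least value of [|zeta y x|] allowed by [y >= exp (-2)] and [|x| >= u]. *)
pose delta := expR (- 2) * u / n.+1%:R.
have d0 : 0 < delta by rewrite divr_gt0// mulr_gt0// expR_gt0.
have d1 : delta <= 1.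
  rewrite ler_pdivrMr// mul1r (@le_trans _ _ 1)// ?ler1n//.
  have e1 : expR (- 2) <= 1 :> R by rewrite -[leRHS]expR0 ler_expR oppr_le0.
  by rewrite mulr_ile1 ?expR_ge0 // (ltW u0).
have c0 : 0 < 1 - cos delta by apply: cos_ltr1; rewrite d0.
exists n.+1%:R^-1; first by rewrite invr_gt0.
exists ((1 - cos delta) * fine (mu (A n))).
  by rewrite mulr_gt0// fine_gt0// lt_neqAle eq_sym An measure_ge0/= -ge0_fin_numE.
move=> y /andP[y1 y2].
apply: (@le_trans _ _ (\int[mu]_(x in A n) (1 - cos (n.+1%:R^-1 * y * x))%:E)%E); last first.
  by apply: ge0_subset_integral => //; exact: measurable_onem_cosM.
rewrite EFinM fineK// -(integral_cst mu (mA n) (1 - cos delta)%:E).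
apply: ge0_le_integral => //.
- by move=> x _; rewrite lee_fin ltW.
- by apply: measurable_funTS; exact: measurable_onem_cosM.
move=> x /andP[xu xn]; rewrite lee_fin; apply: le_onem_cos; first exact: ltW.
have y0 : 0 < y by apply: lt_le_trans y1; exact: expR_gt0.
rewrite !normrM (gtr0_norm y0) normfV (gtr0_norm (ltr0Sn _ _)).
rewrite /delta mulrC mulrA; apply/andP; split.
  rewrite -!mulrA; apply: ler_wpM2l; first by rewrite invr_ge0.
  by apply: ler_pM => //; exact: ltW.
rewrite -mulrA [_^-1 * _]mulrC -mulrA.
apply: (@le_trans _ _ 1); last by rewrite ler1n.
apply: mulr_ile1 => //; first exact: ltW.
by rewrite ler_pdivrMr// mul1r.
Qed.

End levy_tails.

(** * Characteristic functions of the supOU process *)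

(** The function equal to [exp s] for [s <= 0] and to 0 otherwise, to which every section of the
    supOU kernel reduces after a shift in [s]. *)
Definition ou_kernel {R : realType} (s : R) : R := supou_kernel 0 (0, s).

Section supou_characteristic_functions.
Context {R : realType} {d : measure_display} {T : measurableType d}.
Local Notation leb := (@lebesgue_measure R).
Variables (P : probability T R) (Y : R -> T -> R) (a : R).
Variables (mu : {measure set R -> \bar R}) (pi : probability R R).
Hypothesis HY : supOU P Y a 0 mu pi.
Local Notation Q := (pi \x leb)%E.

Lemma supOU_levy : levy_measure mu. Proof. by case: HY => _ []. Qed.

Lemma supOU_measurable t : measurable_fun setT (Y t).
Proof. by case: HY => _ [_ [_ [mY _]]]; exact: mY. Qed.

(** Minus the logarithm of the modulus of the characteristic function of the linear combination with
    kernel [g]. *)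
Definition expo (g : R * R -> R) : R := fine (\int[Q]_z psi mu (g z))%E.

(** Kernel and variable enter as [g] and [Z] with pointwise equalities, so that one statement serves
    Riemann sums, increments and single times. The phase [KI] is left unevaluated. *)
Lemma supOU_char (n : nat) (ts zs : 'I_n -> R) (g : R * R -> R) (Z : T -> R) :
  (forall x, g x = \sum_(j < n) zs j * supou_kernel (ts j) x) ->
  (forall w, Z w = \sum_(j < n) zs j * Y (ts j) w) ->
  let KI := Rintegral Q setT (kappa_im a mu \o g) in
  [/\ (\int[Q]_z psi mu (g z) = (expo g)%:E)%E,
    \int[P]_w cos (Z w) = expR (- expo g) * cos KI &
    \int[P]_w sin (Z w) = expR (- expo g) * sin KI].
Proof.
move=> /funext gE /funext ZE KI.
have [_ [_ [_ [_ /(_ n ts zs)]]]] := HY.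
rewrite /= -gE -ZE => -[iR [iI [eC eS]]].
have kE z : (kappa_re 0 mu (g z))%:E = (- psi mu (g z))%E.
  by rewrite kappa_re_psi//; exact: supOU_levy.
have e1 : (\int[Q]_z (kappa_re 0 mu (g z))%:E = - \int[Q]_z psi mu (g z))%E.
  rewrite -integral_ge0N; last by move=> z _; exact: psi_ge0.
  by apply: eq_integral => z _; rewrite kE.
have fin : (\int[Q]_z psi mu (g z))%E \is a fin_num.
  by rewrite -fin_numN -e1; exact: (integrable_fin_num measurableT iR).
have eKR : Rintegral Q setT (kappa_re 0 mu \o g) = - expo g.
  by rewrite /Rintegral/= e1 fineN.
split; first by rewrite /expo fineK.
  by move: eC; rewrite unlock eKR /Rintegral => ->.
by move: eS; rewrite unlock eKR /Rintegral => ->.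
Qed.

(** Measurability is read off the integrability clause for [kappa_re] in [supOU], rather than from a
    regularity property of [psi]. *)
Lemma measurable_psi_lincomb (n : nat) (ts zs : 'I_n -> R) (g : R * R -> R) :
  (forall x, g x = \sum_(j < n) zs j * supou_kernel (ts j) x) ->
  measurable_fun setT (fun x => psi mu (g x)).
Proof.
move=> /funext gE; have [_ [_ [_ [_ /(_ n ts zs)]]]] := HY; rewrite /= -gE => -[iR _].
have mR := measurable_int _ iR.
have -> : (fun x => psi mu (g x)) = (fun x => (- (kappa_re 0 mu (g x))%:E)%E).
  by apply/funext => x; rewrite kappa_re_psi ?oppeK//; exact: supOU_levy.
apply/measurable_EFinP; apply: (measurableT_comp (@oppr_measurable R setT)).
exact/measurable_EFinP.
Qed.

(** The phase disappears because [cos^2 + sin^2 = 1], leaving [1 - exp (- 2 I) <= 2 I]. *)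
Lemma supOU_char_sq (n : nat) (ts zs : 'I_n -> R) (g : R * R -> R) (Z : T -> R) (B : R) :
  (forall x, g x = \sum_(j < n) zs j * supou_kernel (ts j) x) ->
  (forall w, Z w = \sum_(j < n) zs j * Y (ts j) w) ->
  (\int[Q]_z psi mu (g z) <= B%:E)%E ->
  1 - (\int[P]_w cos (Z w)) ^+ 2 - (\int[P]_w sin (Z w)) ^+ 2 <= 2 * B.
Proof.
move=> gE ZE; have [eg -> ->] := supOU_char gE ZE.
rewrite eg lee_fin => hB.
set KI := Rintegral _ _ _; rewrite !exprMn -addrA -opprD -mulrDr cos2Dsin2 mulr1.
rewrite -expRM_natl mulrN.
set e := expo _ in hB *; have := expR_ge1Dx (- (2 * e)).
by move=> h; lra.
Qed.

Lemma supOU_cos_le (n : nat) (ts zs : 'I_n -> R) (g : R * R -> R) (Z : T -> R) (b : R) :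
  (forall x, g x = \sum_(j < n) zs j * supou_kernel (ts j) x) ->
  (forall w, Z w = \sum_(j < n) zs j * Y (ts j) w) ->
  (b%:E <= \int[Q]_z psi mu (g z))%E ->
  \int[P]_w cos (Z w) <= expR (- b).
Proof.
move=> gE ZE; have [eg -> _] := supOU_char gE ZE.
rewrite eg lee_fin => hB; set e := expo _ in hB *.
apply: (@le_trans _ _ (expR (- e))); last by rewrite ler_expR lerN2.
by rewrite ler_piMr ?expR_ge0// cos_le1.
Qed.

Definition riemann_sum (h : R) (n : nat) (w : T) : R := h * \sum_(j < n) Y (j%:R * h) w.

Let riemann_lincomb h n z w :
  z * riemann_sum h n w = \sum_(j < n) (z * h) * Y (j%:R * h) w.
Proof. by rewrite /riemann_sum mulrA mulr_sumr. Qed.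

Let riemann_kernel_lincomb h n (z : R) x :
  z * riemann_kernel h n x = \sum_(j < n) (z * h) * supou_kernel (j%:R * h) x.
Proof. by rewrite /riemann_kernel mulrA mulr_sumr. Qed.

Lemma riemann_char_sq h n z B :
  (\int[Q]_x psi mu (z * riemann_kernel h n x) <= B%:E)%E ->
  1 - (\int[P]_w cos (z * riemann_sum h n w)) ^+ 2 -
    (\int[P]_w sin (z * riemann_sum h n w)) ^+ 2 <= 2 * B.
Proof.
exact: (supOU_char_sq (riemann_kernel_lincomb h n z) (riemann_lincomb h n z)).
Qed.

Lemma measurable_psi_riemann_kernel h n z :
  measurable_fun setT (fun x => psi mu (z * riemann_kernel h n x)).
Proof. exact: (measurable_psi_lincomb (riemann_kernel_lincomb h n z)). Qed.

Lemma riemann_cos_le h n z b :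
  (b%:E <= \int[Q]_x psi mu (z * riemann_kernel h n x))%E ->
  \int[P]_w cos (z * riemann_sum h n w) <= expR (- b).
Proof.
exact: (supOU_cos_le (riemann_kernel_lincomb h n z) (riemann_lincomb h n z)).
Qed.

Let increment_kernel_lincomb (u v z : R) x :
  z * (supou_kernel u x - supou_kernel v x) =
  \sum_(j < 2) (if j == ord0 then z else - z) * supou_kernel (if j == ord0 then u else v) x.
Proof. by rewrite !big_ord_recl big_ord0 /= addr0; ring. Qed.

Let increment_lincomb (u v z : R) w :
  z * (Y u w - Y v w) =
  \sum_(j < 2) (if j == ord0 then z else - z) * Y (if j == ord0 then u else v) w.
Proof. by rewrite !big_ord_recl big_ord0 /= addr0; ring. Qed.

Lemma measurable_psi_increment u v z :
  measurable_fun setT (fun x => psi mu (z * (supou_kernel u x - supou_kernel v x))).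
Proof. exact: (measurable_psi_lincomb (increment_kernel_lincomb u v z)). Qed.

Lemma increment_char_sq u v z B :
  (\int[Q]_x psi mu (z * (supou_kernel u x - supou_kernel v x)) <= B%:E)%E ->
  1 - (\int[P]_w cos (z * (Y u w - Y v w))) ^+ 2 -
    (\int[P]_w sin (z * (Y u w - Y v w))) ^+ 2 <= 2 * B.
Proof.
exact: (supOU_char_sq (increment_kernel_lincomb u v z) (increment_lincomb u v z)).
Qed.

(** For each [xi] the shift in [s] yields the same inner integral, and [pi] has total mass 1. *)
Lemma integral_kernel_stationary (phi : R -> \bar R) (z t : R) :
  measurable_fun setT (fun x : R * R => phi (z * supou_kernel t x)%R) ->
  (forall y, (0 <= phi y)%E) ->
  (\int[Q]_x phi (z * supou_kernel t x)%R =
   \int[leb]_s phi (z * ou_kernel s)%R)%E.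
Proof.
move=> mphi phi0; rewrite fubini_tonelli1//.
rewrite (eq_integral (cst (\int[leb]_s phi (z * ou_kernel s)%R)%E)); last first.
  move=> x _; rewrite /fubini_F.
  rewrite (@ge0_integral_affine _ 1 (x * t) (fun y => phi (z * supou_kernel t (x, y))))//.
    by rewrite mul1e; apply: eq_integral => s _; rewrite supou_kernel_shift.
  have m0 : measurable_fun setT (fun s : R => (x, s)) by exact: measurable_pair1.
  exact: (measurableT_comp mphi m0).
rewrite integral_cst//.
have -> : (pi : {measure set R -> \bar R}) setT = 1%E by exact: probability_setT.
by rewrite mule1.
Qed.

Let single_kernel_lincomb (t z : R) x :
  z * supou_kernel t x = \sum_(j < 1) z * supou_kernel t x.
Proof. by rewrite big_ord1. Qed.

Let single_lincomb (t z : R) w : z * Y t w = \sum_(j < 1) z * Y t w.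
Proof. by rewrite big_ord1. Qed.

Lemma measurable_psi_kernel z t :
  measurable_fun setT (fun x => psi mu (z * supou_kernel t x)).
Proof. exact: (measurable_psi_lincomb (single_kernel_lincomb t z)). Qed.

Lemma supOU_cos_le_ou_kernel z : exists2 I : R,
  (\int[leb]_s psi mu (z * ou_kernel s)%R = I%:E)%E &
  \int[P]_w cos (z * Y 1 w) <= expR (- I).
Proof.
have [eg ec _] := supOU_char (single_kernel_lincomb 1 z) (single_lincomb 1 z).
exists (expo (fun x => z * supou_kernel 1 x)).
  rewrite -eg -(@integral_kernel_stationary _ z 1)//; last by move=> y; exact: psi_ge0.
  exact: measurable_psi_kernel.
by rewrite ec ler_piMr ?expR_ge0// cos_le1.
Qed.

(** Modulus and phase are rewritten as integrals along [ou_kernel], where time no longer occurs. The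
    phase has no sign, so its positive and negative parts are transported separately by the
    nonnegative statement. *)
Lemma supOU_stationary z t :
  \int[P]_w cos (z * Y t w) = \int[P]_w cos (z * Y 1 w) /\
  \int[P]_w sin (z * Y t w) = \int[P]_w sin (z * Y 1 w).
Proof.
have main u : exists I J,
   [/\ \int[P]_w cos (z * Y u w) = expR (- I) * cos J,
    \int[P]_w sin (z * Y u w) = expR (- I) * sin J,
    I = fine (\int[leb]_s psi mu (z * ou_kernel s)%R)%E &
    J = fine (\int[leb]_s ((EFin \o kappa_im a mu)^\+ (z * ou_kernel s)%R) -
      \int[leb]_s ((EFin \o kappa_im a mu)^\- (z * ou_kernel s)%R))%E].
  have [_ [_ [_ [_ /(_ 1%N (fun=> u) (fun=> z))]]]] := HY.
  have e1 := single_kernel_lincomb u z; have e2 := single_lincomb u z.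
  have [eg ec es] := supOU_char e1 e2; have /funext e1' := e1.
  rewrite /= -e1' => -[iR [iI _]].
  have mI := measurable_int _ iI;
  exists (expo (fun x => z * supou_kernel u x)).
  exists (Rintegral Q setT (kappa_im a mu \o (fun x => z * supou_kernel u x))).
  split; [exact: ec|exact: es| |].
    rewrite /expo integral_kernel_stationary//; last by move=> y; exact: psi_ge0.
    exact: (measurable_psi_lincomb e1).
  rewrite /Rintegral integralE; congr (fine (_ - _)%E).
    rewrite -(@integral_kernel_stationary (EFin \o kappa_im a mu)^\+%E z u)//.
    by apply: eq_integral => x _; rewrite !funeposE.
    have := measurable_funepos mI; apply: eq_measurable_fun => x _.
    by rewrite !funeposE.
  rewrite -(@integral_kernel_stationary (EFin \o kappa_im a mu)^\-%E z u)//.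
  by apply: eq_integral => x _; rewrite !funenegE.
  have := measurable_funeneg mI; apply: eq_measurable_fun => x _.
  by rewrite !funenegE.
have [I [J [-> -> -> ->]]] := main t; have [I' [J' [-> -> -> ->]]] := main 1.
by split.
Qed.

End supou_characteristic_functions.

Section onem_cos.
Context {d : measure_display} {T : measurableType d} {R : realType}.
Variable P : probability T R.

Lemma integral_onem_cos (X : T -> R) (z : R) : measurable_fun setT X ->
  (\int[P]_w (1 - cos (z * X w))%:E = (1 - \int[P]_w cos (z * X w))%:E)%E.
Proof.
move=> mX; have iC := integrable_cosM P z mX.
have i1 : P.-integrable setT (EFin \o cst (1 : R)).
  by apply: (@bounded_integrable _ _ _ _ _ 1) => // x; rewrite normr1.
rewrite -EFin_Rintegral; last exact: integrable_EFinB.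
rewrite RintegralB//; congr (_ - _)%:E; exact: Rintegral_cst_probability.
Qed.

Lemma integral_onem_cos_le_moment (X : T -> R) (z r M : R) : measurable_fun setT X ->
  0 <= r <= 2 -> (\int[P]_w (`|X w| `^ r)%:E <= M%:E)%E ->
  1 - \int[P]_w cos (z * X w) <= 2 * `|z| `^ r * M.
Proof.
move=> mX r02 HM; rewrite -lee_fin -integral_onem_cos//.
have z0 : 0 <= 2 * `|z| `^ r by rewrite mulr_ge0// powR_ge0.
apply: (@le_trans _ _ (\int[P]_w ((2 * `|z| `^ r)%:E * (`|X w| `^ r)%:E))%E).
  apply: ge0_le_integral => //.
  - by apply/measurable_EFinP; apply: measurable_funB => //; exact: measurable_cosM.
  - by apply: measurable_funeM; exact: measurable_normr_powR.
  move=> w _; rewrite -EFinM lee_fin -mulrA -powRM// -normrM; exact: onem_cos_le.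
rewrite ge0_integralZl_EFin//; last exact: measurable_normr_powR.
by rewrite (EFinM _ M); apply: lee_wpmul2l.
Qed.

End onem_cos.

(** * Large jumps *)

Section large_jumps.
Context {R : realType}.
Local Notation leb := (@lebesgue_measure R).
Variable mu : {measure set R -> \bar R}.
Hypothesis levy_mu : levy_measure mu.

Lemma levy_large_mass : (mu [set x | (1 <= `|x|)%R] < +oo)%E.
Proof.
have [_ h] := levy_mu; apply: le_lt_trans h.
have mA : measurable [set x : R | 1 <= `|x|] by exact: measurable_norm_ge.
rewrite -(mul1e (mu _)) -(integral_cst mu mA 1%E).
have m1 : measurable_fun setT (fun x : R => (Num.min 1 (x ^+ 2))%:E).
  by apply/measurable_EFinP; apply: measurable_minr => //; exact: measurable_funX.
have p1 (x : R) : (0 <= (Num.min 1 (x ^+ 2))%:E)%E by rewrite lee_fin le_min ler01 sqr_ge0.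
apply: (@le_trans _ _ (\int[mu]_(x in [set x : R | (1 <= `|x|)%R]) (Num.min 1 (x ^+ 2))%:E)%E).
  apply: ge0_le_integral => //; first exact: measurable_funTS.
  move=> x /= x1; rewrite lee_fin le_min lexx/=.
  by rewrite -[x ^+ 2]real_normK ?num_real// exprn_ege1.
exact: ge0_subset_integral.
Qed.

Let B k := [set x : R | 2 ^+ k <= `|x|] `&` [set x : R | `|x| <= 2 ^+ k.+1].

Let mn : measurable_fun setT (fun x : R => `|x|).
Proof. by apply: measurableT_comp. Qed.

Let mB k : measurable (B k).
Proof. by apply: measurableI; [exact: measurable_norm_ge|exact: measurable_ger]. Qed.

(** [exp (-1) / 2] is the least [|z y x|] for [z = 2^(-k-1)], [y >= exp (-1)] and [|x| >= 2^k]; the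
    values of [ou_kernel] on [[-1, 0]] play the part of [y]. *)
Let c : R := 1 - cos (expR (- 1) / 2).

Let c_gt0 : 0 < c.
Proof.
apply: cos_ltr1; rewrite divr_gt0 ?expR_gt0//= ler_pdivrMr// mul1r.
by apply: (@le_trans _ _ 1); [rewrite -[leRHS]expR0 ler_expR; lra|lra].
Qed.

Let psi_dyadic k y : expR (- 1) <= y <= 1 ->
  (c%:E * mu (B k) <= psi mu ((2 ^+ k.+1)^-1 * y))%E.
Proof.
move=> /andP[y1 y2]; rewrite -(integral_cst mu (mB k) c%:E).
have k0 : 0 < 2 ^+ k.+1 :> R by rewrite exprn_gt0.
apply: (@le_trans _ _ (\int[mu]_(x in B k) (1 - cos ((2 ^+ k.+1)^-1 * y * x))%:E)%E); last first.
  by apply: ge0_subset_integral => //; exact: measurable_onem_cosM.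
apply: ge0_le_integral => //.
- by move=> x _; rewrite lee_fin ltW.
- by apply: measurable_funTS; exact: measurable_onem_cosM.
move=> x [/= xk xk1]; rewrite lee_fin; apply: le_onem_cos.
  by rewrite divr_ge0// expR_ge0.
have y0 : 0 < y by apply: lt_le_trans y1; exact: expR_gt0.
rewrite !normrM (gtr0_norm y0) normfV (gtr0_norm k0); apply/andP; split.
  rewrite [_^-1 * y]mulrC -mulrA; apply: ler_pM => //.
  by rewrite ler_pdivlMl// exprSr -mulrA mulfV// mulr1.
rewrite [_^-1 * y]mulrC -mulrA; apply: (@le_trans _ _ 1); last by rewrite ler1n.
apply: mulr_ile1 => //; [exact: ltW|by rewrite ler_pdivrMl// mulr1].
Qed.

Let mass_dyadic (C r z0 : R) k : (forall z : R, 0 < z <= z0 ->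
    (\int[leb]_s psi mu (z * ou_kernel s)%R <= (C * z `^ r)%:E)%E) ->
  (forall z, measurable_fun setT (fun s : R => psi mu (z * ou_kernel s))) ->
  (2 ^+ k.+1)^-1 <= z0 ->
  (mu (B k) <= (C / c * ((2 ^+ k.+1)^-1) `^ r)%:E)%E.
Proof.
move=> HC mpsi kz; set z := (2 ^+ k.+1)^-1 in kz *.
have z0' : 0 < z by rewrite invr_gt0 exprn_gt0.
have := HC z; rewrite z0' kz => /(_ isT) => h.
suff : (c%:E * mu (B k) <= (C * z `^ r)%:E)%E.
  by rewrite mulrAC EFinM -lee_pdivlMl// -?EFinM; rewrite mulrC.
apply: le_trans h.
have mI : measurable (`[-1, 0]%classic : set R) by [].
apply: (@le_trans _ _ (\int[leb]_(s in `[(-1)%R, 0%R]) (c%:E * mu (B k)))%E).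
  have l1 : leb `[(-1)%R, 0%R]%classic = 1%E.
    rewrite lebesgue_measure_itv/= lte_fin ltrN10.
    by rewrite -EFinD add0r opprK.
  rewrite (integral_cst leb mI (c%:E * mu (B k))%E).
  by rewrite [X in (_ <= _ * X)%E](_ : _ = 1%E) ?mule1//; exact: l1.
apply: (@le_trans _ _ (\int[leb]_(s in `[(-1)%R, 0%R]) psi mu (z * ou_kernel s)%R)%E).
  apply: ge0_le_integral => //.
  - by move=> x _; rewrite mule_ge0// lee_fin ltW.
  - exact: measurable_funTS (mpsi z).
  move=> s /=; rewrite in_itv/= => /andP[s1 s2]; apply: psi_dyadic.
  rewrite /ou_kernel /supou_kernel/= mul0r s2 subr0 ler_expR s1/=.
  by rewrite -[leRHS]expR0 ler_expR.
apply: ge0_subset_integral => //; first exact: mpsi.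
by move=> s _; exact: psi_ge0.
Qed.

(* For every [s] in [[-1, 0]] the function [1 - cos (z (exp s) x)] is bounded below on
   the dyadic shell [|x| ~ 1/z], so the mass of each shell is controlled without any
   exchange of integrals. *)
Lemma levy_large_moment (C r r2 z0 : R) : 0 < z0 -> 0 <= C -> (forall z : R, 0 < z <= z0 ->
    (\int[leb]_s psi mu (z * ou_kernel s)%R <= (C * z `^ r)%:E)%E) ->
  (forall z, measurable_fun setT (fun s : R => psi mu (z * ou_kernel s))) ->
  0 < r2 < r ->
  (\int[mu]_(x in [set x | (1 < `|x|)%R]) (`|x| `^ r2)%:E < +oo)%E.
Proof.
move=> z00 C0 HC mpsi /andP[r20 r2r].
have r0 : 0 < r by exact: lt_trans r2r.
have m1 := levy_large_mass; set m := mu [set x | (1 <= `|x|)%R] in m1.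
have fm0 : 0 <= fine m by rewrite fine_ge0// (measure_ge0 mu _).
have mfin : m \is a fin_num by rewrite (ge0_fin_numE (measure_ge0 mu _)).
have [K hK] : exists K : nat, (2 ^+ K)^-1 <= z0.
  exists (Num.truncn z0^-1).+1; rewrite invf_ple ?posrE ?exprn_gt0//.
  have zi : 0 <= z0^-1 by rewrite invr_ge0 ltW.
  have /andP[_ /ltW /le_trans] := truncn_itv zi; apply.
  by rewrite -natrX ler_nat ltnW// ltn_expl.
(* The first term serves the shells [k >= K], whose frequency is at most [z0]; the second covers the
   finitely many others through the total mass [m] beyond 1. *)
pose C' := C / c + fine m * (2 ^+ K) `^ r.
have Cc0 : 0 <= C / c by rewrite divr_ge0// ltW.
have C'0 : 0 <= C' by rewrite addr_ge0// mulr_ge0 ?powR_ge0.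
have Bk k : (mu (B k) <= (C' * (2 ^+ k) `^ (- r))%:E)%E.
  have p0 j : 0 < 2 ^+ j :> R by rewrite exprn_gt0.
  have [kK|kK] := ltnP k K.
    apply: (@le_trans _ _ m).
      apply: le_measure; rewrite ?inE//; first exact: measurable_norm_ge.
      by move=> x [/= xk _]; rewrite (le_trans _ xk)// exprn_ege1// ler1n.
    rewrite -(fineK mfin) lee_fin /C' mulrDl ler_wpDl//.
      by rewrite mulr_ge0// powR_ge0.
    rewrite -mulrA ler_peMr//.
    rewrite powRN ler_pdivlMr ?powR_gt0// mul1r ge0_ler_powR ?nnegrE ?(ltW r0) ?ltW//.
    by rewrite -!natrX ltr_nat ltn_exp2l.
  apply: le_trans (mass_dyadic HC mpsi _) _.
    apply: le_trans hK; rewrite lef_pV2 ?posrE//.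
    by rewrite -!natrX ler_nat leq_exp2l// ltnW.
  rewrite lee_fin; apply: ler_pM => //.
    by rewrite /C' lerDl mulr_ge0// powR_ge0.
  rewrite -powR_inv1 ?(ltW (p0 _))// -powRrM mulN1r !powRN lef_pV2 ?posrE ?powR_gt0//.
  rewrite ge0_ler_powR ?nnegrE ?(ltW r0) ?(ltW (p0 _))//.
  by rewrite -!natrX ler_nat leq_exp2l.
pose th : R := 2 `^ (r2 - r).
have /andP[th0 th1] := powR2_lt1 r2r.
have mp (q : R) (D : set R) : measurable_fun D (fun x : R => (`|x| `^ q)%:E).
  by apply: measurable_funTS; exact: (@measurable_normr_powR _ _ _ (fun x : R => x)).
have mA := measurable_ltr 1 mn.
pose phi k x : \bar R := ((2 ^+ k.+1) `^ r2 * \1_(B k) x)%:E.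
have mphi k : measurable_fun setT (phi k).
  by apply/measurable_EFinP; apply: measurable_funM => //; exact: measurable_indic.
have phi0 k x : (0 <= phi k x)%E by rewrite lee_fin mulr_ge0// powR_ge0.
apply: (@le_lt_trans _ _ ((2 `^ r2 * C') / (1 - th))%:E); last exact: ltry.
apply: (@integral_le_geometric _ _ _ mu _ _ phi) => //.
- by move=> k; exact: measurable_funTS.
- move=> x /= /ltW x1; have [k /andP[k1 k2]] := dyadic_bracket x1.
  exists k; rewrite lee_fin indicE mem_set/=; last by split => //=; exact: ltW.
  rewrite mulr1 ge0_ler_powR ?nnegrE ?exprn_ge0//; exact: ltW.
- by rewrite th0.
- by rewrite mulr_ge0// powR_ge0.
move=> k; apply: (@le_trans _ _ (\int[mu]_x phi k x)%E).
  exact: ge0_subset_integral.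
have -> : phi k = (fun x => ((2 ^+ k.+1) `^ r2)%:E * (\1_(B k) x)%:E)%E.
  by apply/funext => x; rewrite -EFinM.
rewrite ge0_integralZl_EFin ?powR_ge0//; last first.
  by apply/measurable_EFinP; exact: measurable_indic.
rewrite integral_indic// setIT.
apply: le_trans (lee_wpmul2l _ (Bk k)) _; first by rewrite lee_fin powR_ge0.
rewrite -EFinM lee_fin -expr_powR// gt0_powRD ?exprn_gt0// exprS powRM ?exprn_ge0//.
by rewrite le_eqVlt; apply/orP; left; apply/eqP; ring.
Qed.

End large_jumps.

Section supou_large_jumps.
Context {R : realType} {d : measure_display} {T : measurableType d}.
Local Notation leb := (@lebesgue_measure R).
Variables (P : probability T R) (Y : R -> T -> R) (a : R).
Variables (mu : {measure set R -> \bar R}) (pi : probability R R).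
Hypothesis HY : supOU P Y a 0 mu pi.

Lemma measurable_psi_ou_kernel z : measurable_fun setT (fun s : R => psi mu (z * ou_kernel s)).
Proof.
have m0 : measurable_fun setT (fun s : R => (0 : R, s)) by exact: measurable_pair1.
exact: (measurableT_comp (measurable_psi_kernel HY z 0) m0).
Qed.

(** With [I] the exponent at [z], the moment of [Y 1] gives [1 - exp (- I) <= 2 M z^r]. For small
    [z] the right side is at most 1/2, so [exp (- I) >= 1/2] and
    [I / 2 <= I exp (- I) <= 1 - exp (- I)], that is [I <= 4 M z^r]. *)
Lemma supOU_large_moment r r2 : 0 < r2 < r -> r <= 2 ->
  (\int[P]_w (`|Y 1 w| `^ r)%:E < +oo)%E ->
  (\int[mu]_(x in [set x | (1 < `|x|)%R]) (`|x| `^ r2)%:E < +oo)%E.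
Proof.
move=> /andP[r20 r2r] r2' HM.
have r0 : 0 < r by exact: lt_trans r2r.
have M0 : (0 <= \int[P]_w (`|Y 1 w| `^ r)%:E)%E by apply: integral_ge0.
set M := fine (\int[P]_w (`|Y 1 w| `^ r)%:E)%E.
have M0' : 0 <= M by exact: fine_ge0.
have HM' : (\int[P]_w (`|Y 1 w| `^ r)%:E <= M%:E)%E by rewrite fineK// ge0_fin_numE.
(* Ensures [4 M z^r <= 1] for [z <= z0]; the added 1 keeps the base positive when [M = 0]. *)
pose z0 := (4 * M + 1) `^ (- r^-1).
have z00 : 0 < z0 by rewrite powR_gt0// ltr_wpDl// mulr_ge0.
apply: (@levy_large_moment _ mu (supOU_levy HY) (4 * M) r r2 z0) => //.
- by rewrite mulr_ge0.
- move=> z /andP[zp zz0].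
  have [I -> hI] := supOU_cos_le_ou_kernel HY z; rewrite lee_fin.
  have := @integral_onem_cos_le_moment _ _ _ P (Y 1) z r M (supOU_measurable HY 1).
  rewrite (ltW r0) r2' => /(_ isT HM'); rewrite gtr0_norm// => h.
  have z1 : 4 * M * z `^ r <= 1.
    apply: (@le_trans _ _ ((4 * M + 1) * z0 `^ r)).
      apply: ler_pM; rewrite ?mulr_ge0 ?powR_ge0 ?lerDl//.
      by rewrite ge0_ler_powR ?nnegrE ?(ltW r0) ?(ltW z00) ?(ltW zp).
    rewrite -powRrM mulNr mulVf ?gt_eqF// powR_inv1 ?addr_ge0 ?mulr_ge0//.
    by rewrite mulfV// gt_eqF// ltr_wpDl// mulr_ge0.
  have e1 : expR (- I) * (1 + I) <= 1.
    have : 1 + I <= expR I := expR_ge1Dx I.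
    by rewrite expRN mulrC ler_pdivrMr ?expR_gt0// mul1r.
  have [I0|I0] := leP I 0; first by rewrite (le_trans I0)// mulr_ge0 ?powR_ge0 ?mulr_ge0.
  have : 2^-1 <= expR (- I) by lra.
  move=> h2; have : 2^-1 * I <= expR (- I) * I by rewrite ler_wpM2r// ltW.
  lra.
- exact: measurable_psi_ou_kernel.
- by rewrite r20.
Qed.

End supou_large_jumps.

(** * Mean and L1 continuity of the process *)

(** For [|x| >= 1] the error is at most [2 |x| <= 2 |x|^q] as [q >= 1]; for [|x| < 1] the mean value
    theorem gives [2 x^2 <= 2 |x|^q] as [q <= 2]. *)
Lemma sin_linear_error (R : realType) (x q : R) : 1 <= q <= 2 -> `|sin x - x| <= 2 * `|x| `^ q.
Proof.
move=> /andP[q1 q2]; have [x1|x1] := leP 1 `|x|.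
  have h1 : `|sin x| <= `|x| by have := sin_lipschitz x 0; rewrite sin0 !subr0.
  have h2 : `|x| <= `|x| `^ q by rewrite -[leLHS]powRr1// ler_powR.
  have := ler_normB (sin x) x; lra.
wlog x0 : x x1 / 0 < x => [H|].
  have [/(H x x1)//|xn|<-] := ltgtP 0 x; last first.
    by rewrite sin0 subrr normr0 mulr_ge0// powR_ge0.
  have := H (- x); rewrite normrN oppr_gt0 sinN => /(_ x1 xn).
  by rewrite -opprD normrN.
have [c] : exists2 c, c \in `]0, x[%R & sin x - sin 0 = cos c * (x - 0).
  apply: MVT => //; last exact/continuous_subspaceT/continuous_sin.
rewrite in_itv/= sin0 !subr0 => /andP[c0 cx] ->.
rewrite (_ : cos c * x - x = - ((1 - cos c) * x)); last by ring.
have hc : 1 - cos c <= 2 * c.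
  have := @onem_cos_le R c 1; rewrite ler01 ler1n => /(_ isT).
  by rewrite powRr1// gtr0_norm.
rewrite normrN ger0_norm; last by rewrite mulr_ge0 ?onem_cos_ge0 ?(ltW x0).
have : `|x| ^+ 2 <= `|x| `^ q.
  by rewrite -powR_mulrn// ger_powR// normr_gt0 gt_eqF//= ltW.
rewrite (gtr0_norm x0) => /(ler_wpM2l (ler0n R 2)); apply: le_trans.
rewrite expr2 mulrA ler_wpM2r ?(ltW x0)//; lra.
Qed.

Section mean_sin.
Context {d : measure_display} {T : measurableType d} {R : realType}.
Variable P : probability T R.

Lemma mean_sin_error (X : T -> R) (z q M : R) : measurable_fun setT X ->
  P.-integrable setT (EFin \o X) ->
  1 <= q <= 2 -> (\int[P]_w (`|X w| `^ q)%:E <= M%:E)%E ->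
  `|\int[P]_w sin (z * X w) - z * \int[P]_w X w| <= 2 * `|z| `^ q * M.
Proof.
move=> mX iX q12 HM.
have iS := integrable_sinM P z mX; have iZ := integrable_EFinM z iX.
rewrite -RintegralZl// -RintegralB//; apply: (le_trans (le_normr_Rintegral measurableT (integrable_EFinB iS iZ))).
have iB := integrable_norm (integrable_EFinB iS iZ).
rewrite -lee_fin EFin_Rintegral; last exact: iB.
have z0 : 0 <= 2 * `|z| `^ q by rewrite mulr_ge0// powR_ge0.
apply: (@le_trans _ _ (\int[P]_w ((2 * `|z| `^ q)%:E * (`|X w| `^ q)%:E))%E).
  apply: ge0_le_integral => //.
  - exact: (measurable_int _ iB).
  - by apply: measurable_funeM; exact: measurable_normr_powR.
  move=> w _; rewrite -EFinM lee_fin -mulrA -powRM// -normrM; exact: sin_linear_error.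
rewrite ge0_integralZl_EFin//; last exact: measurable_normr_powR.
by rewrite (EFinM _ M); apply: lee_wpmul2l.
Qed.

Lemma integrable_normr_lty (X : T -> R) : measurable_fun setT X ->
  (\int[P]_w (`|X w|)%:E < +oo)%E -> P.-integrable setT (EFin \o X).
Proof.
move=> mX h; apply/integrableP; split; first exact/measurable_EFinP.
by under eq_integral do rewrite /= -/(EFin _).
Qed.

End mean_sin.

Section supou_mean.
Context {R : realType} {d : measure_display} {T : measurableType d}.
Local Notation leb := (@lebesgue_measure R).
Variables (P : probability T R) (Y : R -> T -> R) (a : R).
Variables (mu : {measure set R -> \bar R}) (pi : probability R R).
Hypothesis HY : supOU P Y a 0 mu pi.
Hypothesis pi_pos : pi `]-oo, 0]%classic = 0%E.
Local Notation Q := (pi \x leb)%E.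
Variables (r : R).
Hypothesis r12 : 1 < r <= 2.
Hypothesis Y1r : (\int[P]_w (`|Y 1%R w| `^ r)%:E < +oo)%E.
Hypothesis EY1 : \int[P]_w Y 1 w = 0.

Let mY t : measurable_fun setT (Y t). Proof. exact: (supOU_measurable HY). Qed.

(** Stationarity is known only through characteristic functions, so the moment of [Y 1] is converted
    into a bound on [1 - cos] and back at time [t], at the price of [q < r]. *)
Lemma supOU_moment q : 0 < q < r -> exists M : R, forall t, (\int[P]_w (`|Y t w| `^ q)%:E <= M%:E)%E.
Proof.
move=> /andP[q1 qr]; have /andP[r1 r2] := r12.
have M0 : (0 <= \int[P]_w (`|Y 1 w| `^ r)%:E)%E by apply: integral_ge0.
set M := fine (\int[P]_w (`|Y 1 w| `^ r)%:E)%E.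
have M0' : 0 <= M by exact: fine_ge0.
have HM' : (\int[P]_w (`|Y 1 w| `^ r)%:E <= M%:E)%E by rewrite fineK// ge0_fin_numE.
exists (1 `^ (- q) + cosK q r * (2 * M) * 1 `^ (r - q)) => t.
apply: moment_le_onem_cos => //; rewrite ?q1 ?mulr_ge0//.
  by have -> : (P : {measure set T -> \bar R}) setT = 1%E by exact: probability_setT.
move=> z /andP[z0 _]; rewrite integral_onem_cos//; have [-> _] := supOU_stationary HY z t.
rewrite lee_fin mulrAC -{2}(gtr0_norm z0); apply: integral_onem_cos_le_moment => //.
by rewrite r2 andbT (le_trans ler01)// ltW.
Qed.

Lemma supOU_integrable t : P.-integrable setT (EFin \o Y t).
Proof.
have /andP[r1 r2] := r12.
have [|M HM] := @supOU_moment 1; first by rewrite ltr01.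
apply: integrable_normr_lty => //; apply: le_lt_trans (ltry M).
by have := HM t; under eq_integral do rewrite powRr1//.
Qed.

(** [E sin (z Y t)] does not depend on [t] and equals [z E (Y t)] up to [O(z^q)] with [q > 1].
    Comparing with time 1, where the mean is 0, and dividing by [z] leaves [O(z^(q-1))], which is
    made small. *)
Lemma supOU_mean0 t : \int[P]_w Y t w = 0.
Proof.
have /andP[r1 r2] := r12; pose q := (1 + r) / 2.
have q1 : 1 < q by rewrite /q; lra.
have qr : q < r by rewrite /q; lra.
have [|M HM] := @supOU_moment q; first by rewrite qr andbT (lt_trans ltr01).
have q12 : 1 <= q <= 2 by rewrite (ltW q1)/= (le_trans _ r2)// ltW.
set m := \int[P]_w Y t w.
have main z : 0 < z -> `|m| <= 4 * M * z `^ (q - 1).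
  move=> z0; have [_ e] := supOU_stationary HY z t.
  have h1 := mean_sin_error z (mY t) (supOU_integrable t) q12 (HM t).
  have h2 := mean_sin_error z (mY 1) (supOU_integrable 1) q12 (HM 1).
  move: h1 h2; rewrite e EY1 mulr0 subr0 -/m (gtr0_norm z0) => h1 h2.
  rewrite -(ler_pM2l z0).
  have -> : z * (4 * M * z `^ (q - 1)) = 4 * z `^ q * M.
    rewrite -[in RHS](subrKC 1 q) (gt0_powRD 1 (q - 1) z0) powRr1 ?(ltW z0)//; ring.
  rewrite -{1}(gtr0_norm z0) -normrM.
  set S := \int[P]_w _ in h1 h2.
  have -> : z * m = S - (S - z * m) by ring.
  by apply: le_trans (ler_normB _ _) _; lra.
apply/eqP; rewrite -normr_eq0 eq_le normr_ge0 andbT; apply/ler_addgt0Pl => e e0; rewrite addr0.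
have M0 : 0 <= 4 * M.
  by have := main 1 ltr01; rewrite powR1 mulr1; apply: le_trans.
have q10 : 0 < q - 1 by rewrite subr_gt0.
pose z := (e / (4 * M + 1)) `^ (q - 1)^-1.
have d0 : 0 < e / (4 * M + 1) by rewrite divr_gt0// ltr_wpDl.
have z0 : 0 < z by rewrite powR_gt0.
apply: le_trans (main z z0) _.
rewrite /z -powRrM mulVf ?gt_eqF// powRr1 ?(ltW d0)// mulrA ler_pdivrMr; last by rewrite ltr_wpDl.
by rewrite mulrDr mulr1 mulrC lerDl ltW.
Qed.

Variables (K r1 r2 : R).
Hypothesis K_ge0 : 0 <= K.
Hypothesis r21 : 1 < r2 <= r1.
Hypothesis Hpsi : forall z, (psi mu z <= (K * (`|z| `^ r1 + `|z| `^ r2))%:E)%E.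

Lemma increment_kernel_norm_le1 u v (x : R * R) : `|supou_kernel u x - supou_kernel v x| <= 1.
Proof.
have := supou_kernel_ge0 u x; have := supou_kernel_ge0 v x.
have := supou_kernel_le1 u x; have := supou_kernel_le1 v x.
by move=> *; rewrite ler_norml; apply/andP; split; lra.
Qed.

(** The kernel increment [D] satisfies [|D| <= 1], so [|D|^r1] and [|D|^r2] are both at most [|D|],
    and the L1 distance of the kernels controls the exponent. *)
Lemma increment_psi_le u v z z0 delta : 0 < z <= z0 ->
  (\int[Q]_x `|supou_kernel u x - supou_kernel v x|%:E <= delta%:E)%E ->
  (\int[Q]_x psi mu (z * (supou_kernel u x - supou_kernel v x))%R <=
   (K * (z0 `^ (r1 - r2) + 1) * z `^ r2 * delta)%:E)%E.
Proof.
move=> /andP[zp zz0] hd; have /andP[r2' r12'] := r21.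
have c0 : 0 <= K * (z0 `^ (r1 - r2) + 1) * z `^ r2.
  by rewrite !mulr_ge0 ?addr_ge0 ?powR_ge0.
have md : measurable_fun setT (fun x : R * R => `|supou_kernel u x - supou_kernel v x|%:E).
  apply/measurable_EFinP; apply: measurableT_comp => //.
  by apply: measurable_funB; exact: measurable_supou_kernel.
apply: (@le_trans _ _ (\int[Q]_x ((K * (z0 `^ (r1 - r2) + 1) * z `^ r2)%:E *
    `|supou_kernel u x - supou_kernel v x|%:E))%E).
  apply: ge0_le_integral => //.
  - by move=> x _; exact: psi_ge0.
  - exact: (measurable_psi_increment HY).
  - exact: measurable_funeM.
  move=> x _; apply: le_trans (Hpsi _) _; rewrite -EFinM lee_fin -!mulrA ler_wpM2l//.
  have h1 := increment_kernel_norm_le1 u v x.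
  set D := supou_kernel u x - supou_kernel v x in h1 *.
  have hD s : 1 <= s -> `|D| `^ s <= `|D|.
    move=> s1; have [->|D0] := eqVneq D 0; first by rewrite normr0 powR0// gt_eqF// (lt_le_trans ltr01).
    by rewrite -[leRHS]powRr1// ger_powR// normr_gt0 D0.
  rewrite normrM (gtr0_norm zp) !powRM ?(ltW zp)// mulrDl mul1r.
  apply: lerD; last by rewrite ler_wpM2l ?powR_ge0// hD// ltW.
  rewrite mulrA; apply: ler_pM; rewrite ?powR_ge0//; last by rewrite hD// (le_trans _ r12')// ltW.
  have -> : r1 = (r1 - r2) + r2 by ring.
  rewrite (gt0_powRD _ _ zp) (_ : r1 - r2 + r2 - r2 = r1 - r2); last by ring.
  rewrite ler_wpM2r ?powR_ge0// ge0_ler_powR ?nnegrE ?subr_ge0 ?(ltW zp)//.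
  exact: le_trans (ltW zp) _.
rewrite ge0_integralZl_EFin//.
by rewrite (EFinM _ delta); apply: lee_wpmul2l.
Qed.

Lemma supOU_L1_continuous eta : 0 < eta -> exists2 h0 : R, 0 < h0 &
  forall u v, `|v - u| <= h0 -> (\int[P]_w `|Y u w - Y v w|%:E <= eta%:E)%E.
Proof.
move=> eta0; have /andP[r2' r12'] := r21.
(* Makes the term [z0^(-1)] of [moment_le_char] equal to [eta / 2]; [delta] then brings the other
   term below [eta / 2]. *)
pose z0 : R := 2 / eta; have z00 : 0 < z0 by rewrite divr_gt0.
pose c := cosK 1 r2 * (2 * (K * (z0 `^ (r1 - r2) + 1))) * z0 `^ (r2 - 1).
have cK : 0 <= cosK 1 r2.
  rewrite /cosK invr_ge0 mulr_ge0 ?onem_cos_ge0// subr_ge0 ltW//.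
  by have /andP[] := powR2_lt1 r2'.
have A0 : 0 <= 2 * (K * (z0 `^ (r1 - r2) + 1)) by rewrite !mulr_ge0 ?addr_ge0 ?powR_ge0.
have c0 : 0 <= c by rewrite !mulr_ge0 ?powR_ge0 ?addr_ge0 ?powR_ge0.
pose delta := eta / 2 / (c + 1).
have d0 : 0 < delta by rewrite !divr_gt0// ltr_wpDl.
have [h0 h00 Hh] := supou_kernel_modulus pi_pos d0.
exists h0 => // u v uv.
have iB : P.-integrable setT (EFin \o (fun w => Y u w - Y v w)).
  by apply: integrable_EFinB; exact: supOU_integrable.
have := @moment_le_char _ _ _ P (fun w => Y u w - Y v w)
  (2 * (K * (z0 `^ (r1 - r2) + 1)) * delta) z0 1 r2 iB.
rewrite RintegralB//; [|exact: supOU_integrable..].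
rewrite !supOU_mean0 subrr lexx r2' => /(_ erefl isT z00).
have D0 : 0 <= 2 * (K * (z0 `^ (r1 - r2) + 1)) * delta by rewrite mulr_ge0// ltW.
move=> /(_ D0); under eq_integral do rewrite powRr1//.
move=> H; apply: (le_trans (H _)).
  move=> z zz; apply: le_trans (increment_char_sq HY (increment_psi_le zz (Hh _ _ uv))) _.
  by rewrite le_eqVlt; apply/orP; left; apply/eqP; ring.
rewrite lee_fin powRN powRr1 ?(ltW z00)// /z0 invf_div -/z0.
have -> : cosK 1 r2 * (2 * (K * (z0 `^ (r1 - r2) + 1)) * delta) * z0 `^ (r2 - 1) = c * delta.
  by rewrite /c; ring.
have : c * delta <= eta / 2.
  rewrite /delta mulrA ler_pdivrMr; last by rewrite ltr_wpDl.
  by rewrite mulrC ler_wpM2l ?lerDl// divr_ge0// ltW.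
lra.
Qed.

End supou_mean.

(** * The integrated process *)

Section char_distance.
Context {d : measure_display} {T : measurableType d} {R : realType}.
Variable P : probability T R.

Lemma char_lipschitz (f : R -> R) (X X' : T -> R) (z eta : R) :
  measurable_fun setT f -> (forall x, `|f x| <= 1) ->
  (forall x y, `|f x - f y| <= `|x - y|) ->
  measurable_fun setT X -> measurable_fun setT X' ->
  (\int[P]_w `|X w - X' w|%:E <= eta%:E)%E ->
  `|\int[P]_w f (z * X w) - \int[P]_w f (z * X' w)| <= `|z| * eta.
Proof.
move=> mf f1 fl mX mX' H.
have iF (X0 : T -> R) : measurable_fun setT X0 ->
    P.-integrable setT (EFin \o (fun w => f (z * X0 w))).
  move=> mX0; apply: (@bounded_integrable _ _ _ _ _ 1) => //.
  by apply: measurableT_comp => //; exact: measurable_funM.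
have iB := integrable_EFinB (iF _ mX) (iF _ mX').
rewrite -RintegralB//; [|exact: iF..].
apply: (le_trans (le_normr_Rintegral measurableT iB)).
have iN := integrable_norm iB.
rewrite -lee_fin EFin_Rintegral; last exact: iN.
have mB : measurable_fun setT (fun w => `|X w - X' w|%:E).
  by apply/measurable_EFinP; apply: measurableT_comp => //; exact: measurable_funB.
apply: (@le_trans _ _ (\int[P]_w (`|z|%:E * `|X w - X' w|%:E))%E).
  apply: ge0_le_integral => //.
  - exact: (measurable_int _ iN).
  - exact: measurable_funeM.
  by move=> w _; rewrite -EFinM lee_fin -normrM mulrBr.
rewrite ge0_integralZl_EFin//.
by rewrite (EFinM _ eta); apply: lee_wpmul2l.
Qed.

End char_distance.

Section integrated_process.
Context {R : realType} {d : measure_display} {T : measurableType d}.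
Local Notation leb := (@lebesgue_measure R).
Variables (P : probability T R) (Y : R -> T -> R).
Hypothesis mY2 : measurable_fun setT (fun z : R * T => Y z.1 z.2).
Hypothesis locY : forall t, 0 <= t ->
  {ae P, forall w, leb.-integrable `[0, t]%classic (EFin \o (Y ^~ w))}.

Let mY t : measurable_fun setT (Y t).
Proof.
have m0 : measurable_fun setT (fun w : T => (t, w)) by exact: measurable_pair1.
exact: (measurableT_comp mY2 m0).
Qed.

Lemma measurable_ge0_integral_param (f : R * T -> \bar R) :
  measurable_fun setT f -> (forall x, (0 <= f x)%E) ->
  measurable_fun setT (fun w => \int[leb]_s f (s, w))%E.
Proof. by move=> mf f0; exact: measurable_fun_fubini_tonelli_G. Qed.

(** Parametrised integrals of nonnegative functions are measurable, and the integral is by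
    definition the difference of those of the two parts; the identity holds for every path,
    integrable or not. *)
Lemma measurable_integrated t : measurable_fun setT (integrated Y t).
Proof.
pose D := `[0, t]%classic : set R.
have mD : measurable D by exact: measurable_itv.
pose g (z : R * T) : \bar R := (Y z.1 z.2 * \1_D z.1)%:E.
have mg : measurable_fun setT g.
  apply/measurable_EFinP; apply: measurable_funM => //.
  by apply: (measurableT_comp (@measurable_indic _ _ R setT _ mD)); exact: measurable_fst.
have e w : (\int[leb]_(s in D) (Y s w)%:E =
    \int[leb]_s (g^\+ (s, w)) - \int[leb]_s (g^\- (s, w)))%E.
  rewrite integral_mkcond integralE; congr (_ - _)%E; apply: eq_integral => s _.
    rewrite !funeposE patchE /g/= indicE; case: ifPn => sD.
      by rewrite mulr1.
    by rewrite mulr0.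
  rewrite !funenegE patchE /g/= indicE; case: ifPn => sD.
    by rewrite mulr1.
  by rewrite mulr0.
rewrite (_ : integrated Y t = fine \o (fun w => \int[leb]_s (g^\+ (s, w)) - \int[leb]_s (g^\- (s, w)))%E).
  apply: measurableT_comp => //; apply: emeasurable_funB.
    by apply: measurable_ge0_integral_param => //; exact: measurable_funepos.
  by apply: measurable_ge0_integral_param => //; exact: measurable_funeneg.
by apply/funext => w /=; rewrite -e.
Qed.

Let I (h : R) (j : nat) : set R := `]j%:R * h, j.+1%:R * h]%classic.

(** Error of the left-endpoint rule on cell [j] along a path. With the absolute value inside,
    Tonelli's theorem reduces its mean to [E |Y s - Y (j h)|]. *)
Let D (h : R) (j : nat) (w : T) : \bar R :=
  (\int[leb]_s (`|Y s w - Y (j%:R * h)%R w| * \1_(I h j) s)%:E)%E.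

Let f (h : R) (j : nat) (z : R * T) : \bar R :=
  (`|Y z.1 z.2 - Y (j%:R * h) z.2| * \1_(I h j) z.1)%:E.

Let mI h j : measurable (I h j). Proof. exact: measurable_itv. Qed.

Let lI h j : 0 <= h -> leb (I h j) = h%:E.
Proof.
move=> h0; rewrite lebesgue_measure_itv/= lte_fin.
have [h1|h1] := ltP (j%:R * h) (j.+1%:R * h).
  by rewrite -EFinB -natr1 mulrDl mul1r addrAC subrr add0r.
have -> : h = 0; last by [].
by apply/le_anti; rewrite h0 andbT; move: h1; rewrite -natr1 mulrDl mul1r gerDl.
Qed.

Let mf h j : measurable_fun setT (f h j).
Proof.
apply/measurable_EFinP; apply: measurable_funM; last first.
  by apply: (measurableT_comp (@measurable_indic _ _ R setT _ (mI h j))); exact: measurable_fst.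
apply: measurableT_comp => //; apply: measurable_funB => //.
by apply: (measurableT_comp (mY (j%:R * h))); exact: measurable_snd.
Qed.

Let f0 h j x : (0 <= f h j x)%E. Proof. by rewrite lee_fin mulr_ge0. Qed.

Let mD h j : measurable_fun setT (D h j).
Proof. exact: (measurable_ge0_integral_param (mf h j) (f0 h j)). Qed.

Let mi h j : @measurable_fun _ _ (measurableTypeR R) _ setT (fun s : R => (\1_(I h j) s)%:E : \bar R).
Proof. by apply/measurable_EFinP; exact: (@measurable_indic _ _ R setT _ (mI h j)). Qed.

Let D_le h j eta : 0 <= h -> 0 <= eta ->
  (forall u v, `|v - u| <= h -> (\int[P]_w `|Y u w - Y v w|%:E <= eta%:E)%E) ->
  (\int[P]_w D h j w <= (h * eta)%:E)%E.
Proof.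
move=> h0 eta0 H.
rewrite -(@fubini_tonelli _ _ _ _ _ leb P (f h j) (mf h j) (f0 h j)).
apply: (@le_trans _ _ (\int[leb]_s (eta%:E * (\1_(I h j) s)%:E))%E); last first.
  rewrite (ge0_integralZl_EFin leb measurableT _ (mi h j) eta0)//.
  have -> : (\int[leb]_s (\1_(I h j) s)%:E = h%:E)%E.
    rewrite -(lI j h0) -[in RHS](setIT (I h j)).
    exact: (integral_indic leb measurableT (mI h j)).
  by rewrite -EFinM mulrC.
apply: ge0_le_integral => //.
- by move=> s _; apply: integral_ge0.
- exact: (@measurable_fun_fubini_tonelli_F _ _ _ _ _ P (f h j) (mf h j) (f0 h j)).
- by apply: measurable_funeM; exact: mi.
move=> s _; rewrite /f/= indicE; have [sI|sI] := boolP (s \in I h j); last first.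
  by rewrite mule0 integral0_eq// => w _; rewrite mulr0.
rewrite mule1; under eq_integral do rewrite mulr1.
apply: H; move: sI; rewrite inE /I /= in_itv/= => /andP[s1 s2].
rewrite distrC ger0_norm ?subr_ge0 ?(ltW s1)// lerBlDl.
by move: s2; rewrite -natr1 mulrDl mul1r.
Qed.

(** Induction on the number of cells: [[0, (n+1) h]] is [[0, n h]] plus a half-open cell, on which
    the constant [Y (n h)] integrates to [h Y (n h)]. *)
Let riemann_error h n w : 0 < h ->
  leb.-integrable `[0, n%:R * h]%classic (EFin \o (Y ^~ w)) ->
  (`|integrated Y (n%:R * h) w - riemann_sum Y h n w|%:E <= \sum_(j < n) D h j w)%E.
Proof.
move=> h0; elim: n => [|n IH] iY.
  rewrite big_ord0 /integrated /riemann_sum big_ord0 mulr0 mul0r subr0.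
  by rewrite set_itv1 Rintegral_set1 normr0.
have nh : n%:R * h <= n.+1%:R * h by rewrite ler_wpM2r ?(ltW h0)// ler_nat.
have n0 : 0 <= n%:R * h by rewrite mulr_ge0// ltW.
have sU : `[0, n.+1%:R * h]%classic = `[0, n%:R * h]%classic `|` I h n.
  by rewrite -itv_bndbnd_setU// bnd_simp.
have mU : measurable (`[0, n.+1%:R * h]%classic : set R) by exact: measurable_itv.
have mA : measurable (`[0, n%:R * h]%classic : set R) by exact: measurable_itv.
have iA : leb.-integrable `[0, n%:R * h]%classic (EFin \o (Y ^~ w)).
  by apply: (@integrableS _ _ _ leb _ _ _ mU mA _ iY); rewrite sU; exact: subsetUl.
have iB : leb.-integrable (I h n) (EFin \o (Y ^~ w)).
  by apply: (@integrableS _ _ _ leb _ (I h n) _ mU (mI h n) _ iY); rewrite sU; exact: subsetUr.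
have ic : leb.-integrable (I h n) (EFin \o cst (Y (n%:R * h) w)).
  apply: measurable_bounded_integrable => //.
  - exact: (mI h n).
  - by apply: (@le_lt_trans _ _ h%:E); [rewrite -(lI n (ltW h0))|exact: ltry].
  exists `|Y (n%:R * h) w|; split; first exact: num_real.
  by move=> y My x _ /=; exact: ltW.
have -> : integrated Y (n.+1%:R * h) w =
    integrated Y (n%:R * h) w + \int[leb]_(s in I h n) Y s w.
  have iU : leb.-integrable (`[0, n%:R * h]%classic `|` I h n) (EFin \o (Y ^~ w)) by rewrite -sU.
  have dj : [disjoint `[0, n%:R * h]%classic & I h n].
    apply/disj_setPS => x [] /=; rewrite !in_itv/= => /andP[_ x1] /andP[x2 _].
    by have := lt_le_trans x2 x1; rewrite ltxx.
  have e := @Rintegral_setU _ _ R leb `[0, n%:R * h]%classic (I h n) (Y ^~ w) mA (mI h n) iU dj.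
  by rewrite /integrated sU; exact: e.
have -> : riemann_sum Y h n.+1 w =
    riemann_sum Y h n w + \int[leb]_(s in I h n) Y (n%:R * h) w.
  rewrite /riemann_sum big_ord_recr/= mulrDr (Rintegral_cst leb (mI h n : measurable (_ : set (measurableTypeR R)))).
  by rewrite [X in _ = _ + _ * fine X](lI n (ltW h0))/= [Y _ w * h]mulrC.
rewrite opprD addrACA -(RintegralB (mI h n : measurable (_ : set (measurableTypeR R))))//.
rewrite big_ord_recr/=; apply: (@le_trans _ _
  (`|integrated Y (n%:R * h) w - riemann_sum Y h n w|%:E +
   `|\int[leb]_(s in I h n) (Y s w - Y (n%:R * h) w)|%:E)%E).
  by rewrite -EFinD lee_fin ler_normD.
apply: leeD; first exact: IH.
have iD : leb.-integrable (I h n) (EFin \o (fun s => Y s w - Y (n%:R * h) w)).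
  have e := integrableB (mI h n : measurable (_ : set (measurableTypeR R))) iB ic.
  exact: e.
apply: (@le_trans _ _ (\int[leb]_(s in I h n) `|Y s w - Y (n%:R * h)%R w|%:E)%E).
  have -> : (`|\int[leb]_(s in I h n) (Y s w - Y (n%:R * h) w)|%:E =
      `|\int[leb]_(s in I h n) (Y s w - Y (n%:R * h) w)%:E|)%E.
    by rewrite -[in RHS](fineK (integrable_fin_num (mI h n : measurable (_ : set (measurableTypeR R))) iD)).
  apply: le_trans (le_abse_integral _ _ _) _ => //.
    exact: (mI h n).
  by case/integrableP : iD.
rewrite integral_mkcond le_eqVlt; apply/orP; left; apply/eqP; apply: eq_integral => s _.
rewrite patchE indicE; case: ifPn => sI; first by rewrite mulr1.
by rewrite mulr0.
Qed.

Hypothesis contY : forall eta, 0 < eta -> exists2 h0 : R, 0 < h0 &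
  forall u v, `|v - u| <= h0 -> (\int[P]_w `|Y u w - Y v w|%:E <= eta%:E)%E.

Lemma integrated_riemann_approx t eta : 0 < t -> 0 < eta ->
  exists n : nat, exists2 h : R, 0 < h <= 1 /\ n%:R * h = t &
  (\int[P]_w `|integrated Y t w - riemann_sum Y h n w|%:E <= eta%:E)%E.
Proof.
move=> t0 eta0; have et0 : 0 < eta / t by rewrite divr_gt0.
have [h0 h00 H] := contY et0.
(* The mesh stays below [h0] for L1 continuity and below 1 for the kernel bounds. With tolerance
   [eta / t], the [n] cells of length [t / n] contribute [eta] in total. *)
pose m := Num.min h0 1; have m0 : 0 < m by rewrite lt_min h00/=.
pose n := (Num.truncn (t / m)).+1.
have n0 : 0 < n%:R :> R by rewrite ltr0n.
have hm : t / n%:R <= m.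
  rewrite ler_pdivrMr// mulrC -ler_pdivrMr//.
  have tm : 0 <= t / m by rewrite divr_ge0// ltW.
  by have /andP[_ /ltW] := truncn_itv tm.
have h' : 0 < t / n%:R by rewrite divr_gt0.
have nh : n%:R * (t / n%:R) = t by rewrite mulrC divfK// gt_eqF.
exists n, (t / n%:R); first by rewrite h' (le_trans hm)// ge_min lexx orbT.
have Hh u v : `|v - u| <= t / n%:R -> (\int[P]_w `|Y u w - Y v w|%:E <= (eta / t)%:E)%E.
  by move=> uv; apply: H; rewrite (le_trans uv)// (le_trans hm)// ge_min lexx.
apply: (@le_trans _ _ (\int[P]_w \sum_(j < n) D (t / n%:R) j w)%E).
  apply: ae_ge0_le_integral => //.
  - apply/measurable_EFinP; apply: measurableT_comp => //; apply: measurable_funB.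
      exact: measurable_integrated.
    by apply: measurable_funM => //; exact: measurable_sum.
  - by move=> w _; apply: sume_ge0 => j _; apply: integral_ge0 => s _; exact: (f0 _ _ (s, w)).
  - by apply: emeasurable_sum => j; exact: mD.
  have := locY (ltW t0); apply: filterS => w iw _.
  by have := @riemann_error (t / n%:R) n w h'; rewrite nh => /(_ iw).
rewrite ge0_integral_sum//; last first.
  by move=> j w _; apply: integral_ge0 => s _; exact: (f0 _ _ (s, w)).
apply: (@le_trans _ _ (\sum_(j < n) (t / n%:R * (eta / t))%:E)%E).
  by apply: lee_sum => j _; apply: D_le => //; exact: ltW.
have e : t / n%:R * (eta / t) *+ n = eta.
  by rewrite -[LHS]mulr_natl mulrA nh mulrC divfK// gt_eqF.
by rewrite sumEFin sumr_const card_ord e.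
Qed.

Hypothesis iY : forall t, P.-integrable setT (EFin \o Y t).

Let mR h n : measurable_fun setT (riemann_sum Y h n).
Proof. by apply: measurable_funM => //; exact: measurable_sum. Qed.

Let iS h n : P.-integrable setT (EFin \o (fun w => \sum_(j < n) Y (j%:R * h) w)).
Proof.
elim: n => [|n IH].
  rewrite (_ : EFin \o _ = EFin \o cst (0 : R)); last first.
    by apply/funext => w /=; rewrite big_ord0.
  by apply: (@bounded_integrable _ _ _ _ _ 1) => // x; rewrite normr0.
rewrite (_ : EFin \o _ = EFin \o (fun w => \sum_(j < n) Y (j%:R * h) w + Y (n%:R * h) w)).
  exact: integrable_EFinD.
by apply/funext => w /=; rewrite big_ord_recr.
Qed.

Let iR h n : P.-integrable setT (EFin \o riemann_sum Y h n).
Proof. exact: integrable_EFinM. Qed.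

Let iXR t eta h n : (\int[P]_w `|integrated Y t w - riemann_sum Y h n w|%:E <= eta%:E)%E ->
  P.-integrable setT (EFin \o (fun w => integrated Y t w - riemann_sum Y h n w)).
Proof.
move=> H; apply: integrable_normr_lty; last exact: le_lt_trans (ltry eta).
apply: measurable_funB => //; exact: measurable_integrated.
Qed.

Lemma integrable_integrated t : 0 < t -> P.-integrable setT (EFin \o integrated Y t).
Proof.
move=> t0; have [n [h _ /iXR iB]] := integrated_riemann_approx t0 ltr01.
rewrite (_ : EFin \o _ =
  EFin \o (fun w => integrated Y t w - riemann_sum Y h n w + riemann_sum Y h n w)).
  exact: integrable_EFinD.
by apply/funext => w /=; rewrite subrK.
Qed.

Lemma integrated_mean0 t : 0 < t -> (forall s, \int[P]_w Y s w = 0) ->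
  \int[P]_w integrated Y t w = 0.
Proof.
move=> t0 Y0.
have R0 h n : \int[P]_w riemann_sum Y h n w = 0.
  rewrite RintegralZl// (_ : \int[P]_w _ = 0) ?mulr0//; elim: n => [|n IH].
    by rewrite -[RHS](Rintegral_cst_probability P 0); apply: eq_Rintegral => w _; rewrite big_ord0.
  transitivity (\int[P]_w (\sum_(j < n) Y (j%:R * h) w + Y (n%:R * h) w)).
    by apply: eq_Rintegral => w _; rewrite big_ord_recr.
  by rewrite RintegralD// IH Y0 addr0.
apply/eqP; rewrite -normr_eq0 eq_le normr_ge0 andbT; apply/ler_addgt0Pl => e e0; rewrite addr0.
have [n [h _ H]] := integrated_riemann_approx t0 e0.
have iB := iXR H.
have -> : \int[P]_w integrated Y t w = \int[P]_w (integrated Y t w - riemann_sum Y h n w).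
  by rewrite RintegralB//; [rewrite R0 subr0|exact: integrable_integrated].
apply: (le_trans (le_normr_Rintegral measurableT iB)).
rewrite -lee_fin EFin_Rintegral; last exact: (integrable_norm iB).
exact: H.
Qed.

Lemma integrated_char_approx t z eta : 0 < t -> 0 < eta -> exists n : nat, exists2 h : R,
  0 < h <= 1 /\ n%:R * h = t &
  `|\int[P]_w cos (z * integrated Y t w) - \int[P]_w cos (z * riemann_sum Y h n w)| <= eta /\
  `|\int[P]_w sin (z * integrated Y t w) - \int[P]_w sin (z * riemann_sum Y h n w)| <= eta.
Proof.
move=> t0 eta0.
have z1 : 0 < `|z| + 1 by rewrite ltr_wpDl.
have e0 : 0 < eta / (`|z| + 1) by rewrite divr_gt0.
have [n [h nh H]] := integrated_riemann_approx t0 e0.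
have ze : `|z| * (eta / (`|z| + 1)) <= eta.
  by rewrite mulrA ler_pdivrMr// mulrC ler_wpM2l ?(ltW eta0)// lerDl.
have mX := measurable_integrated t.
exists n, h => //; split; apply: le_trans ze; apply: char_lipschitz => //.
- exact: continuous_measurable_fun (@continuous_cos R).
- by move=> x; exact: cos_max.
- exact: cos_lipschitz.
- exact: continuous_measurable_fun (@continuous_sin R).
- by move=> x; exact: sin_max.
- exact: sin_lipschitz.
Qed.

(** Bounds uniform over all Riemann sums of mesh at most 1 on [[0, t]] pass to the integrated
    process. *)
Lemma integrated_cos_le t z b : 0 < t ->
  (forall (n : nat) h, 0 < h <= 1 -> n%:R * h = t ->
    \int[P]_w cos (z * riemann_sum Y h n w) <= b) ->
  \int[P]_w cos (z * integrated Y t w) <= b.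
Proof.
move=> t0 H; apply/ler_addgt0Pl => e e0.
have [n [h [h01 nh] [/ler_normlW h1 _]]] := integrated_char_approx z t0 e0.
by have := H n h h01 nh; lra.
Qed.

Lemma integrated_char_sq t z B : 0 < t ->
  (forall (n : nat) h, 0 < h <= 1 -> n%:R * h = t ->
    1 - (\int[P]_w cos (z * riemann_sum Y h n w)) ^+ 2 -
      (\int[P]_w sin (z * riemann_sum Y h n w)) ^+ 2 <= B) ->
  1 - (\int[P]_w cos (z * integrated Y t w)) ^+ 2 -
    (\int[P]_w sin (z * integrated Y t w)) ^+ 2 <= B.
Proof.
move=> t0 H; apply/ler_addgt0Pl => e e0.
(* Squares of two numbers in [[-1, 1]] at distance [e / 4] differ by at most [e / 2], and there are
   two squares. *)
have e4 : 0 < e / 4 by rewrite divr_gt0.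
have [n [h [h01 nh] [h1 h2]]] := integrated_char_approx z t0 e4.
have := H n h h01 nh.
have mX := measurable_integrated t.
have b1 (phi : R -> R) (X : T -> R) : measurable_fun setT phi -> (forall x, `|phi x| <= 1) ->
    measurable_fun setT X -> `|\int[P]_w phi (z * X w)| <= 1.
  move=> mphi phi1 mX0; have i0 : P.-integrable setT (EFin \o (fun w => phi (z * X w))).
    apply: (@bounded_integrable _ _ _ _ _ 1) => //.
    by apply: measurableT_comp => //; exact: measurable_funM.
  apply: (le_trans (le_normr_Rintegral measurableT i0)).
  rewrite -(Rintegral_cst_probability P 1); apply: le_Rintegral => //.
    exact: (integrable_norm i0).
  by apply: (@bounded_integrable _ _ _ _ _ 1) => // x; rewrite normr1.
have mc := continuous_measurable_fun (@continuous_cos R).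
have ms := continuous_measurable_fun (@continuous_sin R).
have := b1 _ _ mc (@cos_max R) mX; have := b1 _ _ mc (@cos_max R) (mR h n).
have := b1 _ _ ms (@sin_max R) mX; have := b1 _ _ ms (@sin_max R) (mR h n).
have sq (x y : R) : `|x| <= 1 -> `|y| <= 1 -> `|x - y| <= e / 4 -> y ^+ 2 - x ^+ 2 <= e / 2.
  move=> x1 y1 xy; rewrite subr_sqr -(mulr1 (e / 2)).
  have -> : e / 2 * 1 = (e / 4) * 2 by lra.
  apply: (le_trans (ler_norm _)); rewrite normrM; apply: ler_pM => //; first by rewrite distrC.
  by apply: (le_trans (ler_normD _ _)); lra.
move=> s1 s2 c1 c2 hB.
by have := sq _ _ c2 c1 h1; have := sq _ _ s2 s1 h2; lra.
Qed.

End integrated_process.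

(** * Moment and characteristic function bounds *)

Section moments_of_integral.
Context {R : realType} {d : measure_display} {T : measurableType d}.
Local Notation leb := (@lebesgue_measure R).
Variables (P : probability T R) (Y : R -> T -> R) (a : R).
Variables (mu : {measure set R -> \bar R}) (pi : probability R R).
Hypothesis HY : supOU P Y a 0 mu pi.
Hypothesis pi_pos : pi `]-oo, 0]%classic = 0%E.
Hypothesis mY2 : measurable_fun setT (fun z : R * T => Y z.1 z.2).
Hypothesis locY : forall t : R, 0 <= t ->
  {ae P, forall w, lebesgue_measure.-integrable `[0, t]%classic (EFin \o (Y ^~ w))}.
Local Notation Q := (pi \x leb)%E.
Variables (alpha q0 : R).
Hypothesis alpha_gt0 : 0 < alpha.
Hypothesis q0_ge : 1 + alpha <= q0.
Hypothesis q0_lt2 : q0 < 2.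
Hypothesis inverse_moment : forall e : R, 0 < e < alpha ->
  (\int[pi]_(x in [set x | (0 < x)%R]) (x^-1 `^ e)%:E < +oo)%E.
Hypothesis small_jumps : forall r : R, q0 < r ->
  (\int[mu]_(x in [set x | (`|x| <= 1)%R]) (`|x| `^ r)%:E < +oo)%E.
Hypothesis Y1_moment : forall r : R, 0 < r < q0 -> (\int[P]_w (`|Y 1%R w| `^ r)%:E < +oo)%E.
Hypothesis EY1 : \int[P]_w Y 1 w = 0.

Let X := integrated Y.

Lemma psi_power_bound (r1 r2 : R) : q0 < r1 <= 2 -> 0 < r2 < q0 ->
  exists2 K : R, 0 <= K & forall z : R, (psi mu z <= (K * (`|z| `^ r1 + `|z| `^ r2))%:E)%E.
Proof.
have A0' := alpha_gt0; have Q1 := q0_ge; have Q2 := q0_lt2.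
move=> /andP[r1q r12] /andP[r20 r2q].
(* An intermediate order: [Y 1] has this moment as it is below [q0], and [supOU_large_moment] then
   descends to [r2]. *)
have r2r : 0 < r2 < (r2 + q0) / 2 by apply/andP; split; lra.
have r0 : 0 < (r2 + q0) / 2 < q0 by apply/andP; split; lra.
have r2' : (r2 + q0) / 2 <= 2 by lra.
have r1b : 0 <= r1 <= 2 by apply/andP; split; lra.
have r2b : 0 <= r2 <= 2 by apply/andP; split; lra.
have h1 := small_jumps r1q.
have h2 := supOU_large_moment HY r2r r2' (Y1_moment r0).
have p1 : (0 <= \int[mu]_(x in [set x | (`|x| <= 1)%R]) (`|x| `^ r1)%:E)%E by apply: integral_ge0.
have p2 : (0 <= \int[mu]_(x in [set x | (1 < `|x|)%R]) (`|x| `^ r2)%:E)%E by apply: integral_ge0.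
set I1 := (X in (X < +oo)%E) in h1; set I2 := (X in (X < +oo)%E) in h2.
have H1 : (I1 <= (fine I1)%:E)%E by rewrite (fineK (_ : I1 \is a fin_num)) ?(ge0_fin_numE p1).
have H2 : (I2 <= (fine I2)%:E)%E by rewrite (fineK (_ : I2 \is a fin_num)) ?(ge0_fin_numE p2).
have f1 : 0 <= fine I1 by exact: fine_ge0.
have f2 : 0 <= fine I2 by exact: fine_ge0.
move: (fine I1) (fine I2) f1 f2 H1 H2 => m1 m2 f1 f2 H1 H2.
exists (2 * (m1 + m2)); first by rewrite mulr_ge0// addr_ge0.
move=> z; apply: le_trans (@psi_le _ mu r1 r2 _ _ z r1b r2b H1 H2) _.
rewrite lee_fin -subr_ge0; set A := `|z| `^ r1; set B := `|z| `^ r2.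
have -> : 2 * (m1 + m2) * (A + B) - (2 * m1 * A + 2 * m2 * B) = 2 * (m1 * B + m2 * A) by ring.
by rewrite mulr_ge0// addr_ge0// mulr_ge0 ?powR_ge0.
Qed.

(** Because [z <= 1] and [n h >= 1], both terms are dominated by the worse powers [z^r2] and
    [(n h)^(r1 - e)], whence the factor 2. *)
Lemma riemann_psi_le (r1 r2 e K J h z : R) (n : nat) : 0 <= K ->
  (forall z : R, (psi mu z <= (K * (`|z| `^ r1 + `|z| `^ r2))%:E)%E) ->
  (\int[pi]_(x in [set x | (0 < x)%R]) (x^-1 `^ e)%:E <= J%:E)%E -> 0 <= J ->
  0 < e -> 1 + e <= r2 -> r2 <= r1 -> 0 < h <= 1 -> 1 <= n%:R * h -> 0 < z <= 1 ->
  (\int[Q]_x psi mu (z * riemann_kernel h n x)%R <=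
    (2 * K * (2 `^ e * (1 + J)) * (n%:R * h) `^ (r1 - e) * z `^ r2)%:E)%E.
Proof.
move=> K0 HK HJ J0 e0 er2 r21 h01 t1 /andP[z0 z1]; have /andP[h0 h1] := h01.
set t := n%:R * h in t1 *.
have mr : measurable_fun setT (riemann_kernel h n) by exact: measurable_riemann_kernel.
have mp r : measurable_fun setT (fun x : R * R => (riemann_kernel h n x `^ r)%:E).
  by apply/measurable_EFinP; exact: (measurableT_comp (measurable_powR r)).
have mk (c r : R) :
    measurable_fun setT (fun x : R * R => c%:E * (riemann_kernel h n x `^ r)%:E)%E.
  by apply: measurable_funeM; exact: mp.
have er1 : 1 + e <= r1 by exact: le_trans r21.
have I1 := integral_riemann_kernel_powR pi_pos HJ e0 er1 h01 t1.
have I2 := integral_riemann_kernel_powR pi_pos HJ e0 er2 h01 t1.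
have zr r : 0 <= K * z `^ r by rewrite mulr_ge0 ?powR_ge0.
apply: (@le_trans _ _ (\int[Q]_x ((K * z `^ r1)%:E * (riemann_kernel h n x `^ r1)%:E +
    (K * z `^ r2)%:E * (riemann_kernel h n x `^ r2)%:E))%E).
  apply: ge0_le_integral => //.
  - by move=> x _; exact: psi_ge0.
  - exact: (measurable_psi_riemann_kernel HY).
  - exact: (emeasurable_funD (mk _ _) (mk _ _)).
  move=> x _; apply: le_trans (HK _) _; rewrite -!EFinM -EFinD lee_fin.
  rewrite normrM (gtr0_norm z0) ger0_norm ?riemann_kernel_ge0 ?(ltW h0)//.
  have kn := riemann_kernel_ge0 n x (ltW h0).
  by rewrite mulrDr !(powRM _ (ltW z0) kn) !mulrA.
have iZ r : (\int[Q]_x ((K * z `^ r)%:E * (riemann_kernel h n x `^ r)%:E) =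
    (K * z `^ r)%:E * \int[Q]_x (riemann_kernel h n x `^ r)%:E)%E.
  apply: ge0_integralZl_EFin => //; first by move=> x _; rewrite lee_fin powR_ge0.
  exact: mp.
rewrite ge0_integralD//; last 4 first.
- by move=> x _; rewrite -EFinM lee_fin mulr_ge0 ?powR_ge0.
- exact: mk.
- by move=> x _; rewrite -EFinM lee_fin mulr_ge0 ?powR_ge0.
- exact: mk.
rewrite !iZ.
set CJ := 2 `^ e * (1 + J) in I1 I2 *.
apply: (@le_trans _ _ ((K * z `^ r1 * (t `^ (r1 - e) * CJ))%:E +
  (K * z `^ r2 * (t `^ (r2 - e) * CJ))%:E)%E).
  by apply: leeD; rewrite (EFinM (K * _)); apply: lee_wpmul2l => //; rewrite lee_fin.
have CJ0 : 0 <= CJ by rewrite mulr_ge0 ?powR_ge0 ?addr_ge0.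
rewrite -EFinD lee_fin.
have -> : 2 * K * CJ * t `^ (r1 - e) * z `^ r2 =
    K * CJ * (z `^ r2 * t `^ (r1 - e)) + K * CJ * (z `^ r2 * t `^ (r1 - e)) by ring.
have KC : 0 <= K * CJ by rewrite mulr_ge0.
apply: lerD.
  rewrite (_ : _ * _ * (_ * _) = K * CJ * (z `^ r1 * t `^ (r1 - e))); last by ring.
  by rewrite ler_wpM2l// ler_wpM2r ?powR_ge0// ger_powR// z0.
rewrite (_ : _ * _ * (_ * _) = K * CJ * (z `^ r2 * t `^ (r2 - e))); last by ring.
rewrite ler_wpM2l// ler_wpM2l ?powR_ge0// ler_powR// lerB//.
Qed.

Lemma integrated_moment_bound (delta : R) : 0 < delta -> exists2 q : R,
  1 < q < q0 /\ q0 - delta < q & exists2 C : R, 0 <= C & forall t : R, 1 <= t ->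
  (\int[P]_w (`|X t w| `^ q)%:E <= (C * t `^ (q0 - alpha + delta))%:E)%E.
Proof.
have A0' := alpha_gt0; have Q1 := q0_ge; have Q2 := q0_lt2.
(* [delta / 4] limits the loss in the exponents, [alpha / 4] keeps [e > 0] and [q > 1], and
   [(2 - q0) / 2] keeps [r1 <= 2]. Lowering [alpha] and [q0] by the same [eta] preserves
   [1 + e <= r2]. *)
move=> delta0; pose eta := Num.min (delta / 4) (Num.min (alpha / 4) ((2 - q0) / 2)).
have eta0 : 0 < eta by rewrite /eta !lt_min; apply/and3P; split; lra.
have eta1 : eta <= delta / 4 by rewrite /eta ge_min lexx.
have eta2 : eta <= alpha / 4 by rewrite /eta !ge_min lexx orbT.
have eta3 : eta <= (2 - q0) / 2 by rewrite /eta !ge_min lexx !orbT.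
move: eta eta0 eta1 eta2 eta3 => eta eta0 eta1 eta2 eta3.
pose r1 := q0 + eta; pose r2 := q0 - eta; pose q := q0 - 2 * eta; pose e := alpha - eta.
have [K K0 HK] : exists2 K : R, 0 <= K & forall z : R, (psi mu z <= (K * (`|z| `^ r1 + `|z| `^ r2))%:E)%E.
  by apply: psi_power_bound; apply/andP; rewrite /r1 /r2; split; lra.
have hJ : (\int[pi]_(x in [set x | (0 < x)%R]) (x^-1 `^ e)%:E < +oo)%E.
  by apply: inverse_moment; apply/andP; rewrite /e; split; lra.
have J0 : (0 <= \int[pi]_(x in [set x | (0 < x)%R]) (x^-1 `^ e)%:E)%E.
  by apply: integral_ge0 => x _; rewrite lee_fin powR_ge0.
set J := (\int[pi]_(x in _) _)%E in hJ J0.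
have HJ : (J <= (fine J)%:E)%E by rewrite fineK// ge0_fin_numE.
have fJ0 : 0 <= fine J by exact: fine_ge0.
have r0q : 1 < (1 + q0) / 2 <= 2 by apply/andP; split; lra.
have Yr : (\int[P]_w (`|Y 1%R w| `^ ((1 + q0) / 2))%:E < +oo)%E.
  by apply: Y1_moment; apply/andP; split; lra.
have iY := supOU_integrable HY r0q Yr.
have Y0 := supOU_mean0 HY r0q Yr EY1.
have r21 : 1 < r2 <= r1 by apply/andP; rewrite /r1 /r2; split; lra.
have contY := supOU_L1_continuous HY pi_pos r0q Yr EY1 K0 r21 HK.
(* One factor 2 comes from [riemann_psi_le], the other from [riemann_char_sq]. *)
pose M := 4 * K * (2 `^ e * (1 + fine J)).
have M0 : 0 <= M by rewrite !mulr_ge0 ?powR_ge0 ?addr_ge0.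
pose A t := M * t `^ (r1 - e).
have A0 t : 0 <= A t by rewrite mulr_ge0 ?powR_ge0.
have cK : 0 <= cosK q r2.
  have qr2 : q < r2 by rewrite /q /r2; lra.
  rewrite /cosK invr_ge0 mulr_ge0 ?onem_cos_ge0// subr_ge0 ltW//.
  by have /andP[] := powR2_lt1 qr2.
pose C := 1 + cosK q r2 * M.
exists q; first by split; [apply/andP; split|]; rewrite /q; lra.
exists C; first by rewrite addr_ge0// mulr_ge0.
move=> t t1; have t0 : 0 < t by exact: lt_le_trans t1.
(* With this choice [z0^(-q) <= t^(theta q0) = t^(q0 - alpha)], while [z0 <= 1] as [riemann_psi_le]
   requires. *)
pose theta := (q0 - alpha) / q0.
have q00 : 0 < q0 by lra.
have th0 : 0 <= theta by rewrite divr_ge0; lra.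
pose z0 := t `^ (- theta).
have z00 : 0 < z0 by exact: powR_gt0.
have z01 : z0 <= 1 by rewrite /z0 -(powRr0 t) ler_powR// oppr_le0.
have qr : 1 <= q < r2 by apply/andP; rewrite /q /r2; split; lra.
have hchar (z : R) : 0 < z <= z0 ->
    1 - (\int[P]_w cos (z * X t w)) ^+ 2 - (\int[P]_w sin (z * X t w)) ^+ 2 <= A t * z `^ r2.
  move=> /andP[zp zz0]; apply: (integrated_char_sq mY2 locY contY) => // n h h01 nh.
  have := @riemann_psi_le r1 r2 e K (fine J) h z n K0 HK HJ fJ0.
  rewrite nh => /(_ _ _ _ h01 t1) H.
  apply: le_trans (riemann_char_sq HY (H _ _ _ _)) _.
  - by rewrite /e; lra.
  - by rewrite /e /r2; lra.
  - by rewrite /r1 /r2; lra.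
  - by rewrite zp (le_trans zz0).
  by rewrite le_eqVlt; apply/orP; left; apply/eqP; rewrite /A /M; ring.
have iX := integrable_integrated mY2 locY contY iY t0.
have X0 := integrated_mean0 mY2 locY contY iY t0 Y0.
apply: le_trans (moment_le_char iX X0 qr z00 (A0 t) hchar) _.
rewrite lee_fin /C mulrDl mul1r; apply: lerD.
  rewrite /z0 -powRrM mulrNN ler_powR//.
  apply: (@le_trans _ _ (theta * q0)).
    by rewrite ler_wpM2l// /q; lra.
  by rewrite /theta divfK ?gt_eqF//; lra.
have -> : cosK q r2 * A t * z0 `^ (r2 - q) = cosK q r2 * M * (t `^ (r1 - e) * z0 `^ (r2 - q)).
  by rewrite /A; ring.
apply: ler_wpM2l; first exact: mulr_ge0.
apply: (@le_trans _ _ (t `^ (r1 - e) * 1)).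
  rewrite ler_wpM2l ?powR_ge0// -(powRr0 z0) ger_powR ?z00//.
  by rewrite /r2 /q; lra.
by rewrite mulr1 ler_powR// /r1 /e; lra.
Qed.

(** Only []0, 1/t]] times [[-1, 0]] is kept: its product measure is the [pi]-mass of []0, 1/t]], and
    there kernel over [t] lies in [[exp (-2), 1]], where [psi] is at least [c]. *)
Lemma integrated_cos_exp_le : (exists2 zeta : R, 0 < zeta & exists2 c : R, 0 < c &
    forall y : R, expR (- 2) <= y <= 1 -> (c%:E <= psi mu (zeta * y))%E) ->
  exists2 zeta : R, 0 < zeta & exists2 c : R, 0 < c & forall t : R, 1 <= t ->
    \int[P]_w cos (zeta / t * X t w) <= expR (- (c * fine (pi `]0, t^-1]%classic))).
Proof.
have A0' := alpha_gt0; have Q1 := q0_ge; have Q2 := q0_lt2.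
move=> [zeta zeta0 [c c0 Hc]]; exists zeta => //; exists c => // t t1.
have t0 : 0 < t by exact: lt_le_trans t1.
(* Any exponents with [1 < r2 < q0 < r1 <= 2] would do; they serve only to obtain L1 continuity. *)
pose r1 := (q0 + 2) / 2; pose r2 := (1 + q0) / 2.
have [K K0 HK] : exists2 K : R, 0 <= K & forall z : R, (psi mu z <= (K * (`|z| `^ r1 + `|z| `^ r2))%:E)%E.
  by apply: psi_power_bound; apply/andP; rewrite /r1 /r2; split; lra.
have r0q : 1 < (1 + q0) / 2 <= 2 by apply/andP; split; lra.
have Yr : (\int[P]_w (`|Y 1%R w| `^ ((1 + q0) / 2))%:E < +oo)%E.
  by apply: Y1_moment; apply/andP; split; lra.
have r21 : 1 < r2 <= r1 by apply/andP; rewrite /r1 /r2; split; lra.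
have contY := supOU_L1_continuous HY pi_pos r0q Yr EY1 K0 r21 HK.
apply: (integrated_cos_le mY2 locY contY) => // n h /andP[h0 h1] nh.
apply: (riemann_cos_le HY).
pose E : set (R * R) := `]0, t^-1]%classic `*` `[(-1)%R, 0%R]%classic.
have mE : measurable E by apply: measurableX; exact: measurable_itv.
have pfin : pi `]0, t^-1]%classic \is a fin_num by rewrite fin_num_measure.
have QE : Q E = pi `]0, t^-1]%classic.
  rewrite product_measure1E//.
  have l1 : leb `[(-1)%R, 0%R]%classic = 1%E.
    by rewrite lebesgue_measure_itv/= lte_fin ltrN10 -EFinD add0r opprK.
  by rewrite [X in (_ * X)%E](_ : _ = 1%E) ?mule1//; exact: l1.
rewrite EFinM fineK// -QE.
have <- : (\int[Q]_(x in E) c%:E = c%:E * Q E)%E by rewrite integral_cst//; exact: mE.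
apply: (@le_trans _ _ (\int[Q]_(x in E) psi mu (zeta / t * riemann_kernel h n x)%R)%E); last first.
  apply: ge0_subset_integral => //; first exact: (measurable_psi_riemann_kernel HY).
  by move=> x _; exact: psi_ge0.
apply: ge0_le_integral => //.
- by move=> x _; rewrite lee_fin ltW.
- by apply: measurable_funTS; exact: (measurable_psi_riemann_kernel HY).
move=> [xi s] [/=]; rewrite !in_itv/= => /andP[xi0 xit] s10.
rewrite -mulrA; apply: Hc; rewrite ler_pdivlMl// ler_pdivrMl// mulr1 -nh.
rewrite riemann_kernel_le ?(ltW h0)// andbT; apply: riemann_kernel_ge => //; rewrite ?(ltW h0) ?(ltW xi0)//.
by rewrite nh -ler_pdivlMr// div1r.
Qed.

End moments_of_integral.

(** * Rates at infinity *)

Section limits_at_infinity.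
Context {R : realType}.
Implicit Types (f : R -> \bar R) (l : R).

Lemma liminf_pinfty_ge f l :
  (forall delta : R, 0 < delta -> exists t0 : R, forall t : R, t0 <= t -> ((l - delta)%:E <= f t)%E) ->
  (l%:E <= liminf_pinfty f)%E.
Proof.
move=> H; apply/lee_addgt0Pr => e e0; have [t0 Ht] := H e e0.
rewrite -leeBlDr// -EFinB.
apply: (@le_trans _ _ (ereal_inf (f @` `[t0, +oo[%classic))).
  apply: le_ereal_inf_tmp => ? [t /=]; rewrite in_itv/= andbT => t0t <-; exact: Ht.
by apply: ereal_sup_ubound; exists t0.
Qed.

Lemma limsup_pinfty_le f l :
  (forall delta : R, 0 < delta -> exists t0 : R, forall t : R, t0 <= t -> (f t <= (l + delta)%:E)%E) ->
  (limsup_pinfty f <= l%:E)%E.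
Proof.
move=> H; apply/lee_addgt0Pr => e e0; have [t0 Ht] := H e e0.
rewrite -EFinD.
apply: (@le_trans _ _ (ereal_sup (f @` `[t0, +oo[%classic))).
  by apply: ereal_inf_lbound; exists t0.
apply: ge_ereal_sup => ? [t /=]; rewrite in_itv/= andbT => t0t <-; exact: Ht.
Qed.

Lemma liminf_limsup_pinfty f : (liminf_pinfty f <= limsup_pinfty f)%E.
Proof.
apply: ge_ereal_sup => ? [M _ <-]; apply: le_ereal_inf_tmp => ? [N _ <-].
apply: (@le_trans _ _ (f (Num.max M N))).
  apply: ereal_inf_lbound; exists (Num.max M N) => //=.
  by rewrite in_itv/= andbT le_max lexx.
apply: ereal_sup_ubound; exists (Num.max M N) => //=.
by rewrite in_itv/= andbT le_max lexx orbT.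
Qed.

Lemma power_decay (C kappa e : R) : 0 < kappa -> 0 < e ->
  exists2 t0 : R, 1 <= t0 & forall t : R, t0 <= t -> C * t `^ (- kappa) <= e.
Proof.
move=> k0 e0; pose y := (`|C| + 1) / e; have y0 : 0 < y by rewrite divr_gt0// ltr_wpDl.
exists (Num.max 1 (y `^ kappa^-1)); first by rewrite le_max lexx.
move=> t; rewrite ge_max => /andP[t1 ty].
have t0 : 0 < t by exact: lt_le_trans t1.
rewrite powRN ler_pdivrMr ?powR_gt0//.
have : y <= t `^ kappa.
  have <- : (y `^ kappa^-1) `^ kappa = y by rewrite -powRrM mulVf ?gt_eqF// powRr1// ltW.
  by rewrite ge0_ler_powR ?nnegrE ?powR_ge0// ltW.
rewrite ler_pdivrMr// mulrC => h.
by have := ler_norm C; lra.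
Qed.

End limits_at_infinity.

Lemma measurable_normr_band (d : measure_display) (T : measurableType d) (R : realType)
    (Z : T -> R) (x y : R) : measurable_fun setT Z ->
  measurable [set w | x < `|Z w| < y].
Proof.
move=> mZ; have mn : measurable_fun setT (fun w => `|Z w|) by apply: measurableT_comp.
have -> : [set w | x < `|Z w| < y] = [set w | x < `|Z w|] `\` [set w | y <= `|Z w|].
  apply/seteqP; split => w /=; first by move=> /andP[-> h]; split => //; apply/negP; rewrite -ltNge.
  by move=> [-> /negP]; rewrite -ltNge.
by apply: measurableD; [exact: measurable_ltr|exact: measurable_ler].
Qed.

Section log_probability.
Context {R : realType} {d : measure_display} {T : measurableType d}.
Variables (P : probability T R) (X : R -> T -> R) (eps : R).
Hypothesis mX : forall t : R, measurable_fun setT (X t).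

Let A (t : R) := [set w | t `^ (1 - eps) < `|X t w| < t `^ (1 + eps)].

Let mA t : measurable (A t).
Proof. exact: measurable_normr_band. Qed.

Lemma liminf_log_prob_ge l :
  (forall delta : R, 0 < delta -> exists t0 : R, forall t : R, t0 <= t ->
    ((t `^ (l - delta))%:E <= P (A t))%E) ->
  (l%:E <= liminf_pinfty (log_prob_ratio P X eps))%E.
Proof.
move=> H; apply: liminf_pinfty_ge => delta d0; have [t0 Ht] := H _ d0.
exists (Num.max t0 2) => t; rewrite ge_max => /andP[t0t t2].
have t1 : 1 < t by apply: lt_le_trans t2; rewrite ltr1n.
have tp : 0 < t by exact: lt_trans t1.
have lt0 : 0 < ln t by exact: ln_gt0.
have := Ht t t0t; rewrite /log_prob_ratio -/(A t).
have pf : P (A t) \is a fin_num by rewrite fin_num_measure.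
rewrite -(fineK pf) lee_fin; set p := fine _ => hp.
have p0 : 0 < p by apply: lt_le_trans hp; exact: powR_gt0.
rewrite /eln p0 -EFinM lee_fin ler_pdivlMr// -ln_powR ler_ln ?posrE// powR_gt0//.
Qed.

Lemma limsup_log_prob_le l :
  (forall delta : R, 0 < delta -> exists t0 : R, forall t : R, t0 <= t ->
    (P (A t) <= (t `^ (l + delta))%:E)%E) ->
  (limsup_pinfty (log_prob_ratio P X eps) <= l%:E)%E.
Proof.
move=> H; apply: limsup_pinfty_le => delta d0; have [t0 Ht] := H _ d0.
exists (Num.max t0 2) => t; rewrite ge_max => /andP[t0t t2].
have t1 : 1 < t by apply: lt_le_trans t2; rewrite ltr1n.
have tp : 0 < t by exact: lt_trans t1.
have lt0 : 0 < ln t by exact: ln_gt0.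
have := Ht t t0t; rewrite /log_prob_ratio -/(A t).
have pf : P (A t) \is a fin_num by rewrite fin_num_measure.
rewrite -(fineK pf) lee_fin; set p := fine _ => hp.
(* A null event gives [eln = -oo], and [ln t > 0] leaves the ratio at [-oo]. *)
rewrite /eln; case: ifPn => p0; last first.
  by rewrite gt0_mulNye ?leNye// lte_fin invr_gt0.
by rewrite -EFinM lee_fin ler_pdivrMr// -ln_powR ler_ln ?posrE// powR_gt0.
Qed.

End log_probability.

Lemma normr_powR2 (R : realType) (y : R) : `|y| `^ 2 = y ^+ 2.
Proof. by rewrite -[2]/(2%:R) powR_mulrn// real_normK ?num_real. Qed.

Section probability_estimates.
Context {R : realType} {d : measure_display} {T : measurableType d}.
Variable P : probability T R.

Lemma markov_powR (Z : T -> R) (M q : R) : measurable_fun setT Z -> 0 < M -> 0 <= q ->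
  ((M `^ q)%:E * P [set w | (M <= `|Z w|)%R] <= \int[P]_w (`|Z w| `^ q)%:E)%E.
Proof.
move=> mZ M0 q0.
have mn : measurable_fun setT (fun w => `|Z w|) by apply: measurableT_comp.
have mB := measurable_ler M mn.
rewrite -(integral_cst P mB (M `^ q)%:E).
have mp := measurable_normr_powR q mZ.
apply: (@le_trans _ _ (\int[P]_(w in [set w | (M <= `|Z w|)%R]) (`|Z w| `^ q)%:E)%E).
  apply: ge0_le_integral => //.
  - by move=> w _; rewrite lee_fin powR_ge0.
  - exact: measurable_funTS.
  by move=> w /= Mw; rewrite lee_fin ge0_ler_powR ?nnegrE// ltW.
exact: ge0_subset_integral.
Qed.

(** [1 - cos] is at most 2 beyond [M], and at most [2 z^2 Z^2 <= 2 z^2 M^(2-q) |Z|^q] below it. A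
    lower bound on [1 - E cos] thereby becomes a lower bound on the tail at [M]. *)
Lemma onem_cos_le_tail (Z : T -> R) (z M q C : R) : measurable_fun setT Z ->
  0 < M -> 0 <= q <= 2 -> (\int[P]_w (`|Z w| `^ q)%:E <= C%:E)%E ->
  1 - \int[P]_w cos (z * Z w) <=
    2 * fine (P [set w | (M < `|Z w|)%R]) + 2 * z ^+ 2 * M `^ (2 - q) * C.
Proof.
move=> mZ M0 /andP[q0 q2] HC.
have mn : measurable_fun setT (fun w => `|Z w|) by apply: measurableT_comp.
set B := [set w | (M < `|Z w|)%R].
have mB : measurable B by exact: measurable_ltr.
have mp := measurable_normr_powR q mZ.
pose k := 2 * z ^+ 2 * M `^ (2 - q).
have k0 : 0 <= k by rewrite mulr_ge0 ?powR_ge0// mulr_ge0 ?sqr_ge0.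
have m1 : measurable_fun setT (fun w => (2 * \1_B w)%:E : \bar R).
  by apply/measurable_EFinP; apply: measurable_funM => //; exact: measurable_indic.
have m2 : measurable_fun setT (fun w => k%:E * (`|Z w| `^ q)%:E)%E by exact: measurable_funeM.
rewrite -lee_fin -integral_onem_cos//.
apply: (@le_trans _ _ (\int[P]_w ((2 * \1_B w)%:E + k%:E * (`|Z w| `^ q)%:E))%E).
  apply: ge0_le_integral => //.
  - by apply/measurable_EFinP; apply: measurable_funB => //; exact: measurable_cosM.
  - exact: emeasurable_funD.
  move=> w _; rewrite -EFinM -EFinD lee_fin indicE.
  have [wB|] := boolP (w \in B).
    rewrite mulr1; have := cos_geN1 (z * Z w).
    have : 0 <= k * `|Z w| `^ q by rewrite mulr_ge0 ?powR_ge0.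
    lra.
  rewrite notin_setE /B/= => /negP; rewrite -leNgt => wM; rewrite mulr0 add0r.
  have := @onem_cos_le R (z * Z w) 2; rewrite lexx ler0n => /(_ isT) /le_trans; apply.
  have [Z0|Z0] := eqVneq (Z w) 0.
    by rewrite Z0 mulr0 normr0 powR0 ?pnatr_eq0// mulr0 mulr_ge0// powR_ge0.
  have nZ : 0 < `|Z w| by rewrite normr_gt0.
  have -> : `|z * Z w| `^ 2 = z ^+ 2 * `|Z w| `^ 2 by rewrite !normr_powR2 exprMn.
  have -> : k * `|Z w| `^ q = 2 * (z ^+ 2 * (M `^ (2 - q) * `|Z w| `^ q)) by rewrite /k; ring.
  apply: ler_wpM2l => //; apply: ler_wpM2l; first exact: sqr_ge0.
  have -> : `|Z w| `^ 2 = `|Z w| `^ (2 - q) * `|Z w| `^ q by rewrite -gt0_powRD// subrK.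
  rewrite ler_wpM2r ?powR_ge0// ge0_ler_powR ?nnegrE ?subr_ge0// ltW//.
rewrite ge0_integralD//; last by move=> w _; rewrite mule_ge0.
have pf : P B \is a fin_num by rewrite fin_num_measure.
rewrite EFinD; apply: leeD.
  under eq_integral do rewrite EFinM.
  rewrite ge0_integralZl_EFin//; last by apply/measurable_EFinP; exact: measurable_indic.
  by rewrite integral_indic// setIT EFinM fineK.
rewrite ge0_integralZl_EFin// -/k (EFinM _ C); exact: lee_wpmul2l.
Qed.

End probability_estimates.

(** * The two bounds on the rate *)

Section rate.
Context {R : realType} {d : measure_display} {T : measurableType d}.
Variables (P : probability T R) (X : R -> T -> R) (m : R -> R).
Variables (alpha q0 eps : R).
Hypothesis mX : forall t : R, measurable_fun setT (X t).
Hypothesis alpha_gt0 : 0 < alpha.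
Hypothesis q0_ge : 1 + alpha <= q0.
Hypothesis q0_lt2 : q0 < 2.
Hypothesis moment_bound : forall delta : R, 0 < delta -> exists2 q : R,
  1 < q < q0 /\ q0 - delta < q & exists2 C : R, 0 <= C & forall t : R, 1 <= t ->
  (\int[P]_w (`|X t w| `^ q)%:E <= (C * t `^ (q0 - alpha + delta))%:E)%E.
Hypothesis cos_exp_le : exists2 zeta : R, 0 < zeta & exists2 c : R, 0 < c & forall t : R, 1 <= t ->
    \int[P]_w cos (zeta / t * X t w) <= expR (- (c * m t^-1)).
Hypothesis mass_lower : forall a : R, alpha < a -> exists2 x1 : R, 0 < x1 &
  exists2 c : R, 0 < c & forall x : R, 0 < x <= x1 -> c * x `^ a <= m x.
Hypothesis eps_gt0 : 0 < eps.
Hypothesis eps_lt : eps < alpha / q0.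

Let A (t : R) := [set w | t `^ (1 - eps) < `|X t w| < t `^ (1 + eps)].

Let mn t : measurable_fun setT (fun w => `|X t w|).
Proof. by apply: measurableT_comp. Qed.

Let tail_le (q C e t : R) : 1 <= t -> 0 <= q ->
  (\int[P]_w (`|X t w| `^ q)%:E <= (C * t `^ e)%:E)%E -> forall s : R,
  fine (P [set w | (t `^ s <= `|X t w|)%R]) <= C * t `^ (e - s * q).
Proof.
move=> t1 q1 H s; have t0 : 0 < t by exact: lt_le_trans t1.
have mB := measurable_ler (t `^ s) (mn t).
have pf : P [set w | (t `^ s <= `|X t w|)%R] \is a fin_num by rewrite fin_num_measure.
have := le_trans (markov_powR P (mX t) (powR_gt0 s t0) q1) H.
rewrite -{1}(fineK pf) -EFinM lee_fin -powRrM mulrC -ler_pdivlMr ?powR_gt0//.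
by rewrite -mulrA -powRN -gt0_powRD.
Qed.

Let mA t : measurable (A t).
Proof. exact: measurable_normr_band. Qed.

Let eps_lt1 : eps < 1.
Proof.
apply: (lt_le_trans eps_lt); rewrite ler_pdivrMr ?mul1r.
  by apply: le_trans q0_ge; rewrite lerDr.
by apply: lt_le_trans q0_ge; rewrite addr_gt0.
Qed.

Lemma rate_upper (delta : R) : 0 < delta -> exists t0 : R, forall t : R, t0 <= t ->
  (P (A t) <= (t `^ (- (alpha - q0 * eps) + delta))%:E)%E.
Proof.
move=> d0; have d4 : 0 < delta / 4 by rewrite divr_gt0.
have [q [/andP[q1 qq0] qd] [C C0 HC]] := moment_bound d4.
have d2 : 0 < delta / 2 by rewrite divr_gt0.
have [t0 t01 Ht] := power_decay C d2 ltr01.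
exists t0 => t t0t; have t1 : 1 <= t by exact: le_trans t0t.
have tp : 0 < t by exact: lt_le_trans t1.
have qp : 0 <= q by rewrite (le_trans ler01)// ltW.
have h1 := tail_le t1 qp (HC t t1) (1 - eps).
have mB := measurable_ler (t `^ (1 - eps)) (mn t).
have pf : P [set w | (t `^ (1 - eps) <= `|X t w|)%R] \is a fin_num by rewrite fin_num_measure.
apply: (@le_trans _ _ (P [set w | (t `^ (1 - eps) <= `|X t w|)%R])).
  by apply: le_measure; rewrite ?inE; [exact: mA|exact: mB|move=> w /= /andP[/ltW]].
rewrite -(fineK pf) lee_fin; apply: (le_trans h1).
(* Half of [delta] pays for the moment exponent and for [(1 - eps)(q0 - q) <= q0 - q < delta / 4];
   the other half absorbs [C]. *)
apply: (@le_trans _ _ (C * t `^ (- (alpha - q0 * eps) + delta / 2))).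
  rewrite ler_wpM2l// ler_powR//.
  have e1 : (1 - eps) * (q0 - q) <= q0 - q.
    by rewrite ler_piMl ?subr_ge0 ?(ltW qq0)// gerBl ltW.
  have := e1; have -> : (1 - eps) * (q0 - q) = q0 - q0 * eps - (1 - eps) * q by ring.
  lra.
have -> : - (alpha - q0 * eps) + delta / 2 = (- (alpha - q0 * eps) + delta) + (- (delta / 2)) by lra.
by rewrite gt0_powRD// mulrCA ler_piMr ?powR_ge0// Ht.
Qed.

Lemma rate_lower (delta : R) : 0 < delta -> exists t0 : R, forall t : R, t0 <= t ->
  ((t `^ (- alpha - delta))%:E <= P (A t))%E.
Proof.
move=> d0; have E0 := eps_gt0; have Q2 := q0_lt2; have E1 := eps_lt1.
have Q0 := q0_ge; have A0 := alpha_gt0.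
have eq0 : 0 < eps * (2 - q0) by rewrite mulr_gt0// subr_gt0.
(* Both error terms must be smaller than [E = t^(-(alpha + d1))] by a factor [t^(-5 d1)]. As
   [q0 - q < d1], this asks for [8 d1 <= eps (2 - q0)] in the truncated part and [8 d1 <= eps] in
   the upper tail. *)
have [d1 [d10 d1d d1e d1q]] : exists d1, [/\ 0 < d1, d1 <= delta / 4, d1 <= eps / 8 &
    d1 <= eps * (2 - q0) / 8].
  exists (Num.min (delta / 4) (Num.min (eps / 8) (eps * (2 - q0) / 8))).
  split; last 3 first.
  - by rewrite ge_min lexx.
  - by rewrite !ge_min lexx orbT.
  - by rewrite !ge_min lexx !orbT.
  by rewrite !lt_min !divr_gt0.
have [q [/andP[q1 qq0] qd] [C C0 HC]] := moment_bound d10.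
have [zeta zeta0 [c c0 Hcos]] := cos_exp_le.
have al : alpha < alpha + d1 by rewrite ltrDl.
have [x1 x10 [c1 c10 Hm]] := mass_lower al.
pose x := c * c1; have xp : 0 < x by rewrite mulr_gt0.
(* For [0 <= E <= 1], [exp (- x E) <= 1 / (1 + x E) <= 1 - c2 E]; the last gap is [c2 x E (1 - E)]
   over [1 + x E]. *)
pose c2 := x / (1 + x); have c20 : 0 < c2 by rewrite divr_gt0// addr_gt0.
have c2x : c2 * (1 + x) = x by rewrite divfK// gt_eqF// addr_gt0.
have d5 : 0 < 5 * d1 by rewrite mulr_gt0.
have dd : 0 < delta - d1 by lra.
(* With [W = c2 E]: the truncated part costs at most [W / 2], so [P (|X t| > M) >= W / 4]; the upper
   tail removes at most [W / 8], and the remaining [W / 8] dominates [t^(- alpha - delta)]. *)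
have [t2 _ H2] := power_decay (2 * zeta ^+ 2 * C) d5 (divr_gt0 c20 (ltr0Sn R 1)).
have [t3 _ H3] := power_decay C d5 (divr_gt0 c20 (ltr0Sn R 7)).
have [t4 _ H4] := power_decay 1 dd (divr_gt0 c20 (ltr0Sn R 7)).
exists (Num.max (Num.max t2 t3) (Num.max t4 (Num.max 1 x1^-1))) => t.
rewrite !ge_max -!andbA => /and5P[/H2 {}H2 /H3 {}H3 /H4 {}H4 t1 tx].
have tp : 0 < t by exact: lt_le_trans t1.
pose E := t `^ (- (alpha + d1)); have E0' : 0 < E by exact: powR_gt0.
have E1' : E <= 1 by rewrite /E -(powRr0 t) ler_powR// oppr_le0 addr_ge0// ltW.
have qp : 0 <= q by rewrite (le_trans ler01)// ltW.
have q2 : 0 <= q <= 2 by rewrite qp/=; lra.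
pose e := q0 - alpha + d1.
have Hmt : c1 * E <= m t^-1.
  have -> : E = (t^-1) `^ (alpha + d1).
    by rewrite -powR_inv1 ?(ltW tp)// -powRrM mulN1r.
  by apply: Hm; rewrite invr_gt0 tp/= invf_ple ?posrE.
have Hc : \int[P]_w cos (zeta / t * X t w) <= 1 - c2 * E.
  apply: (le_trans (Hcos t t1)); apply: (@le_trans _ _ (expR (- (x * E)))).
    by rewrite ler_expR lerN2 /x -mulrA ler_wpM2l// ltW.
  have yp : 0 < 1 + x * E by rewrite addr_gt0// mulr_gt0.
  have h : 1 + x * E <= expR (x * E) := expR_ge1Dx _.
  rewrite expRN; apply: (@le_trans _ _ (1 + x * E)^-1).
    by rewrite lef_pV2 ?posrE// expR_gt0.
  rewrite -[leLHS]mul1r ler_pdivrMr// -subr_ge0.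
  have -> : (1 - c2 * E) * (1 + x * E) - 1 = x * E - c2 * E - c2 * x * E ^+ 2 by ring.
  rewrite -{1}c2x.
  have -> : c2 * (1 + x) * E - c2 * E - c2 * x * E ^+ 2 = c2 * x * E * (1 - E) by ring.
  apply: mulr_ge0; last by rewrite subr_ge0.
  by apply: ltW; apply: mulr_gt0 => //; exact: mulr_gt0.
pose M := t `^ (1 - eps); have M0 : 0 < M by exact: powR_gt0.
have Hup := onem_cos_le_tail (zeta / t) (mX t) M0 q2 (HC t t1).
have tE : t `^ (- (alpha + d1) - 5 * d1) = t `^ (- (5 * d1)) * E.
  by rewrite addrC gt0_powRD.
have qe : (q0 - q) + 7 * d1 <= eps * (2 - q).
  have : eps * (2 - q0) <= eps * (2 - q) by rewrite ler_wpM2l ?(ltW E0)//; lra.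
  lra.
have T2 : 2 * (zeta / t) ^+ 2 * M `^ (2 - q) * (C * t `^ e) <= c2 / 2 * E.
  have -> : 2 * (zeta / t) ^+ 2 * M `^ (2 - q) * (C * t `^ e) =
      2 * zeta ^+ 2 * C * t `^ (- 2 + (1 - eps) * (2 - q) + e).
    have t2E : t `^ (- 2) = (t ^+ 2)^-1 by rewrite powRN -normr_powR2 gtr0_norm.
    rewrite !(gt0_powRD _ _ tp) t2E /M -powRrM exprMn exprVn.
    ring.
  apply: (@le_trans _ _ (2 * zeta ^+ 2 * C * t `^ (- (alpha + d1) - 5 * d1))).
    rewrite ler_wpM2l//; first by rewrite mulr_ge0// mulr_ge0 ?sqr_ge0.
    rewrite ler_powR//.
    have -> : - 2 + (1 - eps) * (2 - q) + e = - q - eps * (2 - q) + e by ring.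
    rewrite /e; lra.
  by rewrite tE mulrA ler_wpM2r// ltW.
pose N := t `^ (1 + eps).
have T3 : fine (P [set w | (N <= `|X t w|)%R]) <= c2 / 8 * E.
  apply: (le_trans (tail_le t1 qp (HC t t1) (1 + eps))).
  apply: (@le_trans _ _ (C * t `^ (- (alpha + d1) - 5 * d1))).
    rewrite ler_wpM2l// ler_powR//.
    have : eps * 1 <= eps * q by rewrite ler_wpM2l ?(ltW E0)// ltW.
    have -> : q0 - alpha + d1 - (1 + eps) * q = q0 - alpha + d1 - q - eps * q by ring.
    lra.
  by rewrite tE mulrA ler_wpM2r// ltW.
have mB := measurable_ltr M (mn t); have mC := measurable_ler N (mn t).
have pf B : measurable B -> P B \is a fin_num by move=> mB'; rewrite fin_num_measure.
have U : (P [set w | (M < `|X t w|)%R] <= P (A t) + P [set w | (N <= `|X t w|)%R])%E.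
  apply: le_trans (measureU2 _ (mA t) mC).
  apply: le_measure; rewrite ?inE//; first exact: measurableU.
  move=> w /= Mw; have [h|h] := ltP `|X t w| N; [left|right] => //.
  by rewrite /A/= Mw.
move: U; rewrite -(fineK (pf _ (mA t))) -{1}(fineK (pf _ mB)) -(fineK (pf _ mC)).
rewrite -EFinD !lee_fin => U.
have -> : t `^ (- alpha - delta) = t `^ (- (delta - d1)) * E.
  by rewrite -gt0_powRD//; congr (_ `^ _); ring.
have h4 : t `^ (- (delta - d1)) * E <= c2 / 8 * E.
  by rewrite ler_wpM2r ?(ltW E0')// -[leLHS]mul1r.
apply: (le_trans h4).
set pM := fine (P [set w | (M < `|X t w|)%R]) in Hup U.
set W := c2 * E in Hc.
have w2 : c2 / 2 * E = W / 2 by rewrite /W; ring.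
have w8 : c2 / 8 * E = W / 8 by rewrite /W; ring.
rewrite w8 in T3 *; rewrite w2 in T2; clear -Hc Hup T2 T3 U; lra.
Qed.

End rate.

Section supou_rate.
Context {R : realType} {d : measure_display} {T : measurableType d}.
Variables (P : probability T R) (Y : R -> T -> R) (a : R).
Variables (mu : {measure set R -> \bar R}) (pi : probability R R).
Variables (pp qq gamma : R) (k : R -> R) (p : R -> R) (alpha : R) (ell : R -> R).
Variables (cp cm beta : R).
Hypothesis HY : supOU P Y a 0 mu pi.
Hypothesis mY2 : measurable_fun setT (fun z : R * T => Y z.1 z.2).
Hypothesis locY : forall t, 0 <= t ->
  {ae P, forall w, lebesgue_measure.-integrable `[0, t]%classic (EFin \o (Y ^~ w))}.
Hypothesis pq_gt0 : 0 < pp + qq.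
Hypothesis slow_k : slowly_varying k.
Hypothesis right_tail :
  (fine (P [set w | x < Y 1 w]) / (k x * x `^ (- gamma))) @[x --> +oo] --> pp.
Hypothesis left_tail :
  (fine (P [set w | Y 1 w <= - x]) / (k x * x `^ (- gamma))) @[x --> +oo] --> qq.
Hypothesis centred : P.-integrable setT (EFin \o Y 1) -> ('E_P[Y 1%R] = 0)%E.
Hypothesis alpha_gt0 : 0 < alpha.
Hypothesis slow_ell : slowly_varying ell.
Hypothesis mp : measurable_fun setT p.
Hypothesis p_ge0 : forall x, 0 <= x -> 0 <= p x.
Hypothesis piE : forall A, measurable A ->
  pi A = (\int[lebesgue_measure]_(x in A `&` `[0%R, +oo[%classic) (p x)%:E)%E.
Hypothesis p_near0 : (p x / (alpha * ell (x^-1) * x `^ (alpha - 1))) @[x --> 0^'+] --> (1 : R).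
Hypothesis cp_ge0 : 0 <= cp.
Hypothesis cm_ge0 : 0 <= cm.
Hypothesis cpm_gt0 : 0 < cp + cm.
Hypothesis beta_ge0 : 0 <= beta.
Hypothesis right_levy_tail :
  (mu `[x, +oo[%classic * (x `^ beta)%:E)%E @[x --> 0^'+] --> cp%:E.
Hypothesis left_levy_tail :
  (mu `]-oo, (- x)%R]%classic * (x `^ beta)%:E)%E @[x --> 0^'+] --> cm%:E.

Let pi_pos : pi `]-oo, 0]%classic = 0%E.
Proof.
rewrite piE; last exact: measurable_itv.
rewrite (_ : _ `&` _ = [set 0]) ?integral_set1//.
apply/seteqP; split => x /=; rewrite !in_itv/= ?andbT; last by move=> ->.
by move=> [x0 x1]; apply/le_anti; rewrite x0.
Qed.

Lemma supou_rate q0 eps : 1 + alpha <= q0 < 2 -> beta <= q0 <= gamma ->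
  0 < eps -> eps < alpha / q0 ->
  ((- alpha)%R%:E <= liminf_pinfty (log_prob_ratio P (integrated Y) eps))%E /\
  (liminf_pinfty (log_prob_ratio P (integrated Y) eps)
     <= limsup_pinfty (log_prob_ratio P (integrated Y) eps))%E /\
  (limsup_pinfty (log_prob_ratio P (integrated Y) eps)
     <= (- (alpha - q0 * eps))%R%:E)%E.
Proof.
move=> /andP[q0a q02] /andP[bq qg] eps0 epsa.
have mY1 := supOU_measurable HY 1.
have Y1_moment (r : R) : 0 < r < q0 -> (\int[P]_w (`|Y 1%R w| `^ r)%:E < +oo)%E.
  move=> /andP[r0 rq]; apply: (absolute_moment_lty mY1 pq_gt0 _ slow_k right_tail left_tail).
  by rewrite r0/= (lt_le_trans rq).
have q01 : 1 < q0 by apply: lt_le_trans q0a; rewrite ltrDl.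
have iY1 : P.-integrable setT (EFin \o Y 1).
  apply: integrable_normr_lty => //.
  have := Y1_moment 1; rewrite ltr01 q01 => /(_ isT).
  by under eq_integral do rewrite powRr1//.
have EY1 : \int[P]_w Y 1 w = 0.
  by have := centred iY1; rewrite unlock /Rintegral => ->.
have halving := density_halving_cvg alpha_gt0 slow_ell p_near0.
have inverse_moment (e : R) : 0 < e < alpha ->
    (\int[pi]_(x in [set x | (0 < x)%R]) (x^-1 `^ e)%:E < +oo)%E.
  exact: (inverse_moment_lty mp p_ge0 piE halving).
have mass_lower (e : R) := mass_lower_bound (ltW alpha_gt0) mp p_ge0 piE halving (a := e).
have small_jumps (r : R) : q0 < r ->
    (\int[mu]_(x in [set x | (`|x| <= 1)%R]) (`|x| `^ r)%:E < +oo)%E.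
  move=> qr; apply: (levy_small_moment cp_ge0 cm_ge0 beta_ge0
    right_levy_tail left_levy_tail); exact: le_lt_trans qr.
have psi_low := psi_lower_bound cp_ge0 cm_ge0 cpm_gt0
  right_levy_tail left_levy_tail.
have Hmom := integrated_moment_bound HY pi_pos mY2 locY alpha_gt0 q0a q02
  inverse_moment small_jumps Y1_moment EY1.
have Hcos := integrated_cos_exp_le HY pi_pos mY2 locY alpha_gt0 q0a q02
  small_jumps Y1_moment EY1 psi_low.
have mX := measurable_integrated mY2.
split; last split.
- apply: liminf_log_prob_ge => // delta d0.
  exact: (rate_lower mX alpha_gt0 q0a q02 Hmom Hcos mass_lower eps0 epsa d0).
- exact: liminf_limsup_pinfty.
apply: limsup_log_prob_le => // delta d0.
exact: (rate_upper mX Hmom eps0 d0).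
Qed.

End supou_rate.

Theorem theorem5p4 (R : realType) (d : measure_display) (T : measurableType d)
  (P : probability T R) (Y : R -> T -> R) (a b : R)
  (mu : {measure set R -> \bar R}) (pi : probability R R)
  (p0 q0 gamma : R) (k : R -> R)
  (p : R -> R) (alpha : R) (ell : R -> R)
  (cp cm beta : R) :
  (* Y is a supOU process with characteristic quadruple (a,b,mu,pi) *)
  supOU P Y a b mu pi ->
  (* a jointly measurable version with locally integrable paths, so that
     X(t) = \int_0^t Y(s) ds is well defined *)
  measurable_fun setT (fun z : R * T => Y z.1 z.2) ->
  (forall t, 0 <= t ->
     {ae P, forall w, lebesgue_measure.-integrable `[0, t]%classic (EFin \o (Y ^~ w))}) ->
  (* (1) *)
  0 <= p0 -> 0 <= q0 -> 0 < p0 + q0 -> 0 < gamma < 2 -> slowly_varying k ->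
  (fine (P [set w | x < Y 1 w]) / (k x * x `^ (- gamma))) @[x --> +oo] --> p0 ->
  (fine (P [set w | Y 1 w <= - x]) / (k x * x `^ (- gamma))) @[x --> +oo] --> q0 ->
  (gamma = 1 -> p0 = q0) ->
  (* (2) *)
  (P.-integrable setT (EFin \o Y 1) -> ('E_P[Y 1%R] = 0)%E) ->
  (* (3) *)
  0 < alpha -> slowly_varying ell ->
  measurable_fun setT p -> (forall x, 0 <= x -> 0 <= p x) ->
  (forall A, measurable A ->
     pi A = (\int[lebesgue_measure]_(x in A `&` `[0%R, +oo[%classic) (p x)%:E)%E) ->
  (p x / (alpha * ell (x^-1) * x `^ (alpha - 1))) @[x --> 0^'+] --> (1 : R) ->
  (* (4) *)
  0 <= cp -> 0 <= cm -> 0 < cp + cm -> 0 <= beta < 2 ->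
  (mu `[x, +oo[%classic * (x `^ beta)%:E)%E @[x --> 0^'+] --> cp%:E ->
  (mu `]-oo, (- x)%R]%classic * (x `^ beta)%:E)%E @[x --> 0^'+] --> cm%:E ->
  (* (5) *)
  (forall q : R, exists l : \bar R,
     log_ratio P (integrated Y) q t @[t --> +oo] --> l) ->
  interior [set q : R | (tau P (integrated Y) q < +oo)%E] 0 ->
  (* conclusions *)
  (b = 0 -> beta < 1 + alpha < gamma ->
   forall eps, 0 < eps < 1 - (1 + alpha)^-1 ->
     ((- alpha)%R%:E <= liminf_pinfty (log_prob_ratio P (integrated Y) eps))%E /\
     (liminf_pinfty (log_prob_ratio P (integrated Y) eps)
        <= limsup_pinfty (log_prob_ratio P (integrated Y) eps))%E /\
     (limsup_pinfty (log_prob_ratio P (integrated Y) eps)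
        <= (- (alpha - (1 + alpha) * eps))%R%:E)%E) /\
  (b = 0 -> 1 + alpha < beta <= gamma ->
   forall eps, 0 < eps < alpha / beta ->
     ((- alpha)%R%:E <= liminf_pinfty (log_prob_ratio P (integrated Y) eps))%E /\
     (liminf_pinfty (log_prob_ratio P (integrated Y) eps)
        <= limsup_pinfty (log_prob_ratio P (integrated Y) eps))%E /\
     (limsup_pinfty (log_prob_ratio P (integrated Y) eps)
        <= (- (alpha - beta * eps))%R%:E)%E).
Proof.
move=> HY mY2 locY _ _ pq0 /andP[g0 g2] sk rt lt _ cent al0 sl mp pge0 piE pn cp0 cm0 cd0 /andP[b0 b2] rl ll _ _.
split=> [b_eq0 /andP[b1 ag] eps /andP[e0 e1]|b_eq0 /andP[ab bg] eps /andP[e0 e1]].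
  rewrite b_eq0 in HY; apply: (supou_rate HY mY2 locY pq0 sk rt lt cent al0 sl mp pge0 piE pn cp0 cm0 cd0 b0 rl ll) => //.
  - by rewrite lexx/= (lt_trans ag).
  - by rewrite !ltW.
  have a1 : 1 + alpha != 0 by rewrite gt_eqF// addr_gt0.
  by have -> : alpha / (1 + alpha) = 1 - (1 + alpha)^-1 by field.
rewrite b_eq0 in HY; apply: (supou_rate HY mY2 locY pq0 sk rt lt cent al0 sl mp pge0 piE pn cp0 cm0 cd0 b0 rl ll) => //.
- by rewrite (ltW ab).
- by rewrite lexx.
Qed.
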